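(* Let $p\ge1$, $q>0$, $s>\max\{0,1-\frac qn\}$, let $\rho>0$ satisfy $\max\{0,q-n\}<\rho<\frac{q+ns-n}{1-s}$ if $0<s<1$, and $\rho>\max\{0,q-n\}$ if $s\ge1$, and put $k=\frac{p(n+\rho)}{q}$. Let $f(z)=\sum_\alpha a_\alpha z^\alpha\in H(\mathbb{B})$. If $$\{|a_\alpha|\,\omega_{\alpha,k}\}_\alpha\in\ell^{\min\{2,k\}},\qquad \omega_{\alpha,k}=\left(\int_{\mathbb{S}}|\xi^\alpha|^kd\sigma(\xi)\right)^{1/k},$$ then $f_\omega\in\mathcal{N}(p,q,s)$ for almost every $\omega\in\Omega$.
   Context: $\mathbb{B}$ is the open unit ball of $\mathbb{C}^n$, $\mathbb{S}=\partial\mathbb{B}$, $\sigma$ is the normalized surface measure on $\mathbb{S}$, $H(\mathbb{B})$ is the space of holomorphic functions on $\mathbb{B}$, $dV$ is normalized volume measure on $\mathbb{B}$, and $d\lambda(z)=\frac{dV(z)}{(1-|z|^2)^{n+1}}$. For $a\in\mathbb{B}$, $\Phi_a(z)=\frac{a-P_az-s_aQ_az}{1-\langle z,a\rangle}$, where $s_a=\sqrt{1-|a|^2}$, $P_a$ is the orthogonal projection onto the span of $a$ and $Q_a=I-P_a$. For $p,q,s>0$, $\mathcal{N}(p,q,s)$ is the set of $f\in H(\mathbb{B})$ with $\|f\|^p=\sup_{a\in\mathbb{B}}\int_{\mathbb{B}}|f(z)|^p(1-|z|^2)^q(1-|\Phi_a(z)|^2)^{ns}d\lambda(z)<\infty$.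 $\{\varepsilon_\alpha(\omega)\}$, indexed by multi-indices $\alpha\in\mathbb{Z}_+^n$, is a Bernoulli sequence of random variables on a probability space $(\Omega,\mathcal{A},P)$: the $\varepsilon_\alpha$ are independent and each takes the values $1$ and $-1$ with probability $\frac12$ each. For $f(z)=\sum_\alpha a_\alpha z^\alpha\in H(\mathbb{B})$, its randomization is $f_\omega(z)=\sum_\alpha\varepsilon_\alpha(\omega)a_\alpha z^\alpha$. *)

(* Defs.v *)
From HB Require Import structures.
From mathcomp Require Import all_boot all_order all_algebra finmap complex.
From mathcomp Require Import all_classical all_reals all_analysis measurable_realfun.
From mathcomp Require summability.

Set Implicit Arguments.
Unset Strict Implicit.
Unset Printing Implicit Defensive.

Import Order.TTheory GRing.Theory Num.Theory.
Import numFieldNormedType.Exports.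

Local Open Scope classical_set_scope.
Local Open Scope ring_scope.
Local Open Scope complex_scope.

Definition multiindex (n : nat) := {ffun 'I_n -> nat}.
HB.instance Definition _ n := Countable.on (multiindex n).

Section hermitian.
Context {R : realType} {n : nat}.
Implicit Types z a : 'rV[R[i]]_n.

Definition hdot z a : R[i] := \sum_(j < n) z 0 j * (a 0 j)^*.

Definition hnorm z : R := Num.sqrt (\sum_(j < n) Normc.normc (z 0 j) ^+ 2).

Definition uball : set 'rV[R[i]]_n := [set z | hnorm z < 1].

Definition usphere : set 'rV[R[i]]_n := [set z | hnorm z = 1].

(* For [a = 0] the quotient below is [0 / 0 = 0], so that [hproj 0] is the
   projection onto the null space. *)
Definition hproj a z : 'rV[R[i]]_n := (hdot z a / hdot a a) *: a.

Definition Phi a z : 'rV[R[i]]_n :=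
  (1 - hdot z a)^-1 *:
    (a - hproj a z - (Num.sqrt (1 - hnorm a ^+ 2))%:C *: (z - hproj a z)).

Definition monomial (alpha : multiindex n) z : R[i] :=
  \prod_(j < n) z 0 j ^+ alpha j.

End hermitian.

(* Frechet differentiability over the field K; for K = R[i] this is
   holomorphy. The sup norm carried by the matrix type is equivalent to the
   hermitian one. *)
Definition differentiable_on (K : numFieldType) (n : nat)
    (D : set 'rV[K]_n) (f : 'rV[K]_n -> K^o) : Prop :=
  forall z : 'rV[K]_n, D z -> differentiable f z.

(* H(B), for functions whose values outside the ball are irrelevant. *)
Definition holomorphic_ball (R : realType) (n : nat)
    (f : 'rV[R[i]]_n -> R[i]) : Prop :=
  differentiable_on (K := R[i]) uball f.

(* C^n is identified with (R * R)^n, measurable for the product (i.e. Borel)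
   sigma-algebra. *)
Notation plane R := (measurableTypeR R * measurableTypeR R)%type.

Section measures.
Context {R : realType}.

Definition cvec {n : nat} (t : n.-tuple (plane R)) : 'rV[R[i]]_n :=
  \row_(j < n) (((tnth t j).1 : R) +i* (tnth t j).2).

Definition tcons {n : nat}
    (x : n.-tuple (plane R) * measurableTypeR R * measurableTypeR R) :
    n.+1.-tuple (plane R) :=
  [tuple of (x.1.2, x.2) :: x.1.1].

(* 2n-dimensional Lebesgue measure, as an iterated product measure. *)
Fixpoint lebesgue_cvec (n : nat) : set (n.-tuple (plane R)) -> \bar R :=
  if n is m.+1 then
    pushforward (@lebesgue_cvec m \x lebesgue_measure \x lebesgue_measure)%E
      tcons
  else \d_ [tuple].

Definition ball_volume (n : nat) (A : set (n.-tuple (plane R))) : \bar R :=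
  ((fine (@lebesgue_cvec n (cvec @^-1` uball)))^-1%:E *
   lebesgue_cvec (A `&` cvec @^-1` uball))%E.

Definition radial {n : nat} (t : n.-tuple (plane R)) : n.-tuple (plane R) :=
  [tuple of [seq ((x.1 : R) / hnorm (cvec t), (x.2 : R) / hnorm (cvec t))
            | x <- t]].

(* The normalized surface measure of a set A of the sphere is the normalized
   volume of the part of the ball in the cone spanned by A. *)
Definition sphere_measure (n : nat) : set (n.-tuple (plane R)) -> \bar R :=
  pushforward (@ball_volume n) radial.

Definition sphere_moment (n : nat) (alpha : multiindex n) (k : R) : R :=
  fine (\int[@sphere_measure n]_(t in cvec @^-1` usphere)
    (Normc.normc (monomial alpha (cvec t)) `^ k)%:E) `^ k^-1.

End measures.

Section measure_instances.
Context {R : realType}.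

Lemma measurable_tcons n : measurable_fun setT (@tcons R n).
Proof.
have m1 := measurable_fst : measurable_fun setT
  (@fst (n.-tuple (plane R) * measurableTypeR R) (measurableTypeR R)).
apply: measurable_cons.
  apply: measurable_fun_pair; last exact: measurable_snd.
  exact: (measurableT_comp measurable_snd m1).
exact: (measurableT_comp measurable_fst m1).
Qed.

Lemma lebesgue_cvec_is_measure n :
  exists m : {measure set (n.-tuple (plane R)) -> \bar R},
    (m : set _ -> _) = @lebesgue_cvec R n.
Proof.
elim: n => [|n [m mE]]; first by exists (\d_ [tuple]).
exists (measure_function_pushforward__canonical__measure_function_Measure
  (m \x lebesgue_measure \x lebesgue_measure)%E (@measurable_tcons n)).
by rewrite /= -mE.
Qed.

Section fixed_dimension.
Variable n : nat.

Let leb0 : @lebesgue_cvec R n set0 = 0%E.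
Proof. by have [m <-] := lebesgue_cvec_is_measure n; exact: measure0. Qed.

Let leb_ge0 A : (0 <= @lebesgue_cvec R n A)%E.
Proof. by have [m <-] := lebesgue_cvec_is_measure n; exact: measure_ge0. Qed.

Let leb_sigma_additive : semi_sigma_additive (@lebesgue_cvec R n).
Proof.
have [m <-] := lebesgue_cvec_is_measure n.
exact: measure_semi_sigma_additive.
Qed.

HB.instance Definition _ := isMeasure.Build _ _ _ (@lebesgue_cvec R n)
  leb0 leb_ge0 leb_sigma_additive.

Lemma measurable_hnorm_cvec : measurable_fun setT (fun t => hnorm (@cvec R n t)).
Proof.
apply: (@measurableT_comp _ _ _ _ _ _ (@Num.sqrt R)).
  exact: continuous_measurable_fun (@sqrt_continuous R).
apply: measurable_sum => j; apply: measurable_funX.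
rewrite (_ : (fun _ => _) = fun t : n.-tuple (plane R) =>
    Num.sqrt ((tnth t j).1 ^+ 2 + (tnth t j).2 ^+ 2)); last first.
  by apply/funext => t; rewrite mxE.
apply: (@measurableT_comp _ _ _ _ _ _ (@Num.sqrt R)).
  exact: continuous_measurable_fun (@sqrt_continuous R).
have mt := @measurable_tnth _ (plane R) n j.
by apply: measurable_funD; apply: measurable_funX;
  [apply: (measurableT_comp measurable_fst mt)
  |apply: (measurableT_comp measurable_snd mt)].
Qed.

Lemma measurable_uball : measurable (@cvec R n @^-1` uball).
Proof.
rewrite [X in measurable X](_ : _ =
  (fun t => hnorm (@cvec R n t)) @^-1` `]-oo, 1[%classic).
  by rewrite -[X in measurable X]setTI; exact: measurable_hnorm_cvec.
by apply/seteqP; split => t /=; rewrite in_itv.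
Qed.

Let vol0 : @ball_volume R n set0 = 0%E.
Proof. by rewrite /ball_volume set0I measure0 mule0. Qed.

Let vol_ge0 A : (0 <= @ball_volume R n A)%E.
Proof. by rewrite mule_ge0// lee_fin invr_ge0 fine_ge0. Qed.

Let vol_sigma_additive : semi_sigma_additive (@ball_volume R n).
Proof.
have r0 : 0 <= (fine (@lebesgue_cvec R n (cvec @^-1` uball)))^-1.
  by rewrite invr_ge0 fine_ge0.
exact: (@measure_semi_sigma_additive _ _ _
  (mscale (NngNum r0) (mrestr (@lebesgue_cvec R n) measurable_uball))).
Qed.

HB.instance Definition _ := isMeasure.Build _ _ _ (@ball_volume R n)
  vol0 vol_ge0 vol_sigma_additive.

Lemma measurable_radial : measurable_fun setT (@radial R n).
Proof.
apply/measurable_fun_tnthP => j.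
have mt := @measurable_tnth _ (plane R) n j.
rewrite (_ : _ \o _ = fun t : n.-tuple (plane R) =>
  ((tnth t j).1 / hnorm (cvec t), (tnth t j).2 / hnorm (cvec t))); last first.
  by apply/funext => t /=; rewrite tnth_map.
have mV : measurable_fun setT (fun t => (hnorm (@cvec R n t))^-1).
  under eq_fun do rewrite -powR_inv1 ?sqrtr_ge0//.
  exact: (measurableT_comp (measurable_powR _) measurable_hnorm_cvec).
by apply: measurable_fun_pair; apply: measurable_funM => //;
  [apply: (measurableT_comp measurable_fst mt)
  |apply: (measurableT_comp measurable_snd mt)].
Qed.

HB.instance Definition _ := Measure.copy (@sphere_measure R n)
  (measure_function_pushforward__canonical__measure_function_Measure
    (@ball_volume R n) measurable_radial).

End fixed_dimension.
End measure_instances.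

Section Npqs.
Context {R : realType} {n : nat}.

(* The factor (1 - |z|^2)^-(n+1) is the density of dlambda with respect to
   dV. *)
Definition Npqs_integral (p q s : R) (f : 'rV[R[i]]_n -> R[i])
    (a : 'rV[R[i]]_n) : \bar R :=
  (\int[@ball_volume R n]_(t in cvec @^-1` uball)
    (Normc.normc (f (cvec t)) `^ p
     * (1 - hnorm (cvec t) ^+ 2) `^ q
     * (1 - hnorm (Phi a (cvec t)) ^+ 2) `^ (n%:R * s)
     / (1 - hnorm (cvec t) ^+ 2) ^+ n.+1)%:E)%E.

Definition Npqs (p q s : R) (f : 'rV[R[i]]_n -> R[i]) : Prop :=
  holomorphic_ball f /\
  (ereal_sup [set Npqs_integral p q s f a | a in uball] < +oo)%E.

End Npqs.

Section power_series.
Context {R : realType} {n : nat}.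

(* On the ball, f is the sum of the power series with coefficients a; as
   [summability.totally] is the filter of finite sets of multi-indices, the
   convergence is unconditional. *)
Definition power_series_on_ball (a : multiindex n -> R[i])
    (f : 'rV[R[i]]_n -> R[i]) : Prop :=
  forall z, uball z ->
    summability.partial_sum (fun alpha => a alpha * monomial alpha z : R[i]^o)
      @ summability.totally --> (f z : R[i]^o).

Definition randomization (T : Type) (eps : multiindex n -> T -> R)
    (a : multiindex n -> R[i]) (w : T) (z : 'rV[R[i]]_n) : R[i] :=
  summability.sum
    (fun alpha => (eps alpha w)%:C * a alpha * monomial alpha z : R[i]^o).

End power_series.

Section probability.
Context {d : measure_display} {Omega : measurableType d} {R : realType}.
Variables (P : probability Omega R) (I : choiceType).

Definition mutually_independent (X : I -> {RV P >-> R}) : Prop :=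
  forall (J : {fset I}) (A : I -> set R), (forall i, measurable (A i)) ->
    P (\bigcap_(i in [set` J]) (X i @^-1` A i)) =
    (\prod_(i <- J) P (X i @^-1` A i))%E.

Definition bernoulli_sequence (X : I -> {RV P >-> R}) : Prop :=
  mutually_independent X /\
  forall i, P (X i @^-1` [set 1]) = (2^-1)%:E /\
            P (X i @^-1` [set (-1)]) = (2^-1)%:E.

End probability.

Definition in_ell {R : realType} {I : choiceType} (r : R) (x : I -> R) : Prop :=
  (\esum_(i in [set: I]) (`|x i| `^ r)%:E < +oo)%E.

(* Main.v *)
From HB Require Import structures.
Require Import Defs.
From mathcomp Require Import all_boot all_order all_algebra finmap complex.
From mathcomp Require Import all_classical all_reals all_analysis.
From mathcomp Require Import measurable_realfun ring lra.
From mathcomp Require spectral.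
From mathcomp Require summability.

(** Young's inequality separates the random function from the invariant kernel.
    Put t = (n + rho) / q, so that k = p t, and let t' be the conjugate
    exponent.  On the ball
      [|f|^p (1-|z|^2)^q (1-|Phi_a|^2)^(n s)
         <= |f|^k (1-|z|^2)^(n + rho) + (1-|Phi_a|^2)^(n s t')],
    and dividing by [(1-|z|^2)^(n+1)] and integrating bounds the integral that
    defines N(p,q,s) by a weighted Bergman integral of [|f|^k], in which the
    point [a] does not occur, plus an integral of [(1-|Phi_a|^2)^(n s t')]
    against the invariant measure ([young_weight]).  The conditions on rho say
    exactly that t > 1 and [n s t' > n] ([exponent_conditions]), and for such an
    exponent the second integral is bounded uniformly in [a]
    ([Phi_integral_bounded]).  It remains to see that almost surely
    [f_omega] is holomorphic and [|f_omega|^k (1-|z|^2)^(rho-1)] is integrable.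

    Integrability ([ae_randomization_integral_lty]).  For a finite sum with
    random signs, Khinchine's inequality bounds the mean of the k-th power at
    each point z by the power k/2 of the square function
    [sum |a_alpha z^alpha|^2].  If k >= 2, Minkowski's inequality in L^(k/2)
    reduces the integral of the latter to single monomials; if k <= 2, the
    subadditivity of [x^(k/2)] does.  This is where min(2,k) comes from
    ([square_function_integral]).  The integral of [|z^alpha|^k (1-|z|^2)^(rho-1)]
    is at most a constant times [omega_(alpha,k)^k] ([monomial_integral_le]).
    So the partial sums over boxes of multi-indices have bounded mean, and two
    applications of Fatou's lemma, in omega and then in z, conclude.

    Holomorphy ([holomorphic_series_value]).  The coefficients of [f_omega] have
    the moduli of those of f.  As the series of f converges unconditionally on
    the whole ball, its terms are bounded at a slightly larger point, hence
    decay geometrically; each monomial has a second-order expansion at z whose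
    remainder is controlled by the value of the monomial at such a point, so
    the expansions can be summed.

    Integrals over the ball are never computed in polar coordinates.  They
    follow from [layer_bound]: if the integral of h over [g <= t] is at most
    [C t] for every t, a dyadic decomposition bounds the integral of
    [h g^b (e+g)^(-c)].  The point [a] is moved to the first axis by a unitary
    map, which preserves volume by the argument that shows the uniqueness of
    Haar measure ([integral_additive_map]). *)

Set Implicit Arguments.
Unset Strict Implicit.
Unset Printing Implicit Defensive.

Import Order.TTheory GRing.Theory Num.Theory.
Import numFieldNormedType.Exports.
Local Open Scope classical_set_scope.
Local Open Scope ring_scope.

(** * Lebesgue measure on C^n under affine maps *)

Section sigma_finite_product.
Context d1 d2 (T1 : measurableType d1) (T2 : measurableType d2) (R : realType).
Variables (m1 : {sigma_finite_measure set T1 -> \bar R})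
  (m2 : {sigma_finite_measure set T2 -> \bar R}).

(** The product of two sigma-finite measures under a name of its own, which
    carries the structure of a sigma-finite measure and so can be a factor of a
    further product. *)
Definition sfprod : set (T1 * T2) -> \bar R := (m1 \x m2)%E.

HB.instance Definition _ := Measure.on sfprod.

Lemma sigma_finite_sfprod : sigma_finite setT sfprod.
Proof.
have /sigma_finiteP[F [TF ndF Foo]] := sigma_finiteT m1.
have /sigma_finiteP[G [TG ndG Goo]] := sigma_finiteT m2.
exists (fun n => F n `*` G n).
  rewrite -setXTT TF TG predeqE => -[x y]; split.
    move=> [/= [n _ Fnx] [k _ Gky]]; exists (maxn n k) => //; split.
    - by move: x Fnx; exact/subsetPset/ndF/leq_maxl.
    - by move: y Gky; exact/subsetPset/ndG/leq_maxr.
  by move=> [n _ []/= ? ?]; split; exists n.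
move=> k; have [? ?] := Foo k; have [? ?] := Goo k.
split; first exact: measurableX.
by rewrite /sfprod product_measure1E// lte_mul_pinfty// ge0_fin_numE.
Qed.

HB.instance Definition _ := Measure_isSigmaFinite.Build _ _ _ sfprod
  sigma_finite_sfprod.

End sigma_finite_product.

Section rescaling.
Context d (T : measurableType d) (R : realType).
Local Open Scope ereal_scope.

(** Change of variables by [phi] with constant Jacobian [k], stated on integrals
    so that it passes to products by Tonelli's theorem. *)
Definition rescales (m : set T -> \bar R) (phi : T -> T) (k : R) :=
  [/\ measurable_fun setT phi, (0 <= k)%R &
   forall F : T -> \bar R, measurable_fun setT F -> (forall x, 0 <= F x) ->
   k%:E * \int[m]_x F (phi x) = \int[m]_x F x].

End rescaling.

Lemma rescales_prod d1 d2 (T1 : measurableType d1) (T2 : measurableType d2)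
    (R : realType) (m1 : {sigma_finite_measure set T1 -> \bar R})
    (m2 : {sigma_finite_measure set T2 -> \bar R}) f1 f2 (k1 k2 : R) :
  rescales m1 f1 k1 -> rescales m2 f2 k2 ->
  rescales (sfprod m1 m2) (fun x => (f1 x.1, f2 x.2)) (k1 * k2).
Proof.
move=> [mf1 k10 H1] [mf2 k20 H2].
have mf : measurable_fun setT (fun x : T1 * T2 => (f1 x.1, f2 x.2)).
  by apply: measurable_fun_pair; apply: measurableT_comp.
split=> // [|F mF F0]; first exact: mulr_ge0.
have mFx x : measurable_fun setT (fun y => F (x, y)).
  exact: measurableT_comp mF (measurable_pair1 x).
rewrite (fubini_tonelli1 (fun x => F (f1 x.1, f2 x.2)))//=; last first.
  exact: measurableT_comp.
rewrite fubini_tonelli1// EFinM -muleA -ge0_integralZl_EFin//; last 2 first.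
- by move=> x _; apply: integral_ge0.
- by apply: (measurable_fun_fubini_tonelli_F (fun x => F (f1 x.1, f2 x.2)));
    rewrite //; exact: measurableT_comp.
rewrite /fubini_F /=.
under eq_integral => x _ do rewrite (H2 (fun y => F (f1 x, y)))//.
rewrite -[RHS]H1//; first exact: (measurable_fun_fubini_tonelli_F F).
by move=> x; exact: integral_ge0.
Qed.

(** The image of an interval of endpoints x and y under [x |-> c x + v] has
    length [|c| |y - x|], and a measure on the line is determined by its values
    on half-open intervals. *)
Lemma rescales_lebesgue (R : realType) (c v : R) : c != 0 ->
  rescales (@lebesgue_measure R) (fun x => c * x + v) `|c|.
Proof.
move=> c0.
have mphi : measurable_fun setT (fun x : measurableTypeR R => c * x + v : measurableTypeR R).
  by apply: measurable_funD => //; exact: mulrl_measurable.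
split=> // F mF F0.
have cp : 0 <= `|c| by [].
pose mu' : {measure set (measurableTypeR R) -> \bar R} := mscale (NngNum cp)
  (measure_function_pushforward__canonical__measure_function_Measure
    (@lebesgue_measure R) mphi).
transitivity (\int[mu']_x F x)%E.
  rewrite ge0_integral_mscale//=; congr (_ * _)%E.
  by rewrite ge0_integral_pushforward.
apply: eq_measure_integral => A mA _.
apply/esym/lebesgue_measure_unique => //= _ [[a b]] _ <-.
rewrite /mscale/= /pushforward.
have [c1|c1|c1] := ltgtP c 0; last by rewrite c1 eqxx in c0.
  rewrite (_ : _ @^-1` _ = `[(b - v) / c, (a - v) / c[%classic); last first.
    apply/seteqP; split=> x /=; rewrite !in_itv /= ler_ndivrMr// ltr_ndivlMr//;
    by rewrite (mulrC x) => /andP[h1 h2]; apply/andP; split; lra.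
  rewrite !lebesgue_measure_itv /= !lte_fin ltr_ndivrMr// divfK// ltrD2r.
  case: ifPn => _; last by rewrite mule0.
  by rewrite -!EFinD -EFinM ltr0_norm//; congr EFin; field.
rewrite (_ : _ @^-1` _ = `](a - v) / c, (b - v) / c]%classic); last first.
  apply/seteqP; split=> x /=; rewrite !in_itv /= ler_pdivlMr// ltr_pdivrMr//;
  by rewrite (mulrC x) => /andP[h1 h2]; apply/andP; split; lra.
rewrite !lebesgue_measure_itv /= !lte_fin ltr_pdivlMr// divfK ?gt_eqF// ltrD2r.
case: ifPn => _; last by rewrite mule0.
by rewrite -!EFinD -EFinM gtr0_norm//; congr EFin; field; rewrite gt_eqF.
Qed.

Section lebesgue_cvec_theory.
Context {R : realType}.

Definition tuncons n (t : n.+1.-tuple (plane R)) :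
    n.-tuple (plane R) * measurableTypeR R * measurableTypeR R :=
  ([tuple of behead t], (thead t).1, (thead t).2).

Lemma tconsK n : cancel (@tcons R n) (@tuncons n).
Proof. by move=> [[t x] y]; congr (_, _, _); apply/val_inj. Qed.

Lemma measurable_tuncons n : measurable_fun setT (@tuncons n).
Proof.
have mh : measurable_fun setT (@thead n (plane R)) := @measurable_tnth _ _ _ ord0.
apply: measurable_fun_pair; first apply: measurable_fun_pair.
- exact: measurable_behead.
- exact: measurableT_comp.
- exact: measurableT_comp.
Qed.

(** The induction produces a sigma-finite measure structure rather than the bare
    property, since the product at the next dimension needs the structure. *)
Lemma sigma_finite_lebesgue_cvec n : sigma_finite setT (@lebesgue_cvec R n).
Proof.
suff [m mE] : exists m : {sigma_finite_measure set (n.-tuple (plane R)) -> \bar R},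
    (m : set _ -> _) = @lebesgue_cvec R n.
  by rewrite -mE; exact: sigma_finiteT.
elim: n => [|n [m mE]]; first by exists (\d_ [tuple]).
pose mm : {sigma_finite_measure set (n.-tuple (plane R) * measurableTypeR R *
  measurableTypeR R)%type -> \bar R} := sfprod (sfprod m (@lebesgue_measure R)) (@lebesgue_measure R).
have [F FT Ffin] := sigma_finiteT mm.
have sf : sigma_finite setT (@lebesgue_cvec R n.+1).
  exists (fun k => @tuncons n @^-1` F k).
    by rewrite -preimage_bigcup -FT preimage_setT.
  move=> k; have [mFk Fk] := Ffin k; split.
    by rewrite -[X in measurable X]setTI; exact: measurable_tuncons.
  rewrite /= /pushforward -mE -comp_preimage (_ : _ \o _ = id)//.
  by apply/funext => x /=; rewrite tconsK.
pose sfi := Measure_isSigmaFinite.Build _ _ _ (@lebesgue_cvec R n.+1) sf.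
pose s : {sigma_finite_measure set (n.+1.-tuple (plane R)) -> \bar R} :=
  HB.pack (@lebesgue_cvec R n.+1) sfi.
by exists s.
Qed.

HB.instance Definition _ n := Measure_isSigmaFinite.Build _ _ _
  (@lebesgue_cvec R n) (@sigma_finite_lebesgue_cvec n).

Definition affine n (c : R) (v t : n.-tuple (plane R)) : n.-tuple (plane R) :=
  [tuple ((c * (tnth t j).1 + (tnth v j).1 : measurableTypeR R),
          (c * (tnth t j).2 + (tnth v j).2 : measurableTypeR R)) | j < n].

Lemma cvec_affine n (c : R) (v t : n.-tuple (plane R)) :
  cvec (affine c v t) = c%:C%C *: cvec t + cvec v.
Proof.
apply/rowP => j; rewrite !mxE tnth_mktuple /=; apply/eqP.
by rewrite eq_complex /= !mul0r subr0 addr0 !eqxx.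
Qed.

Lemma measurable_affine n (c : R) (v : n.-tuple (plane R)) :
  measurable_fun setT (affine c v).
Proof.
apply/measurable_fun_tnthP => j.
rewrite (_ : _ \o _ = fun t : n.-tuple (plane R) =>
    ((c * (tnth t j).1 + (tnth v j).1 : measurableTypeR R),
          (c * (tnth t j).2 + (tnth v j).2 : measurableTypeR R))); last first.
  by apply/funext => t /=; rewrite tnth_mktuple.
have mt := @measurable_tnth _ (plane R) n j.
apply: measurable_fun_pair; apply: measurable_funD => //; apply: measurable_funM => //.
  exact: (measurableT_comp measurable_fst mt).
exact: (measurableT_comp measurable_snd mt).
Qed.

Lemma integral_lebesgue_cvecS n (F : n.+1.-tuple (plane R) -> \bar R) :
  measurable_fun setT F -> (forall t, (0 <= F t)%E) ->
  (\int[@lebesgue_cvec R n.+1]_t F t =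
   \int[@lebesgue_cvec R n \x lebesgue_measure \x lebesgue_measure]_x F (tcons x))%E.
Proof.
by move=> mF F0; rewrite /= ge0_integral_pushforward//; exact: measurable_tcons.
Qed.

(** The exponent is the real dimension [2 n]: each complex coordinate contributes
    two factors [|c|]. *)
Lemma rescales_lebesgue_cvec n (c : R) (v : n.-tuple (plane R)) : c != 0 ->
  rescales (@lebesgue_cvec R n) (affine c v) (`|c| ^+ (2 * n)).
Proof.
move=> c0; split; [exact: measurable_affine|exact: exprn_ge0|].
elim: n v => [|n IH] v F mF F0.
  rewrite muln0 expr0 mul1e; apply: eq_integral => t _.
  by rewrite (tuple0 t) (tuple0 (affine _ _ _)).
have rn : rescales (@lebesgue_cvec R n) (affine c [tuple of behead v])
    (`|c| ^+ (2 * n)).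
  by split; [exact: measurable_affine|exact: exprn_ge0|exact: IH].
have r1 := rescales_prod rn (rescales_lebesgue (thead v).1 c0).
have [_ _ r2] := rescales_prod r1 (rescales_lebesgue (thead v).2 c0).
have mt := @measurable_tcons R n.
rewrite integral_lebesgue_cvecS//; last by apply: (measurableT_comp mF); exact: measurable_affine.
rewrite integral_lebesgue_cvecS//.
rewrite -[RHS](r2 (fun x => F (tcons x)))//; last exact: (measurableT_comp mF).
rewrite -mulrA -expr2 -exprD mulnS addnC; congr (_ * _)%E.
apply: eq_integral => -[[t x] y] _; congr F; apply/eq_from_tnth => j.
rewrite tnth_mktuple; case: (unliftP ord0 j) => [i ->|->] /=.
  have -> : tnth v (lift ord0 i) = tnth [tuple of behead v] i.
    rewrite tnth_behead; congr tnth; apply/val_inj.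
    by rewrite /= inordK//= ltnS.
  by rewrite /tcons !tnthS tnth_mktuple.
by rewrite /thead /tcons !tnth0.
Qed.

End lebesgue_cvec_theory.

(** * Norm-preserving additive maps preserve volume *)

Section additive_maps.
Context {R : realType} {n : nat}.
Local Notation T := (n.-tuple (plane R)).
Local Notation leb := (@lebesgue_cvec R n).

Lemma measurable_affine2 (c : R) :
  measurable_fun setT (fun x : T * T => affine c x.1 x.2).
Proof.
apply/measurable_fun_tnthP => j.
rewrite (_ : _ \o _ = fun x : T * T =>
    ((c * (tnth x.2 j).1 + (tnth x.1 j).1 : measurableTypeR R),
     (c * (tnth x.2 j).2 + (tnth x.1 j).2 : measurableTypeR R))); last first.
  by apply/funext => t /=; rewrite tnth_mktuple.
have mt := @measurable_tnth _ (plane R) n j.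
have m1 := measurableT_comp mt (@measurable_fst _ _ T T).
have m2 := measurableT_comp mt (@measurable_snd _ _ T T).
apply: measurable_fun_pair; apply: measurable_funD; try apply: measurable_funM => //.
- exact: (measurableT_comp measurable_fst m2).
- exact: (measurableT_comp measurable_fst m1).
- exact: (measurableT_comp measurable_snd m2).
- exact: (measurableT_comp measurable_snd m1).
Qed.

Lemma integral_affine1 (c : R) (v : T) (F : T -> \bar R) : `|c| = 1 ->
  measurable_fun setT F -> (forall t, 0 <= F t)%E ->
  (\int[leb]_t F (affine c v t) = \int[leb]_t F t)%E.
Proof.
move=> c1 mF F0.
have c0 : c != 0 by rewrite -normr_gt0 c1.
have [_ _ /(_ F mF F0)] := rescales_lebesgue_cvec v c0.
by rewrite c1 expr1n mul1e.
Qed.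

(** The uniqueness of Haar measure.  Integrate [F (phi x)] times the indicator of
    B at [phi x + y] over (x, y).  Integrating in y first gives the left-hand
    side, by translation invariance.  The translation of x by a preimage of -y
    turns the integrand into [F (phi x - y)] times the indicator of B at
    [phi x]; integrating again in y first gives the right-hand side.  Taking for
    B the ball, which an isometry fixes, shows that [phi] preserves integrals. *)
Lemma integral_additive_map (phi : T -> T) (F : T -> \bar R) (B : set T) :
  measurable_fun setT phi ->
  (forall v t, phi (affine 1 v t) = affine 1 (phi v) (phi t)) ->
  (forall y, exists v, phi v = y) ->
  measurable_fun setT F -> (forall t, 0 <= F t)%E -> measurable B ->
  (\int[leb]_t F (phi t) * leb B = \int[leb]_t F t * leb (phi @^-1` B))%E.
Proof.
move=> mphi phiD phi_surj mF F0 mB.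
have mA c : measurable_fun setT (fun x : T * T => affine c (phi x.1) x.2).
  apply: (measurableT_comp (measurable_affine2 c) (g := fun x => (phi x.1, x.2))).
  by apply: measurable_fun_pair => //; exact: measurableT_comp.
have mFphi : measurable_fun setT (fun x : T * T => F (phi x.1)).
  by apply: (measurableT_comp mF); exact: measurableT_comp.
have mIB : measurable_fun setT (fun t : T => (\1_B t)%:E : \bar R).
  exact/measurable_EFinP/measurable_indic.
pose G1 x := (F (phi x.1) * (\1_B (affine 1 (phi x.1) x.2))%:E)%E.
pose G2 x := (F (affine (-1) (phi x.1) x.2) * (\1_B (phi x.1))%:E)%E.
have mG1 : measurable_fun setT G1.
  apply: emeasurable_funM => //; exact: (measurableT_comp mIB (mA 1)).
have mG2 : measurable_fun setT G2.
  apply: emeasurable_funM; first exact: (measurableT_comp mF (mA (-1))).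
  by apply: (measurableT_comp mIB); exact: measurableT_comp.
have G10 x : (0 <= G1 x)%E by rewrite mule_ge0// lee_fin.
have G20 x : (0 <= G2 x)%E by rewrite mule_ge0// lee_fin.
have mphiB : measurable (phi @^-1` B) by rewrite -[X in measurable X]setTI; exact: mphi.
transitivity (\int[leb]_x \int[leb]_y G1 (x, y))%E.
  rewrite -ge0_integralZr//; last exact: (measurableT_comp mF).
  apply: eq_integral => x _; rewrite /G1 /= ge0_integralZl//; last first.
    by apply: (measurableT_comp mIB); exact: measurable_affine.
  congr (_ * _)%E.
  rewrite (@integral_affine1 1 _ (fun t => (\1_B t)%:E))// ?normr1//.
  by rewrite integral_indic// setIT.
rewrite fubini_tonelli//.
transitivity (\int[leb]_y \int[leb]_x G2 (x, y))%E.
  apply: eq_integral => y _.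
  have [v vE] := phi_surj (affine (-1) [tuple (0, 0) | j < n] y).
  rewrite -(@integral_affine1 1 v (fun x => G1 (x, y)))//; last 2 first.
    by rewrite normr1.
    exact: (measurableT_comp mG1 (measurable_pair2 y)).
  apply: eq_integral => x _; rewrite /G1 /G2 /= phiD vE.
  congr (F _ * (\1_B _)%:E)%E; apply/eq_from_tnth => j; rewrite !tnth_mktuple/=.
    by congr pair; ring.
  by case: (tnth (phi x) j) => u w /=; congr pair; ring.
rewrite -fubini_tonelli//.
transitivity (\int[leb]_x ((\int[leb]_t F t) * (\1_(phi @^-1` B) x)%:E))%E.
  apply: eq_integral => x _; rewrite /G2 /= ge0_integralZr//; last first.
    by apply: (measurableT_comp mF); exact: measurable_affine.
  by rewrite integral_affine1// normrN1.
rewrite ge0_integralZl//; last exact: integral_ge0.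
  by rewrite integral_indic// setIT.
exact/measurable_EFinP/measurable_indic.
Qed.

End additive_maps.

Section normalized_volume.
Context {R : realType} {n : nat}.
Local Notation T := (n.-tuple (plane R)).
Local Notation leb := (@lebesgue_cvec R n).
Local Notation ball := (cvec @^-1` uball : set T).

(** The normalization of the volume of the ball.  It is 0 if Lebesgue measure gives
    the ball the value 0 or infinity; the lemmas below hold in these cases
    too, so that the volume of the ball never has to be computed. *)
Definition vol_const : R := (fine (leb ball))^-1.

Lemma vol_const_ge0 : 0 <= vol_const.
Proof. by rewrite invr_ge0 fine_ge0. Qed.

Lemma integral_ball_volume (E : set T) (F : T -> \bar R) :
  measurable E -> measurable_fun E F -> (forall t, E t -> 0 <= F t)%E ->
  (\int[@ball_volume R n]_(t in E) F t = vol_const%:E *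
   \int[leb]_(t in E `&` ball) F t)%E.
Proof.
move=> mE mF F0.
pose mu : {measure set T -> \bar R} := mscale (NngNum vol_const_ge0) leb.
have mB := @measurable_uball R n.
rewrite (ge0_negligible_integral (N := ~` ball))//; last 2 first.
- exact: measurableC.
- by rewrite /= /ball_volume setICl measure0 mule0.
rewrite setDE setCK.
transitivity (\int[mu]_(t in E `&` ball) F t)%E.
  apply: eq_measure_integral => A mA AE.
  rewrite /= /ball_volume /mscale /= (_ : A `&` _ = A)//.
  by apply/setIidPl => t /AE[].
rewrite ge0_integral_mscale//=.
- exact: measurableI.
- by apply: measurable_funS mF => //; exact: subIsetl.
- by move=> t [/F0].
Qed.

Lemma ball_volume_le1 A : measurable A -> (@ball_volume R n A <= 1)%E.
Proof.
move=> mA; rewrite /ball_volume.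
have : (leb (A `&` ball) <= leb ball)%E.
  by apply: le_measure; rewrite ?inE//; [apply: measurableI => //|]; exact: measurable_uball.
have : (0 <= leb ball)%E by [].
case: (leb ball) => [r r0|_ _|//]; last by rewrite /= invr0 mul0e.
move=> h; rewrite /=; have [->|r1] := eqVneq r 0; first by rewrite invr0 mul0e.
by rewrite lee_pdivrMl ?mule1// lt_def r1.
Qed.

Lemma integral_isometry (phi : T -> T) (F : T -> \bar R) :
  measurable_fun setT phi ->
  (forall v t, phi (affine 1 v t) = affine 1 (phi v) (phi t)) ->
  (forall y, exists v, phi v = y) ->
  (forall t, hnorm (cvec (phi t)) = hnorm (cvec t)) ->
  measurable_fun setT F -> (forall t, 0 <= F t)%E ->
  (vol_const%:E * \int[leb]_t F (phi t) = vol_const%:E * \int[leb]_t F t)%E.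
Proof.
move=> mphi phiD phi_surj phi_norm mF F0.
have := integral_additive_map mphi phiD phi_surj mF F0 (@measurable_uball R n).
have -> : phi @^-1` ball = ball by apply/seteqP; split => t /=; rewrite /uball/= phi_norm.
have : (0 <= leb ball)%E by [].
rewrite /vol_const; case: (leb ball) => [r r0|_ _|//]; last first.
  by rewrite /= invr0 !mul0e.
rewrite /=.
have [->|r1] := eqVneq r 0; first by rewrite /= invr0 !mul0e.
move=> h.
have key x : (r^-1%:E * x = (r^-1 * r^-1)%:E * (x * r%:E))%E.
  by rewrite (muleC x) muleA -EFinM -mulrA mulVf// mulr1.
by rewrite [LHS]key [RHS]key h.
Qed.

End normalized_volume.

(** * Integrals controlled by sublevel sets *)

Section layers.
Context {R : realType}.

Lemma geometric_sum_le (q : R) N : 0 <= q < 1 ->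
  \sum_(0 <= i < N) q ^+ i <= (1 - q)^-1.
Proof.
move=> /andP[q0 q1]; have q1' : 0 < 1 - q by rewrite subr_gt0.
rewrite -[leRHS]mul1r ler_pdivlMr// mulrC -opprB mulNr.
rewrite big_mkord -subrX1 opprB gerBl exprn_ge0//.
Qed.

Lemma powR_layer_le (a b x : R) : 0 < a -> 0 <= x <= 1 ->
  x `^ b * (1 + x) `^ (- a) <= x `^ b.
Proof.
move=> a0 /andP[x0 x1]; rewrite ler_piMr ?powR_ge0// powRN invf_le1.
  by rewrite -[leLHS](powRr0 (1 + x)) ler_powR ?(ltW a0)// lerDl.
by apply: powR_gt0; lra.
Qed.

Lemma dyadic_low (x : R) : 0 < x <= 1 ->
  exists j : nat, 2^-1 ^+ j.+1 < x <= 2^-1 ^+ j.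
Proof.
move=> /andP[x0 x1].
have [N xN] : exists N : nat, 2^-1 ^+ N < x.
  have /cvgr0Pnorm_lt/(_ _ x0)[N _ /(_ N (leqnn N))] :
      (fun n => (2^-1 : R) ^+ n) @ \oo --> 0.
    by apply: cvg_expr; rewrite gtr0_norm ?invr_gt0// invf_lt1// ltr1n.
  by rewrite /= ger0_norm ?exprn_ge0 ?invr_ge0// => h; exists N.
elim: N xN => [|N IH] xN; first by rewrite expr0 in xN; lra.
by have [/IH //|xN'] := ltP (2^-1 ^+ N) x; exists N; rewrite xN.
Qed.

Lemma dyadic_high (x : R) : 1 < x ->
  exists j : nat, 2 ^+ j < x <= 2 ^+ j.+1.
Proof.
move=> x1; have x0 : 0 < x by lra.
have [N xN] : exists N : nat, x <= 2 ^+ N.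
  exists (Num.bound x); apply: (le_trans (ltW (archi_boundP (ltW x0)))).
  by rewrite -natrX ler_nat ltnW// ltn_expl.
elim: N xN => [|N IH] xN; first by rewrite expr0 in xN; lra.
by have [/IH //|xN'] := leP x (2 ^+ N); exists N; rewrite xN' xN.
Qed.

Lemma powR_half_le (y b : R) : 2^-1 < y <= 1 -> y `^ b <= 2 `^ `|b|.
Proof.
move=> /andP[y2 y1]; have y0 : 0 < y by apply: lt_trans y2; rewrite invr_gt0.
have [b0|b0] := leP 0 b.
  rewrite (@le_trans _ _ 1)//.
    by rewrite -[leRHS](powRr0 y) ger_powR// y0.
  by rewrite -[leLHS](powRr0 2) ler_powR// ler1n.
have -> : y `^ b = y^-1 `^ (- b).
  by rewrite -powR_inv1 ?(ltW y0)// -powRrM mulN1r opprK.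
rewrite ltr0_norm//.
apply: ge0_ler_powR; rewrite ?nnegrE ?invr_ge0 ?oppr_ge0 ?ltW//.
by rewrite -[ltRHS]invrK ltf_pV2 ?posrE ?invr_gt0.
Qed.

Lemma powR_exprn (c b : R) j : 0 <= c -> (c ^+ j) `^ b = (c `^ b) ^+ j.
Proof.
move=> c0; elim: j => [|j IH]; first by rewrite !expr0 powR1.
by rewrite !exprS powRM ?exprn_ge0// IH.
Qed.

Lemma powRD1_exprn (c b : R) j : 0 < c ->
  (c `^ b) ^+ j * c ^+ j = (c `^ (b + 1)) ^+ j.
Proof.
move=> c0; rewrite -exprMn powRD ?powRr1 ?(ltW c0)//.
by rewrite (lt0r_neq0 c0) implybT.
Qed.

(** The weight [x^b (1+x)^(-a)] behaves like [x^b] on [0,1] and like [x^(b-a)]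
    beyond.  On each dyadic shell it is at most a constant, [layer_low] on
    the shells near 0 and [layer_high] on those near infinity. *)
Definition layer_weight (a b x : R) : R := x `^ b * (1 + x) `^ (- a).

Definition layer_low (b : R) j : R := 2 `^ `|b| * (2^-1 ^+ j) `^ b.
Definition layer_high (a b : R) j : R := (2 ^+ j) `^ (b - a).

Lemma layer_weight_le (a b x : R) : 0 < a -> b < a -> 0 <= x ->
  exists j : nat, layer_weight a b x <=
    layer_low b j * (x <= 2^-1 ^+ j)%R%:R + layer_high a b j * (x <= 2 ^+ j.+1)%R%:R.
Proof.
move=> a0 ba x0; rewrite /layer_weight.
have low0 j : 0 <= layer_low b j by rewrite mulr_ge0 ?powR_ge0.
have high0 j : 0 <= layer_high a b j by rewrite powR_ge0.
have [->|xn0] := eqVneq x 0.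
  exists 0%N; rewrite expr0 ler01 !mulr1 addr0 powR1 mulr1 ler_wpDr//.
    by rewrite mulr_ge0.
  rewrite /layer_low expr0 powR1 mulr1.
  have [->|b0] := eqVneq b 0; first by rewrite normr0 !powRr0.
  by rewrite powR0// powR_ge0.
have {xn0} {}x0 : 0 < x by rewrite lt_def xn0.
have [x1|x1] := leP x 1.
  have [|j /andP[j1 j2]] := @dyadic_low x; first by rewrite x0.
  exists j; rewrite j2 mulr1 ler_wpDr// ?mulr_ge0//.
  apply: le_trans (powR_layer_le b a0 _) _; first by rewrite (ltW x0).
  have j0 : 0 < (2^-1 : R) ^+ j by rewrite exprn_gt0// invr_gt0.
  rewrite /layer_low -[in leLHS](divfK (lt0r_neq0 j0) x).
  rewrite powRM ?divr_ge0 ?(ltW x0) ?(ltW j0)//.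
  apply: ler_wpM2r; first exact: powR_ge0.
  by rewrite powR_half_le// ltr_pdivlMr// -exprS j1 /= ler_pdivrMr// mul1r.
have [j /andP[j1 j2]] := dyadic_high x1.
exists j; rewrite j2 mulr1 ler_wpDl// ?mulr_ge0//.
have ->: layer_high a b j = (2 ^+ j) `^ (b - a) by [].
apply: (@le_trans _ _ (x `^ (b - a))).
  rewrite powRD ?(lt0r_neq0 x0) ?implybT// ler_wpM2l ?powR_ge0//.
  rewrite !powRN lef_pV2 ?posrE ?powR_gt0//; last by lra.
  by apply: ge0_ler_powR; rewrite ?nnegrE ?ltW//; lra.
have j0 : 0 < (2 : R) ^+ j by rewrite exprn_gt0.
rewrite -opprB !powRN lef_pV2 ?posrE ?powR_gt0//.
by apply: ge0_ler_powR; rewrite ?nnegrE ?subr_ge0 ?ltW.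
Qed.

(** Summing over dyadic shells, the integral of h over a shell of size [t] being at
    most [C t], gives two geometric series, of ratios [2^-(b+1)] and [2^(b+1-a)]; both
    ratios are below 1 exactly under the two hypotheses on the exponents. *)
Lemma layer_bound1 (a b : R) : -1 < b -> b + 1 < a ->
  exists2 K : R, 0 <= K & forall d (T : measurableType d)
    (mu : {measure set T -> \bar R}) (D : set T) (h g : T -> R) (C : R),
  measurable D -> measurable_fun D h -> (forall x, D x -> 0 <= h x) ->
  measurable_fun D g -> (forall x, D x -> 0 <= g x) -> 0 <= C ->
  (forall t : R, (0 < t)%R ->
    \int[mu]_(x in D `&` [set x | g x <= t]%R) (h x)%:E <= (C * t)%:E)%E ->
  (\int[mu]_(x in D) (h x * layer_weight a b (g x))%:E <= (K * C)%:E)%E.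
Proof.
move=> b1 ba.
have a0 : 0 < a by lra.
have ba' : b < a by lra.
pose q1 : R := 2^-1 `^ (b + 1); pose q2 : R := 2 `^ (b + 1 - a).
have q1b : 0 <= q1 < 1.
  rewrite powR_ge0 /= -[ltRHS](_ : 1 `^ (b + 1) = 1); last by rewrite powR1.
  apply: gt0_ltr_powR; rewrite ?nnegrE ?invr_ge0//; first lra.
  by rewrite invf_lt1// ltr1n.
have q2b : 0 <= q2 < 1.
  rewrite powR_ge0 /= /q2 -opprB powRN invf_lt1 ?powR_gt0//.
  rewrite -[ltLHS](_ : 1 `^ (a - (b + 1)) = 1); last by rewrite powR1.
  by apply: gt0_ltr_powR; rewrite ?nnegrE ?ltr1n//; lra.
have q1E j : layer_low b j * 2^-1 ^+ j = 2 `^ `|b| * q1 ^+ j.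
  have h0 : 0 < (2^-1 : R) by rewrite invr_gt0.
  by rewrite /layer_low /q1 -mulrA powR_exprn ?(ltW h0)// powRD1_exprn.
have q2E j : layer_high a b j * 2 ^+ j.+1 = 2 * q2 ^+ j.
  have h0 : 0 < (2 : R) by [].
  rewrite /layer_high /q2 exprS mulrCA; congr (_ * _).
  rewrite powR_exprn// (_ : b + 1 - a = b - a + 1); last by ring.
  by rewrite powRD1_exprn.
pose K := 2 `^ `|b| * (1 - q1)^-1 + 2 * (1 - q2)^-1.
exists K.
  by rewrite addr_ge0// mulr_ge0 ?powR_ge0// invr_ge0 subr_ge0 ltW//; lra.
move=> d T mu D h g C mD mh h0 mg g0 C0 H.
have mle t : measurable (D `&` [set x | g x <= t]%R).
  by apply: measurable_fun_le => //; exact: measurable_cst.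
have low0 j : 0 <= layer_low b j by rewrite mulr_ge0 ?powR_ge0.
have high0 j : 0 <= layer_high a b j by rewrite powR_ge0.
pose I t x : R := h x * (g x <= t)%R%:R.
have I0 t x : D x -> 0 <= I t x by move=> Dx; rewrite mulr_ge0 ?h0.
have mI t : measurable_fun D (I t).
  apply: measurable_funM => //.
  rewrite (_ : (fun x => _) = (fun b : bool => b%:R) \o (fun x => g x <= t))//.
  apply: (measurable_comp (F := setT)) => //.
  by apply: measurable_fun_ler => //.
have HI t : 0 < t -> (\int[mu]_(x in D) (I t x)%:E <= (C * t)%:E)%E.
  move=> t0; apply: le_trans (H t t0); rewrite le_eqVlt; apply/orP; left; apply/eqP.
  rewrite setIC integral_mkcondl; apply: eq_integral => x _.
  rewrite patchE /I; case: ifPn => [|]; first by rewrite inE /= => ->; rewrite mulr1.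
  by rewrite notin_setE /= => /negP/negbTE ->; rewrite mulr0.
pose F j x := (layer_low b j * I (2^-1 ^+ j) x + layer_high a b j * I (2 ^+ j.+1) x)%:E.
have F0 j x : D x -> (0 <= F j x)%E.
  by move=> Dx; rewrite lee_fin addr_ge0// mulr_ge0// I0.
have mF j : measurable_fun D (F j).
  by apply/measurable_EFinP; apply: measurable_funD; apply: measurable_funM.
have FI j : (\int[mu]_(x in D) F j x <=
    (C * (2 `^ `|b| * q1 ^+ j + 2 * q2 ^+ j))%:E)%E.
  rewrite [leLHS](_ : _ = \int[mu]_(x in D)
    ((layer_low b j)%:E * (I (2^-1 ^+ j) x)%:E +
     (layer_high a b j)%:E * (I (2 ^+ j.+1) x)%:E))%E//.
  have m2 t : measurable_fun D (fun x => (I t x)%:E) by apply/measurable_EFinP.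
  rewrite ge0_integralD//; last 4 first.
  - by move=> x Dx; rewrite mule_ge0// lee_fin ?I0.
  - by apply: emeasurable_funM => //; exact: m2.
  - by move=> x Dx; rewrite mule_ge0// lee_fin ?I0.
  - by apply: emeasurable_funM => //; exact: m2.
  rewrite !ge0_integralZl_EFin//; try by move=> x Dx; rewrite lee_fin I0.
  rewrite mulrDr EFinD -q1E -q2E; apply: leeD.
    rewrite mulrCA [leRHS]EFinM; apply: lee_wpmul2l; first by rewrite lee_fin.
    by rewrite HI// exprn_gt0// invr_gt0.
  rewrite mulrCA [leRHS]EFinM; apply: lee_wpmul2l; first by rewrite lee_fin.
  by rewrite HI// exprn_gt0.
apply: (@le_trans _ _ (\int[mu]_(x in D) \sum_(0 <= j <oo) F j x)%E).
  have mS : measurable_fun D (fun x => \sum_(0 <= j <oo) F j x)%E.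
    by apply: (ge0_emeasurable_sum (P := xpredT)) => // j x Dx _; exact: F0.
  apply: ge0_le_integral => //.
  - by move=> x Dx; rewrite lee_fin !mulr_ge0 ?h0 ?powR_ge0.
  - apply/measurable_EFinP; apply: measurable_funM => //; apply: measurable_funM.
      exact: (measurableT_comp (measurable_powR _) mg).
    apply: (measurableT_comp (measurable_powR _)).
    exact: measurable_funD.
  - move=> x Dx; have [j Hj] := layer_weight_le a0 ba' (g0 _ Dx).
    apply: (@le_trans _ _ (F j x)).
      rewrite lee_fin /I (mulrCA (layer_low b j)) (mulrCA (layer_high a b j)) -mulrDr.
      by apply: ler_wpM2l; first exact: h0.
    rewrite (@nneseriesD1 _ _ j)//; last by move=> k _; exact: F0.
    by rewrite leeDl// nneseries_ge0// => k _ _; exact: F0.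
rewrite integral_nneseries//.
apply: lime_le.
  by apply: is_cvg_nneseries => j _ _; apply: integral_ge0 => x; exact: F0.
apply: nearW => N.
apply: (@le_trans _ _ (\sum_(0 <= j < N) (C * (2 `^ `|b| * q1 ^+ j + 2 * q2 ^+ j))%:E)%E).
  by apply: lee_sum => j _; exact: FI.
rewrite sumEFin lee_fin -mulr_sumr mulrC ler_wpM2r// big_split/= -!mulr_sumr.
by apply: lerD; apply: ler_wpM2l; rewrite ?powR_ge0// geometric_sum_le.
Qed.

(** The scaled form of [layer_bound1], applied to [g / e]. *)
Lemma layer_bound (a b : R) : -1 < b -> b + 1 < a ->
  exists2 K : R, 0 <= K & forall d (T : measurableType d)
    (mu : {measure set T -> \bar R}) (D : set T) (h g : T -> R) (C e : R),
  measurable D -> measurable_fun D h -> (forall x, D x -> 0 <= h x) ->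
  measurable_fun D g -> (forall x, D x -> 0 <= g x) -> 0 <= C -> 0 < e ->
  (forall t : R, (0 < t)%R ->
    \int[mu]_(x in D `&` [set x | g x <= t]%R) (h x)%:E <= (C * t)%:E)%E ->
  (\int[mu]_(x in D) (h x * (g x `^ b * (e + g x) `^ (- a)))%:E <=
    (K * C * e `^ (b + 1 - a))%:E)%E.
Proof.
move=> b1 ba; have [K K0 HK] := layer_bound1 b1 ba.
exists K => // d T mu D h g C e mD mh h0 mg g0 C0 e0 H.
have -> : (K * C * e `^ (b + 1 - a))%:E = ((e `^ (b - a))%:E * (K * (C * e))%:E)%E.
  rewrite -EFinM; congr EFin.
  have -> : b + 1 - a = (b - a) + 1 by ring.
  rewrite (@powRD _ _ (b - a) 1); last by rewrite (lt0r_neq0 e0) implybT.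
  by rewrite powRr1 ?(ltW e0)//; ring.
apply: (@le_trans _ _ ((e `^ (b - a))%:E *
    \int[mu]_(x in D) (h x * layer_weight a b (g x / e))%:E)%E).
  rewrite -ge0_integralZl_EFin ?powR_ge0//; last 2 first.
  - by move=> x Dx; rewrite lee_fin !mulr_ge0 ?h0 ?powR_ge0.
  - apply/measurable_EFinP; apply: measurable_funM => //.
    rewrite /layer_weight; apply: measurable_funM;
      apply: (measurableT_comp (measurable_powR _)).
      exact: measurable_funM.
    by apply: measurable_funD => //; exact: measurable_funM.
  rewrite le_eqVlt; apply/orP; left; apply/eqP; apply: eq_integral => x /set_mem Dx.
  rewrite -EFinM; congr EFin; rewrite [RHS]mulrCA; congr (_ * _).
  rewrite /layer_weight.
  have -> : e + g x = e * (1 + g x / e) by field; rewrite gt_eqF.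
  have ge : 0 <= g x / e by rewrite divr_ge0 ?g0// ltW.
  rewrite powRM ?(ltW e0)//; last by rewrite addr_ge0.
  rewrite -{1}(divfK (lt0r_neq0 e0) (g x)) (@powRM _ _ e b) ?(ltW e0)//.
  rewrite (@powRD _ _ b (- a)); last by rewrite (lt0r_neq0 e0) implybT.
  ring.
apply: lee_wpmul2l; first by rewrite lee_fin powR_ge0.
apply: HK => //.
- by apply: measurable_funM.
- by move=> x Dx; rewrite divr_ge0 ?g0// ltW.
- by rewrite mulr_ge0// ltW.
move=> t t0; rewrite -mulrA (mulrC e).
under eq_set do rewrite ler_pdivrMr//.
by apply: H; rewrite mulr_gt0.
Qed.

End layers.

(** * Hermitian geometry of the ball *)

Section complex_measurability.
Context {R : realType} {d : measure_display} {T : measurableType d}.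
Implicit Types f g : T -> R[i].

Definition cmeasurable f :=
  measurable_fun setT (fun x => complex.Re (f x)) /\ measurable_fun setT (fun x => complex.Im (f x)).

Lemma cmeasurable_cst c : cmeasurable (fun=> c).
Proof. by split; exact: measurable_cst. Qed.

Lemma cmeasurableD f g : cmeasurable f -> cmeasurable g ->
  cmeasurable (fun x => f x + g x).
Proof.
move=> [f1 f2] [g1 g2]; split.
  rewrite (_ : (fun _ => _) = fun x => complex.Re (f x) + complex.Re (g x)); first exact: measurable_funD.
  by apply/funext => x; case: (f x) (g x) => [? ?] [? ?].
rewrite (_ : (fun _ => _) = fun x => complex.Im (f x) + complex.Im (g x)); first exact: measurable_funD.
by apply/funext => x; case: (f x) (g x) => [? ?] [? ?].
Qed.

Lemma cmeasurableM f g : cmeasurable f -> cmeasurable g ->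
  cmeasurable (fun x => f x * g x).
Proof.
move=> [f1 f2] [g1 g2]; split.
  rewrite (_ : (fun _ => _) = fun x => complex.Re (f x) * complex.Re (g x) - complex.Im (f x) * complex.Im (g x)).
    by apply: measurable_funB; exact: measurable_funM.
  by apply/funext => x; case: (f x) (g x) => [? ?] [? ?].
rewrite (_ : (fun _ => _) = fun x => complex.Re (f x) * complex.Im (g x) + complex.Im (f x) * complex.Re (g x)).
  by apply: measurable_funD; exact: measurable_funM.
by apply/funext => x; case: (f x) (g x) => [? ?] [? ?].
Qed.

Lemma cmeasurable_sum (I : Type) (s : seq I) (f : I -> T -> R[i]) :
  (forall i, cmeasurable (f i)) -> cmeasurable (fun x => \sum_(i <- s) f i x).
Proof.
move=> mf; elim: s => [|i s IH].
  by under eq_fun do rewrite big_nil; exact: cmeasurable_cst.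
by under eq_fun do rewrite big_cons; exact: cmeasurableD.
Qed.

Lemma cmeasurable_prod (I : Type) (s : seq I) (f : I -> T -> R[i]) :
  (forall i, cmeasurable (f i)) -> cmeasurable (fun x => \prod_(i <- s) f i x).
Proof.
move=> mf; elim: s => [|i s IH].
  by under eq_fun do rewrite big_nil; exact: cmeasurable_cst.
by under eq_fun do rewrite big_cons; exact: cmeasurableM.
Qed.

Lemma cmeasurableX f k : cmeasurable f -> cmeasurable (fun x => f x ^+ k).
Proof.
move=> mf; elim: k => [|k IH].
  by under eq_fun do rewrite expr0; exact: cmeasurable_cst.
by under eq_fun do rewrite exprS; exact: cmeasurableM.
Qed.

Lemma measurable_normc f : cmeasurable f ->
  measurable_fun setT (fun x => Normc.normc (f x)).
Proof.
move=> [f1 f2].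
rewrite (_ : (fun _ => _) = fun x => Num.sqrt (complex.Re (f x) ^+ 2 + complex.Im (f x) ^+ 2)).
  apply: (@measurableT_comp _ _ _ _ _ _ (@Num.sqrt R)).
    exact: continuous_measurable_fun (@sqrt_continuous R).
  by apply: measurable_funD; exact: measurable_funX.
by apply/funext => x; case: (f x).
Qed.

End complex_measurability.

Section hermitian_geometry.
Context {R : realType}.
Local Notation "x %:C" := (real_complex _ x).

Lemma normcE2 (x : R[i]) : (Normc.normc x ^+ 2)%:C = x * x^*.
Proof. by have := sqr_normc x; rewrite -rmorphXn. Qed.

Lemma normc_ge0 (x : R[i]) : 0 <= Normc.normc x.
Proof. by case: x => a b; exact: sqrtr_ge0. Qed.

Lemma normcR (x : R) : Normc.normc x%:C = `|x|.
Proof. by rewrite /= expr0n addr0 sqrtr_sqr. Qed.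

Lemma normc_eq0 (x : R[i]) : (Normc.normc x == 0) = (x == 0).
Proof.
apply/eqP/eqP => [/Normc.eq0_normc//|->]; exact: Normc.normc0.
Qed.

Lemma normc_prod (I : Type) (s : seq I) (f : I -> R[i]) :
  Normc.normc (\prod_(i <- s) f i) = \prod_(i <- s) Normc.normc (f i).
Proof. by apply: big_morph; [exact: Normc.normcM|exact: Normc.normc1]. Qed.

Lemma normcX (x : R[i]) k : Normc.normc (x ^+ k) = Normc.normc x ^+ k.
Proof. by elim: k => [|k IH]; rewrite ?expr0 ?Normc.normc1// !exprS Normc.normcM IH. Qed.

Context {n : nat}.
Implicit Types z a b : 'rV[R[i]]_n.

Lemma hnorm_ge0 z : 0 <= hnorm z. Proof. exact: sqrtr_ge0. Qed.

Lemma sqr_hnorm z : hnorm z ^+ 2 = \sum_(j < n) Normc.normc (z 0 j) ^+ 2.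
Proof. by rewrite sqr_sqrtr// sumr_ge0// => j _; exact: sqr_ge0. Qed.

Lemma sqr_hnormC z : (hnorm z ^+ 2)%:C = hdot z z.
Proof. by rewrite sqr_hnorm rmorph_sum; apply: eq_bigr => j _; exact: normcE2. Qed.

Lemma normc_le_hnorm z j : Normc.normc (z 0 j) <= hnorm z.
Proof.
rewrite -(@ler_pXn2r _ 2) ?nnegrE ?normc_ge0 ?hnorm_ge0// sqr_hnorm (bigD1 j)//=.
by rewrite lerDl sumr_ge0// => i _; exact: sqr_ge0.
Qed.

Lemma hdotDl z1 z2 a : hdot (z1 + z2) a = hdot z1 a + hdot z2 a.
Proof. by rewrite -big_split; apply: eq_bigr => j _; rewrite mxE mulrDl. Qed.

Lemma hdotZl c z a : hdot (c *: z) a = c * hdot z a.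
Proof. by rewrite /hdot mulr_sumr; apply: eq_bigr => j _; rewrite mxE mulrA. Qed.

Lemma hdotC z a : hdot z a = (hdot a z)^*.
Proof.
rewrite /hdot rmorph_sum; apply: eq_bigr => j _.
by rewrite rmorphM mulrC /= conjCK.
Qed.

Lemma hdotDr z a1 a2 : hdot z (a1 + a2) = hdot z a1 + hdot z a2.
Proof. by rewrite hdotC hdotDl rmorphD /= -!hdotC. Qed.

Lemma hdotZr c z a : hdot z (c *: a) = c^* * hdot z a.
Proof. by rewrite hdotC hdotZl rmorphM /= -hdotC. Qed.

Lemma hdot_comb x y z a : hdot (x *: z + y *: a) (x *: z + y *: a) =
  x * x^* * hdot z z + x * y^* * hdot z a + y * x^* * hdot a z + y * y^* * hdot a a.
Proof. by rewrite !(hdotDl, hdotDr, hdotZl, hdotZr); ring. Qed.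

Lemma hnorm_eq0 z : hnorm z = 0 -> z = 0.
Proof.
move=> z0; apply/rowP => j; rewrite mxE; apply/eqP; rewrite -normc_eq0 eq_le normc_ge0 andbT.
by rewrite -z0 normc_le_hnorm.
Qed.

Lemma hdot0r z : hdot z 0 = 0.
Proof.
rewrite hdotC (_ : hdot 0 z = 0) ?rmorph0// /hdot big1// => j _.
by rewrite mxE mul0r.
Qed.

Lemma hnormZ c z : hnorm (c *: z) = Normc.normc c * hnorm z.
Proof.
apply/eqP; rewrite -(@eqrXn2 _ 2) ?mulr_ge0 ?normc_ge0 ?hnorm_ge0//; apply/eqP.
rewrite exprMn !sqr_hnorm mulr_sumr; apply: eq_bigr => j _.
by rewrite mxE Normc.normcM exprMn.
Qed.

Lemma hnormZR (c : R) z : hnorm (c%:C *: z) = `|c| * hnorm z.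
Proof. by rewrite hnormZ normcR. Qed.

(** At [a = 0] both sides vanish, with the convention that dividing by 0 gives 0;
    this is what makes the formula for [Phi] uniform in [a]. *)
Lemma hdot_proj z a : hdot z a = hdot z a / hdot a a * hdot a a.
Proof.
have [a0|a0] := eqVneq (hdot a a) 0; last by rewrite divfK.
rewrite a0 mulr0.
have /complexI/eqP : (hnorm a ^+ 2)%:C = 0%:C by rewrite sqr_hnormC a0.
by rewrite sqrf_eq0 => /eqP/hnorm_eq0 ->; exact: hdot0r.
Qed.

Lemma cauchy_schwarz z a : Normc.normc (hdot z a) <= hnorm z * hnorm a.
Proof.
have [a0|a0] := eqVneq (hnorm a) 0.
  by rewrite a0 mulr0 (hnorm_eq0 a0) hdot0r Normc.normc0.
have A0 : hdot a a != 0.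
  by rewrite -sqr_hnormC; apply: contra a0 => /eqP/complexI/eqP; rewrite sqrf_eq0.
pose c := hdot z a / hdot a a.
rewrite -(@ler_pXn2r _ 2) ?nnegrE ?mulr_ge0 ?normc_ge0 ?hnorm_ge0//.
rewrite -lecR exprMn [leRHS]rmorphM /= !sqr_hnormC normcE2.
have : 0 <= (hnorm (1 *: z + (- c) *: a) ^+ 2)%:C by rewrite lecR sqr_ge0.
rewrite sqr_hnormC hdot_comb.
have -> : (- c)^* = - ((hdot z a)^* / hdot a a).
  rewrite rmorphN /= /c rmorphM /=; congr (- (_ * _)).
  by rewrite fmorphV /= -hdotC.
rewrite rmorph1 (hdotC a z) /c.
set w := hdot z a; set w' := w^*; set A := hdot a a; set Z := hdot z z => H.
have AA : 0 <= A by rewrite /A -sqr_hnormC lecR sqr_ge0.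
rewrite -subr_ge0; have := mulr_ge0 AA H; congr (0 <= _); field.
exact: A0.
Qed.

Lemma one_sub_hdot_neq0 z a : uball a -> uball z -> 1 - hdot z a != 0.
Proof.
rewrite /uball/= => a1 z1; rewrite subr_eq0; apply/eqP => h.
have := cauchy_schwarz z a; rewrite -h Normc.normc1 leNgt => /negP; apply.
by rewrite mulr_ilt1 ?hnorm_ge0.
Qed.

(** The fundamental identity of the involutions of the ball.  [Phi_a z] is a
    combination of [a] and [z] whose coefficients involve [c = <z,a>/<a,a>] and
    [s], the square root of [1-|a|^2]; the identity is then polynomial in
    these once [s^2] and [<z,a> = c <a,a>] are substituted. *)
Lemma one_sub_sqr_hnorm_Phi a z : uball a -> uball z ->
  1 - hnorm (Phi a z) ^+ 2 =
  (1 - hnorm a ^+ 2) * (1 - hnorm z ^+ 2) / Normc.normc (1 - hdot z a) ^+ 2.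
Proof.
move=> ua uz; have w0 := one_sub_hdot_neq0 ua uz.
have s2 : ((Num.sqrt (1 - hnorm a ^+ 2))%:C) ^+ 2 = 1 - hdot a a.
  rewrite -rmorphXn /= sqr_sqrtr; first by rewrite rmorphB rmorph1 /= sqr_hnormC.
  by rewrite subr_ge0 exprn_ile1 ?hnorm_ge0// ltW.
apply: (@complexI R); rewrite fmorph_div rmorphM !rmorphB rmorph1 /=.
rewrite normcE2 !sqr_hnormC rmorphB rmorph1 /=.
set A := hdot a a in s2 *; set Z := hdot z z; set w := hdot z a.
set c := w / A; set s := (Num.sqrt _)%:C in s2 *.
have wE : w = c * A := hdot_proj z a.
have AJ : A^* = A by rewrite /A -hdotC.
have w'E : w^* = c^* * A by rewrite wE rmorphM /= AJ.
have sJ : s^* = s by exact: conjc_real.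
have w'0 : 1 - w^* != 0.
  by apply: contra w0; rewrite -conjC_eq0 rmorphB rmorph1 /= conjCK.
have PhiE : Phi a z = ((1 - w)^-1 * (1 - c + s * c)) *: a + (- ((1 - w)^-1 * s)) *: z.
  by apply/rowP => j; rewrite /Phi /hproj -/w -/A -/c -/s !mxE; ring.
clearbody c s.
have JE : ((1 - w)^-1)^* = (1 - c^* * A)^-1.
  by rewrite fmorphV rmorphB rmorph1 /= w'E.
have xE : ((1 - w)^-1 * (1 - c + s * c))^* = (1 - c^* * A)^-1 * (1 - c^* + s * c^*).
  by rewrite rmorphM /= JE rmorphD rmorphB rmorph1 rmorphM /= sJ.
have yE : (- ((1 - w)^-1 * s))^* = - ((1 - c^* * A)^-1 * s).
  by rewrite rmorphN rmorphM /= JE sJ.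
rewrite PhiE hdot_comb xE yE (hdotC a z) -/w -/A -/Z.
rewrite -/w in w0; rewrite w'E in w'0 *; rewrite wE in w0 *.
set c' := c^* in w'0 *.
apply: (@mulIf _ ((1 - c * A) * (1 - c' * A))); first by rewrite mulf_neq0.
transitivity ((1 - A) * (1 - Z)); last by field; rewrite w0 w'0.
transitivity ((1 - c * A) * (1 - c' * A) - ((1 - c + s * c) * (1 - c' + s * c') * A
   - s * (1 - c + s * c) * (c' * A) - s * (1 - c' + s * c') * (c * A) + s ^+ 2 * Z)).
  by field; rewrite w0 w'0.
rewrite s2 (_ : (1 - c + s * c) * (1 - c' + s * c') * A
   - s * (1 - c + s * c) * (c' * A) - s * (1 - c' + s * c') * (c * A) =
   (1 - c) * (1 - c') * A - s ^+ 2 * (c * c' * A)); last by ring.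
by rewrite s2; ring.
Qed.

End hermitian_geometry.

(** * A unitary map taking a point to the first axis *)

Section unitary_maps.
Context {R : realType}.
Local Notation "x %:C" := (real_complex _ x).

Definition tvec {n} (z : 'rV[R[i]]_n) : n.-tuple (plane R) :=
  [tuple ((complex.Re (z 0 j) : measurableTypeR R),
          (complex.Im (z 0 j) : measurableTypeR R)) | j < n].

Lemma tvecK n : cancel (@tvec n) cvec.
Proof. by move=> z; apply/rowP => j; rewrite !mxE tnth_mktuple /=; case: (z 0 j). Qed.

Lemma cvecK n : cancel (@cvec R n) tvec.
Proof.
move=> t; apply/eq_from_tnth => j; rewrite tnth_mktuple mxE /=.
by case: (tnth t j).
Qed.

Lemma cmeasurable_cvec n (j : 'I_n) :
  cmeasurable (fun t : n.-tuple (plane R) => cvec t 0 j).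
Proof.
have mt := @measurable_tnth _ (plane R) n j.
split.
  rewrite (_ : (fun _ => _) = fun t : n.-tuple (plane R) => (tnth t j).1).
    exact: (measurableT_comp measurable_fst mt).
  by apply/funext => t; rewrite mxE.
rewrite (_ : (fun _ => _) = fun t : n.-tuple (plane R) => (tnth t j).2).
  exact: (measurableT_comp measurable_snd mt).
by apply/funext => t; rewrite mxE.
Qed.

Lemma cmeasurable_hdot n (a : 'rV[R[i]]_n) :
  cmeasurable (fun t : n.-tuple (plane R) => hdot (cvec t) a).
Proof.
apply: cmeasurable_sum => j; apply: cmeasurableM.
  exact: cmeasurable_cvec.
exact: cmeasurable_cst.
Qed.

Lemma measurable_mulmx n (M : 'M[R[i]]_n) :
  measurable_fun setT (fun t : n.-tuple (plane R) => tvec (cvec t *m M)).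
Proof.
apply/measurable_fun_tnthP => j.
rewrite (_ : _ \o _ = fun t : n.-tuple (plane R) =>
    ((complex.Re (\sum_k cvec t 0 k * M k j) : measurableTypeR R),
     (complex.Im (\sum_k cvec t 0 k * M k j) : measurableTypeR R))); last first.
  by apply/funext => t /=; rewrite tnth_mktuple mxE.
have [m1 m2] : cmeasurable (fun t : n.-tuple (plane R) => \sum_k cvec t 0 k * M k j).
  apply: cmeasurable_sum => k; apply: cmeasurableM; first exact: cmeasurable_cvec.
  exact: cmeasurable_cst.
exact: measurable_fun_pair.
Qed.

Lemma mul_adjoint_hdot n (z a : 'rV[R[i]]_n) :
  z *m (map_mx Num.conj a^T) = (hdot z a)%:M.
Proof.
apply/rowP => i; rewrite !mxE (ord1 i) eqxx mulr1n.
by apply: eq_bigr => j _; rewrite !mxE.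
Qed.

(** The Gram-Schmidt basis obtained from a family whose first vector is [a] is
    unitary, and its first vector is a nonnegative multiple of [a]; the matrix of
    the basis change is the required map. *)
Lemma unitary_to_axis m (a : 'rV[R[i]]_m.+1) :
  exists phi : m.+1.-tuple (plane R) -> m.+1.-tuple (plane R),
  [/\ measurable_fun setT phi,
      forall v t, phi (affine 1 v t) = affine 1 (phi v) (phi t),
      forall y, exists v, phi v = y,
      forall t, hnorm (cvec (phi t)) = hnorm (cvec t) &
      forall t, hdot (cvec t) a = cvec (phi t) 0 0 * (hnorm a)%:C].
Proof.
pose A : 'M[R[i]]_m.+1 := \matrix_(i < m.+1) a.
pose S := spectral.schmidt A.
have SU : S *m map_mx Num.conj S^T = 1%:M.
  by apply/eqP; exact: (spectral.schmidt_unitarymx A (leqnn _)).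
have SU' : map_mx Num.conj S^T *m S = 1%:M by apply: mulmx1C.
pose M := map_mx Num.conj S^T.
have hdotM z b : hdot (z *m M) (b *m M) = hdot z b.
  have : (hdot (z *m M) (b *m M))%:M = (hdot z b)%:M :> 'M[R[i]]_1.
    rewrite -!mul_adjoint_hdot trmx_mul map_mxM -mulmxA (mulmxA M).
    rewrite (_ : map_mx Num.conj M^T = S); first by rewrite SU' mul1mx.
    by apply/matrixP => i j; rewrite !mxE conjCK.
  by move/matrixP => /(_ 0 0); rewrite !mxE eqxx !mulr1n.
have rowA : row 0 A = a by apply/rowP => j; rewrite !mxE.
have [c aE] : exists c : R[i], a = c *: row 0 S.
  have := spectral.row_schmidt_sub A 0.
  rewrite rowA (big_pred1 0) => [|i]; last by rewrite leqn0.
  by rewrite genmxE => /sub_rVP[c ->]; exists c.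
have aM : a *m M = c *: delta_mx 0 0.
  rewrite aE -scalemxAl -row_mul SU; congr (_ *: _).
  by rewrite row1.
have normM z : hnorm (z *m M) = hnorm z.
  apply/eqP; rewrite -(@eqrXn2 _ 2) ?hnorm_ge0//; apply/eqP.
  by apply: complexI; rewrite !sqr_hnormC hdotM.
have S00 : hdot (row 0 S) (row 0 S) = 1.
  have := congr1 (fun M : 'M[R[i]]_m.+1 => M 0 0) SU; rewrite !mxE eqxx mulr1n => <-.
  by apply: eq_bigr => j _; rewrite !mxE.
have nS : hnorm (row 0 S) = 1.
  apply/eqP; rewrite -(@eqrXn2 _ 2) ?hnorm_ge0//; apply/eqP.
  by apply: complexI; rewrite sqr_hnormC S00 expr1n.
have c0 : 0 <= c.
  have := spectral.form1_row_schmidt A 0; rewrite rowA.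
  rewrite (_ : spectral.dotmx _ _ = hdot a (row 0 S)).
    by rewrite aE hdotZl S00 mulr1.
  rewrite /spectral.dotmx /sesquilinear.form_of_matrix mulmx1 trace_mx11 mxE.
  by apply: eq_bigr => j _; rewrite !mxE.
have cE : c = (hnorm a)%:C.
  by rewrite aE hnormZ nS mulr1 -[LHS]ger0_norm.
exists (fun t => tvec (cvec t *m M)); split.
- exact: measurable_mulmx.
- move=> v t; apply: (can_inj (@cvecK _)).
  rewrite tvecK !cvec_affine !tvecK !scale1r.
  by rewrite mulmxDl.
- move=> y; exists (tvec (cvec y *m S)).
  by rewrite tvecK -mulmxA SU mulmx1 cvecK.
- by move=> t; rewrite tvecK normM.
- move=> t; rewrite tvecK -hdotM aM hdotZr cE.
  rewrite /hdot (bigD1 0)//= big1 => [|j j0].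
    by rewrite addr0 !mxE eqxx rmorph1 mulr1 mulrC; congr (_ * _); exact: conjc_real.
  by rewrite !mxE (negbTE j0) andbF rmorph0 mulr0.
Qed.

End unitary_maps.

(** * Homogeneous functions against powers of 1-|z|^2 *)

Section homogeneous_weights.
Context {R : realType} {n : nat}.
Local Notation T := (n.-tuple (plane R)).
Local Notation leb := (@lebesgue_cvec R n).
Local Notation ball := (cvec @^-1` uball : set T).
Local Notation zero := ([tuple (0, 0) | j < n] : T).

(** Homogeneity of degree 0: such a function depends on the direction of z
    only. *)
Definition homogeneous0 (h : T -> R) :=
  forall c t, 0 < c -> h (affine c zero t) = h t.

Lemma hnorm_affine (c : R) (t : T) : hnorm (cvec (affine c zero t)) = `|c| * hnorm (cvec t).
Proof.
rewrite cvec_affine (_ : cvec zero = 0) ?addr0 ?hnormZR//.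
by apply/rowP => j; rewrite !mxE tnth_mktuple.
Qed.

Lemma measurable_hnorm_lt (r : R) : measurable [set t : T | hnorm (cvec t) < r].
Proof.
rewrite (_ : [set t | _] = (fun t => hnorm (@cvec R n t)) @^-1` `]-oo, r[%classic).
  by rewrite -[X in measurable X]setTI; exact: measurable_hnorm_cvec.
by apply/seteqP; split => t /=; rewrite in_itv.
Qed.

Lemma bernoulli_ineq (x : R) k : 0 <= x <= 1 -> 1 - k%:R * x <= (1 - x) ^+ k.
Proof.
move=> /andP[x0 x1]; elim: k => [|k IH]; first by rewrite expr0 mul0r subr0.
rewrite exprS; apply: (@le_trans _ _ ((1 - x) * (1 - k%:R * x))).
  rewrite -subr_ge0 -natr1.
  rewrite (_ : _ - _ = k%:R * x ^+ 2); last by ring.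
  by rewrite mulr_ge0// sqr_ge0.
by rewrite ler_wpM2l// subr_ge0.
Qed.

Lemma integral_small_ball (h : T -> R) (c : R) : homogeneous0 h ->
  measurable_fun setT h -> (forall t, 0 <= h t) -> 0 < c ->
  (\int[leb]_(t in [set t | (hnorm (cvec t) < c)%R]) (h t)%:E =
   (c ^+ (2 * n))%:E * \int[leb]_(t in ball) (h t)%:E)%E.
Proof.
move=> hh mh h0 c0.
rewrite integral_mkcond [in RHS]integral_mkcond.
have [_ _ H] := rescales_lebesgue_cvec zero (lt0r_neq0 c0).
rewrite -H; last 2 first.
- apply/(measurable_restrictT _ _).1 => //; first exact: measurable_hnorm_lt.
  by apply/measurable_EFinP; exact: measurable_funS mh.
- by move=> t; apply: erestrict_ge0 => x _; rewrite lee_fin.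
rewrite gtr0_norm//; congr (_ * _)%E; apply: eq_integral => t _.
rewrite !patchE hh//.
congr (if _ then _ else _); apply/idP/idP; rewrite !inE /uball /= hnorm_affine gtr0_norm//.
  by rewrite -ltr_pdivlMl// mulVf ?gt_eqF.
by move=> h1; rewrite -[ltRHS]mulr1 ltr_pM2l.
Qed.

(** By homogeneity the ball of radius r carries the part [r^(2n)] of the integral
    V of h, so the shell [1-|z|^2 <= x] carries [(1 - (1-x)^n) V], which is at most
    [n x V] by Bernoulli's inequality. *)
Lemma ball_layer (h : T -> R) (x V : R) : (0 < n)%N -> homogeneous0 h ->
  measurable_fun setT h -> (forall t, 0 <= h t) -> 0 < x ->
  (\int[@ball_volume R n]_(t in ball) (h t)%:E = V%:E)%E ->
  (\int[@ball_volume R n]_(t in ball `&` [set t | (1 - hnorm (cvec t) ^+ 2 <= x)%R])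
    (h t)%:E <= ((n%:R * V) * x)%:E)%E.
Proof.
move=> n0 hh mh h0 x0 HV.
have mB := @measurable_uball R n.
have mL : measurable (ball `&` [set t | (1 - hnorm (cvec t) ^+ 2 <= x)%R]).
  apply: measurable_fun_le => //; apply: measurable_funTS; apply: measurable_funB => //.
  by apply: measurable_funX; exact: measurable_hnorm_cvec.
have mhE D : measurable_fun D (fun t => (h t)%:E).
  by apply: measurable_funTS; exact/measurable_EFinP.
have hE0 t : (0 <= (h t)%:E)%E by rewrite lee_fin.
have V0 : 0 <= V by rewrite -lee_fin -HV; apply: integral_ge0 => t _.
have [x1|x1] := leP 1 x.
  apply: (@le_trans _ _ V%:E).
    by rewrite -HV; apply: ge0_subset_integral => //; exact: subIsetl.
  by rewrite lee_fin mulrAC ler_peMl// mulr_ege1// ler1n.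
(* The radius of the ball that is the complement of the shell. *)
pose c := Num.sqrt (1 - x).
have c0 : 0 < c by rewrite sqrtr_gt0 subr_gt0.
have c2 : c ^+ 2 = 1 - x by rewrite sqr_sqrtr// subr_ge0 ltW.
pose S := [set t : T | (hnorm (cvec t) < c)%R].
have mS : measurable S := measurable_hnorm_lt c.
have lt_c (t : T) : (hnorm (cvec t) < c) = (x < 1 - hnorm (cvec t) ^+ 2).
  rewrite ltrBrDl -ltrBrDr -c2 ltr_pXn2r ?nnegrE ?hnorm_ge0//.
  exact: ltW.
have SB : S `<=` ball.
  move=> t /=; rewrite /uball /= => tc; apply: (lt_trans tc).
  by rewrite -(@ltr_pXn2r _ 2) ?nnegrE ?(ltW c0)// c2 expr1n; lra.
have HS : (\int[@ball_volume R n]_(t in S) (h t)%:E = ((1 - x) ^+ n * V)%:E)%E.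
  rewrite integral_ball_volume// (setIidl SB) integral_small_ball//.
  rewrite exprM c2 muleCA EFinM -HV integral_ball_volume//.
  by rewrite setIid.
have BE : ball = (ball `&` [set t | (1 - hnorm (cvec t) ^+ 2 <= x)%R]) `|` S.
  apply/seteqP; split => [t Bt|t [[]//|/SB//]].
  have [h1|h1] := leP (1 - hnorm (cvec t) ^+ 2) x; first by left.
  by right; rewrite /S /= lt_c.
move: HV; rewrite {1}BE ge0_integral_setU//=; last first.
  rewrite disj_set2E; apply/eqP/seteqP; split => // t [[_ /= h1]].
  by rewrite /S /= lt_c ltNge h1.
rewrite HS => HV.
have fin : (\int[@ball_volume R n]_(t in ball `&` [set t | (1 - hnorm (cvec t) ^+ 2 <= x)%R])
    (h t)%:E)%E \is a fin_num.
  rewrite ge0_fin_numE; last exact: integral_ge0.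
  by rewrite ltey; apply/eqP => E; move: HV; rewrite E addye.
rewrite -(fineK fin) in HV *; move: HV; rewrite -EFinD => -[HV].
rewrite lee_fin.
have := @bernoulli_ineq x n; rewrite (ltW x0) (ltW x1) => /(_ isT) hb.
have := ler_wpM2r V0 hb; move: HV; lra.
Qed.

(** A substitute for integration in polar coordinates: [layer_bound] with
    [g = 1-|z|^2], [e = 1] and exponent [b + 2].  As [g <= 1] on the ball, the factor
    [(1+g)^(-(b+2))] is bounded below. *)
Lemma ball_weight (b : R) : (0 < n)%N -> -1 < b ->
  exists2 K : R, 0 <= K & forall (h : T -> R) (V : R), homogeneous0 h ->
  measurable_fun setT h -> (forall t, 0 <= h t) ->
  (\int[@ball_volume R n]_(t in ball) (h t)%:E = V%:E)%E ->
  (\int[@ball_volume R n]_(t in ball) (h t * (1 - hnorm (cvec t) ^+ 2) `^ b)%:E <=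
    (K * V)%:E)%E.
Proof.
move=> n0 b1.
have [K K0 HK] := @layer_bound R (b + 2) b b1 ltac:(lra).
exists (2 `^ (b + 2) * (K * n%:R)); first by rewrite !mulr_ge0 ?powR_ge0.
move=> h V hh mh h0 HV.
have mB := @measurable_uball R n.
have V0 : 0 <= V by rewrite -lee_fin -HV; apply: integral_ge0 => t _; rewrite lee_fin.
have mg : measurable_fun ball (fun t : T => 1 - hnorm (cvec t) ^+ 2).
  apply: measurable_funTS; apply: measurable_funB => //.
  by apply: measurable_funX; exact: measurable_hnorm_cvec.
have g01 (t : T) : ball t -> 0 < 1 - hnorm (cvec t) ^+ 2 <= 1.
  rewrite /uball /= => t1; rewrite subr_gt0 exprn_ilt1 ?hnorm_ge0//=.
  by rewrite gerBl sqr_ge0.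
have g0 (t : T) : ball t -> 0 <= 1 - hnorm (cvec t) ^+ 2.
  by move=> /g01 /andP[/ltW].
have {}HK := HK _ _ (@ball_volume R n) ball h (fun t => 1 - hnorm (cvec t) ^+ 2)
  (n%:R * V) 1 mB (measurable_funTS mh) (fun t _ => h0 t) mg g0
  (mulr_ge0 (ler0n _ _) V0) ltr01 (fun x x0 => ball_layer n0 hh mh h0 x0 HV).
rewrite powR1 mulr1 in HK.
have mw : measurable_fun ball (fun t : T => (1 - hnorm (cvec t) ^+ 2) `^ b).
  exact: (measurableT_comp (measurable_powR _) mg).
have mw2 : measurable_fun ball (fun t : T => (1 + (1 - hnorm (cvec t) ^+ 2)) `^ (- (b + 2))).
  by apply: (measurableT_comp (measurable_powR _)); exact: measurable_funD.
have mhB : measurable_fun ball h := measurable_funTS mh.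
rewrite [leRHS](_ : _ = (2 `^ (b + 2))%:E * (K * (n%:R * V))%:E)%E; last first.
  by rewrite -EFinM !mulrA.
have p0 : (0 <= (2 `^ (b + 2) : R)%:E)%E by rewrite lee_fin powR_ge0.
apply: (le_trans _ (lee_wpmul2l p0 HK)).
rewrite -ge0_integralZl_EFin ?powR_ge0//; last 2 first.
- by move=> t _; rewrite lee_fin !mulr_ge0 ?powR_ge0.
- by apply/measurable_EFinP; apply: measurable_funM => //; exact: measurable_funM.
apply: ge0_le_integral => //.
- by move=> t _; rewrite lee_fin !mulr_ge0 ?powR_ge0.
- by apply/measurable_EFinP; exact: measurable_funM.
- apply: measurable_funeM; apply/measurable_EFinP; apply: measurable_funM => //.
  exact: measurable_funM.
move=> t /g01 /andP[g1 g2]; rewrite -EFinM lee_fin mulrCA ler_wpM2l// mulrCA.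
rewrite ler_peMr ?powR_ge0// powRN ler_pdivlMr ?powR_gt0//; last by lra.
rewrite mul1r; apply: ge0_ler_powR; rewrite ?nnegrE//; lra.
Qed.

End homogeneous_weights.

(** * Uniform bounds for powers of 1-|Phi_a|^2 *)

Section iterated_integrals.
Context {R : realType}.
Local Notation leb := (@lebesgue_measure R).

Lemma integral_tcons_zxy m (F : m.+1.-tuple (plane R) -> \bar R) :
  measurable_fun setT F -> (forall t, (0 <= F t)%E) ->
  (\int[@lebesgue_cvec R m.+1]_t F t =
   \int[@lebesgue_cvec R m]_z \int[leb]_x \int[leb]_y F (tcons (z, x, y)))%E.
Proof.
move=> mF F0; rewrite integral_lebesgue_cvecS//.
have mFt : measurable_fun setT (fun x => F (@tcons R m x)).
  exact: (measurableT_comp mF (@measurable_tcons R m)).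
rewrite -[LHS]/(\int[sfprod (sfprod (@lebesgue_cvec R m) leb) leb]_x F (tcons x))%E.
rewrite (fubini_tonelli1 (fun x => F (tcons x)))//.
rewrite -[LHS]/(\int[sfprod (@lebesgue_cvec R m) leb]_x
  fubini_F leb (fun x => F (tcons x)) x)%E.
rewrite (fubini_tonelli1 (fubini_F leb (fun x => F (tcons x))))//.
  exact: measurable_fun_fubini_tonelli_F.
by move=> x; exact: integral_ge0.
Qed.

Lemma integral_tcons_yzx m (F : m.+1.-tuple (plane R) -> \bar R) :
  measurable_fun setT F -> (forall t, (0 <= F t)%E) ->
  (\int[@lebesgue_cvec R m.+1]_t F t =
   \int[leb]_y \int[@lebesgue_cvec R m]_z \int[leb]_x F (tcons (z, x, y)))%E.
Proof.
move=> mF F0; rewrite integral_lebesgue_cvecS//.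
have mFt : measurable_fun setT (fun x => F (@tcons R m x)).
  exact: (measurableT_comp mF (@measurable_tcons R m)).
rewrite -[LHS]/(\int[sfprod (sfprod (@lebesgue_cvec R m) leb) leb]_x F (tcons x))%E.
rewrite (fubini_tonelli2 (fun x => F (tcons x)))//.
apply: eq_integral => y _; rewrite /fubini_G.
rewrite -[LHS]/(\int[sfprod (@lebesgue_cvec R m) leb]_x F (tcons (x, y)))%E.
rewrite (fubini_tonelli1 (fun x => F (tcons (x, y))))//.
exact: (measurableT_comp mFt (measurable_pair2 y)).
Qed.

Lemma line_integral_bound (b a : R) : -1 < b -> b + 1 < a ->
  exists2 K : R, 0 <= K & forall s e : R, 0 < e ->
  (\int[leb]_x (`|s - x| `^ b * (e + `|s - x|) `^ (- a))%:E <=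
   (K * e `^ (b + 1 - a))%:E)%E.
Proof.
move=> b1 ba; have [K K0 HK] := layer_bound b1 ba.
exists (K * 2) => [|s e e0]; first by rewrite mulr_ge0.
have mg : measurable_fun setT (fun x : measurableTypeR R => `|s - x|).
  by apply: (measurableT_comp (@normr_measurable R setT)); exact: measurable_funB.
have Hle (t : R) : 0 < t ->
    (\int[leb]_(x in setT `&` [set x | (`|s - x| <= t)%R]) 1%:E <= (2 * t)%:E)%E.
  move=> t0; rewrite integral_cst/=; last first.
    exact: (measurable_fun_le measurableT mg (measurable_cst t)).
  rewrite mul1e setTI (_ : [set x | _] = `[s - t, s + t]%classic); last first.
    by apply/seteqP; split => x /=; rewrite in_itv /= ler_distlC.
  rewrite lebesgue_measure_itv /= lte_fin; case: ifPn => _; last by rewrite lee_fin; lra.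
  by rewrite -EFinD lee_fin; lra.
have := HK _ _ leb setT (fun=> 1) (fun x => `|s - x|) 2 e measurableT
  (measurable_cst _) (fun _ _ => ler01) mg (fun _ _ => normr_ge0 _) (ler0n R 2) e0 Hle.
by under eq_integral do rewrite mul1r.
Qed.

(** [layer_bound] for [g = x^2 + y^2], whose sublevel sets lie in squares of area
    [4 t]. *)
Lemma plane_integral_bound (c : R) : 1 < c ->
  exists2 K : R, 0 <= K & forall e : R, 0 < e ->
  (\int[leb]_x \int[leb]_y ((e + (x ^+ 2 + y ^+ 2)) `^ (- c))%:E <=
   (K * e `^ (1 - c))%:E)%E.
Proof.
move=> c1; have [K K0 HK] := @layer_bound R c 0 ltac:(lra) ltac:(lra).
exists (K * 4) => [|e e0]; first by rewrite mulr_ge0.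
pose g (x : measurableTypeR R * measurableTypeR R) : R := x.1 ^+ 2 + x.2 ^+ 2.
have mg : measurable_fun setT g.
  by apply: measurable_funD; apply: measurable_funX.
have g0 x : 0 <= g x by rewrite addr_ge0// sqr_ge0.
have Hle (t : R) : 0 < t ->
    (\int[sfprod leb leb]_(x in setT `&` [set x | (g x <= t)%R]) 1%:E <= (4 * t)%:E)%E.
  move=> t0; rewrite integral_cst/=; last first.
    exact: (measurable_fun_le measurableT mg (measurable_cst t)).
  rewrite mul1e setTI.
  pose I := `[- Num.sqrt t, Num.sqrt t]%classic : set (measurableTypeR R).
  have st0 : 0 < Num.sqrt t by rewrite sqrtr_gt0.
  have t2 : Num.sqrt t ^+ 2 = t by rewrite sqr_sqrtr// ltW.
  apply: (@le_trans _ _ (sfprod leb leb (I `*` I))).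
    apply: le_measure; rewrite ?inE.
    - rewrite -[X in measurable X]setTI.
      exact: (measurable_fun_le measurableT mg (measurable_cst t)).
    - by apply: measurableX; exact: measurable_itv.
    - have sub (u v : R) : u ^+ 2 + v ^+ 2 <= t -> I u.
        move=> h; rewrite /I /= in_itv /= -ler_norml.
        rewrite -(@ler_pXn2r _ 2) ?nnegrE ?(ltW st0)// t2 real_normK ?num_real//.
        by have := sqr_ge0 v; lra.
      move=> -[u v] /= h; split => /=; first exact: sub h.
      by apply: (sub v u); rewrite addrC.
  have lI : leb I = (2 * Num.sqrt t)%:E.
    rewrite lebesgue_measure_itv /= lte_fin ifT; last by lra.
    by rewrite -EFinD; congr EFin; ring.
  have mI : measurable I by exact: measurable_itv.
  rewrite [leLHS](_ : _ = leb I * leb I)%E; last exact: product_measure1E.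
  rewrite lI -EFinM lee_fin.
  rewrite [leLHS](_ : _ = 4 * Num.sqrt t ^+ 2); last by ring.
  by rewrite t2.
have := HK _ _ (sfprod leb leb) setT (fun=> 1) g 4 e measurableT
  (measurable_cst _) (fun _ _ => ler01) mg (fun x _ => g0 x) (ler0n R 4) e0 Hle.
under eq_integral do rewrite mul1r powRr0 mul1r.
rewrite add0r (fubini_tonelli1 (fun x => ((e + g x) `^ (- c))%:E))//.
  apply/measurable_EFinP/(measurableT_comp (measurable_powR _)).
  exact: measurable_funD.
by move=> x; rewrite lee_fin powR_ge0.
Qed.

(** The majorant of the kernel in the coordinates orthogonal to [a]. *)
Definition polyweight m (c e : R) (z : m.-tuple (plane R)) : R :=
  \prod_(j < m) (e + (((tnth z j).1 : R) ^+ 2 + ((tnth z j).2 : R) ^+ 2)) `^ (- c).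

Lemma polyweight_ge0 m c e z : 0 <= @polyweight m c e z.
Proof. by apply: prodr_ge0 => j _; exact: powR_ge0. Qed.

Lemma measurable_polyweight m c e : measurable_fun setT (@polyweight m c e).
Proof.
apply: measurable_prod => j _; apply: (measurableT_comp (measurable_powR _)).
have mt := @measurable_tnth _ (plane R) m j.
apply: measurable_funD => //; apply: measurable_funD; apply: measurable_funX.
  exact: (measurableT_comp measurable_fst mt).
exact: (measurableT_comp measurable_snd mt).
Qed.

Lemma integral_polyweight_le (c : R) : 1 < c ->
  exists2 K : R, 0 <= K & forall m (e : R), 0 < e ->
  (\int[@lebesgue_cvec R m]_z (polyweight c e z)%:E <= ((K * e `^ (1 - c)) ^+ m)%:E)%E.
Proof.
move=> c1; have [K K0 HK] := plane_integral_bound c1.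
exists K => // m e e0; elim: m => [|m IH].
  rewrite expr0 integral_dirac//=; last by apply/measurable_EFinP; exact: measurable_polyweight.
  by rewrite diracT mul1e /polyweight big_ord0.
have mW k : measurable_fun setT (fun z => (@polyweight k c e z)%:E).
  by apply/measurable_EFinP; exact: measurable_polyweight.
rewrite integral_tcons_zxy//; last by move=> t; rewrite lee_fin polyweight_ge0.
have WE (z : m.-tuple (plane R)) x y : polyweight c e (tcons (z, x, y)) =
    polyweight c e z * (e + (x ^+ 2 + y ^+ 2)) `^ (- c).
  rewrite /polyweight big_ord_recl mulrC; congr (_ * _).
  by apply: eq_bigr => j _; rewrite /tcons !tnthS.
set p := fun x y : R => ((e + (x ^+ 2 + y ^+ 2)) `^ (- c))%:E.
have mp : measurable_fun setT (fun x : measurableTypeR R * measurableTypeR R => p x.1 x.2).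
  apply/measurable_EFinP/(measurableT_comp (measurable_powR _)).
  by apply: measurable_funD => //; apply: measurable_funD; apply: measurable_funX.
have p0 x y : (0 <= p x y)%E by rewrite lee_fin powR_ge0.
have Q0 x : (0 <= \int[leb]_y p x y)%E by exact: integral_ge0.
rewrite (_ : \int[_]_z _ = \int[@lebesgue_cvec R m]_z
    ((polyweight c e z)%:E * \int[leb]_x \int[leb]_y p x y))%E; last first.
  apply: eq_integral => z _.
  rewrite -ge0_integralZl_EFin ?polyweight_ge0//; last first.
    exact: (@measurable_fun_fubini_tonelli_F _ _ _ _ _ leb _ mp (fun x => p0 x.1 x.2)).
  apply: eq_integral => x _.
  rewrite -ge0_integralZl_EFin ?polyweight_ge0//; last first.
    exact: (measurableT_comp mp (measurable_pair1 x)).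
  by apply: eq_integral => y _; rewrite WE.
have Q1 : (0 <= \int[leb]_x \int[leb]_y p x y)%E by exact: integral_ge0.
have W0 : (0 <= \int[@lebesgue_cvec R m]_z (polyweight c e z)%:E)%E.
  by apply: integral_ge0 => z _; rewrite lee_fin polyweight_ge0.
rewrite ge0_integralZr//; [|exact: mW|by move=> z _; rewrite lee_fin polyweight_ge0].
rewrite exprSr EFinM; apply: lee_pmul => //.
exact: HK.
Qed.

End iterated_integrals.

Section forelli_rudin.
Context {R : realType} {m : nat}.

Lemma powRN_le (e x D : R) : 0 <= e -> 0 < x -> x <= 3 * D ->
  D `^ (- e) <= 3 `^ e * x `^ (- e).
Proof.
move=> e0 x0 xD; have D0 : 0 < D by lra.
rewrite !powRN ler_pdivlMr ?powR_gt0// mulrC ler_pdivrMr ?powR_gt0//.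
rewrite -powRM ?(ltW D0)//; apply: ge0_ler_powR; rewrite ?nnegrE//; lra.
Qed.

Lemma powR_slice_le (b x : R) : 1 <= x <= 2 -> x `^ b <= 2 `^ `|b|.
Proof.
move=> /andP[x1 x2]; have [b0|b0] := leP 0 b.
  by rewrite ger0_norm//; apply: ge0_ler_powR; rewrite ?nnegrE//; lra.
apply: (@le_trans _ _ 1).
  by rewrite -[leRHS](powRr0 x) ler_powR// ltW.
by rewrite -[leLHS](powRr0 2) ler_powR// ler1n.
Qed.

(** For [a] on the first axis at distance r from 0, write x + i y for the first
    coordinate of z and [w j] for the squared moduli of the others; D is
    [|1 - <z,a>|].  Where D >= 1/4 the kernel is at most a power of [1-|z|^2].
    Elsewhere x > 3/4, and [1-|z|^2 = s^2 - x^2] is comparable to [u = s - x], where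
    s is the largest value of x on the slice.  Moreover [3 D] dominates each of
    [e + u], [e + |y|] and [e + w j], so the negative power of D can be shared
    out among them; the exponent [c > 1] is chosen so that the parts add up to
    [2 tau].  The result is a product of functions of one
    real or complex variable each. *)
Lemma kernel_bound (tau r x y D : R) (w : 'I_m -> R) :
  let b := tau - m.+2%:R in
  let c := 1 + tau / m.+2%:R in
  let e := 1 - r in
  let N := x ^+ 2 + y ^+ 2 + \sum_(j < m) w j in
  let u := `|Num.sqrt (1 - (y ^+ 2 + \sum_(j < m) w j)) - x| in
  m.+1%:R < tau -> 0 <= r < 1 -> (forall j, 0 <= w j) -> N < 1 -> 0 <= D ->
  D ^+ 2 = (1 - r * x) ^+ 2 + (r * y) ^+ 2 ->
  ((1 - r ^+ 2) * (1 - N) / D ^+ 2) `^ tau / (1 - N) ^+ m.+2 <=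
    16 `^ tau * (1 - N) `^ b +
    2 `^ tau * 2 `^ `|b| * 3 `^ (2 * tau) *
    (e `^ tau * (u `^ b * (e + u) `^ (- (b + c)) * (e + `|y|) `^ (- c) *
     \prod_(j < m) (e + w j) `^ (- c))).
Proof.
move=> b c e N u tau1 /andP[r0 r1] w0 N1 D0 D2.
have tau0 : 0 < tau by apply: lt_trans tau1.
have W0 : 0 <= \sum_(j < m) w j by apply: sumr_ge0.
have e0 : 0 < e by rewrite subr_gt0.
have N0 : 0 <= N by rewrite addr_ge0// addr_ge0// sqr_ge0.
have x1 : x ^+ 2 < 1.
  by move: N1; rewrite /N; have := sqr_ge0 y; lra.
have x11 : -1 < x < 1 by rewrite -ltr_norml -(@ltr_pXn2r _ 2) ?nnegrE// real_normK ?num_real// expr1n.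
have rx : e <= 1 - r * x.
  by rewrite /e lerB// -[leRHS]mulr1 ler_wpM2l//; lra.
have Dx : 1 - r * x <= D.
  rewrite -(@ler_pXn2r _ 2) ?nnegrE//; last by lra.
  by rewrite D2 lerDl sqr_ge0.
have Dgt0 : 0 < D by lra.
have P1 : (1 - N) `^ tau / (1 - N) ^+ m.+2 = (1 - N) `^ b.
  rewrite -powR_mulrn ?subr_ge0 ?(ltW N1)// -powRB//.
  by rewrite subr_eq0 (gt_eqF N1) implybT.
have r2 : 0 <= 1 - r ^+ 2 by rewrite subr_ge0 exprn_ile1// ltW.
have DV0 : 0 <= (D ^+ 2)^-1 by rewrite invr_ge0 sqr_ge0.
have -> : ((1 - r ^+ 2) * (1 - N) / D ^+ 2) `^ tau / (1 - N) ^+ m.+2 =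
    (1 - N) `^ b * ((1 - r ^+ 2) `^ tau * (D ^+ 2)^-1 `^ tau).
  rewrite powRM ?mulr_ge0 ?subr_ge0 ?(ltW N1)//; last by rewrite -subr_ge0.
  rewrite powRM ?subr_ge0 ?(ltW N1)//; last by rewrite -subr_ge0.
  by rewrite -P1; ring.
have [D4|D4] := leP 4^-1 D.
  rewrite ler_wpDr//; first by rewrite !mulr_ge0 ?powR_ge0// prodr_ge0// => j _; exact: powR_ge0.
  rewrite mulrC ler_wpM2r ?powR_ge0//.
  rewrite -powRM//; apply: ge0_ler_powR; rewrite ?nnegrE ?mulr_ge0//; first exact: ltW.
  rewrite ler_pdivrMr ?exprn_gt0//.
  have : 1 <= 16 * D ^+ 2.
    have : 0 <= (D - 4^-1) * (D + 4^-1) by rewrite mulr_ge0//; lra.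
    by rewrite (_ : _ * _ = D ^+ 2 - 16^-1); [lra|field].
  by have := sqr_ge0 r; lra.
rewrite ler_wpDl//; first by rewrite mulr_ge0 ?powR_ge0.
have x34 : 3 / 4 < x.
  have [//|xle] := ltP (3 / 4) x.
  have : r * x <= 3 / 4.
    have [xn|xp] := leP x 0; first by rewrite (@le_trans _ _ 0)// mulr_ge0_le0.
    by rewrite (@le_trans _ _ x)// ler_piMl ?ltW.
  by lra.
have rx1 : r * x <= r by rewrite ler_piMr//; lra.
set s2 := 1 - (y ^+ 2 + \sum_(j < m) w j).
have s2x : x ^+ 2 < s2 by move: N1; rewrite /N /s2; lra.
have s20 : 0 <= s2 by have := sqr_ge0 x; lra.
have s21 : s2 <= 1 by have := sqr_ge0 y; rewrite /s2; lra.
set s := Num.sqrt s2 in u *.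
have s0 : 0 <= s by exact: sqrtr_ge0.
have ss : s ^+ 2 = s2 by rewrite sqr_sqrtr.
have sx : x < s by rewrite -(@ltr_pXn2r _ 2) ?nnegrE ?ss//; lra.
have s1 : s <= 1 by rewrite -(@ler_pXn2r _ 2) ?nnegrE// ss expr1n.
have uE : u = s - x by rewrite /u ger0_norm// subr_ge0 ltW.
have xrx : 1 - x <= 1 - r * x by rewrite lerB// ler_piMl//; lra.
have B1 : e + u <= 3 * D by rewrite uE; lra.
have B2 : e + `|y| <= 3 * D.
  have : r * `|y| <= D.
    rewrite -(@ler_pXn2r _ 2) ?nnegrE ?mulr_ge0// exprMn real_normK ?num_real//.
    by rewrite -exprMn D2 lerDr sqr_ge0.
  have : 3 / 4 * `|y| <= r * `|y| by rewrite ler_wpM2r//; lra.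
  by lra.
have B3 j : e + w j <= 3 * D.
  have wj : w j <= \sum_(j < m) w j.
    by rewrite (bigD1 j)//= lerDl sumr_ge0.
  have : w j <= 1 - x ^+ 2 by move: N1; rewrite /N; have := sqr_ge0 y; lra.
  have : 1 - x ^+ 2 <= 2 * (1 - x).
    rewrite -subr_ge0 (_ : _ - _ = (1 - x) ^+ 2); last by ring.
    exact: sqr_ge0.
  by lra.
have c0 : 0 < c by rewrite ltr_wpDr// divr_ge0// ltW.
have m2 : (0 : R) < m.+2%:R by [].
(* The exponents given to the m + 2 factors exhaust the power of D. *)
have bc : b + c + c + m%:R * c = 2 * tau.
  rewrite /b /c -!natr1; field; rewrite natr1 natr1; exact: lt0r_neq0.
have bc0 : 0 < b + c.
  have : 0 < tau / m.+2%:R by rewrite divr_gt0.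
  by move: tau1; rewrite /b /c -(natr1 m.+1); lra.
have DE : (D ^+ 2)^-1 `^ tau = D `^ (- (b + c)) * D `^ (- c) * \prod_(j < m) D `^ (- c).
  have -> : (D ^+ 2)^-1 `^ tau = D `^ (- (2 * tau)).
    by rewrite -powR_invn// -powRrM; congr (_ `^ _); ring.
  have -> : \prod_(j < m) D `^ (- c) = D `^ (- (m%:R * c)).
    rewrite prodr_const card_ord -powR_mulrn ?powR_ge0// -powRrM.
    by congr (_ `^ _); ring.
  rewrite -!powRD ?(lt0r_neq0 Dgt0) ?implybT//; congr (_ `^ _).
  by rewrite -bc; ring.
have H1 : (1 - N) `^ b <= u `^ b * 2 `^ `|b|.
  rewrite (_ : 1 - N = u * (s + x)); last first.
    by rewrite uE -subr_sqr ss /N /s2; ring.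
  rewrite powRM; [|by rewrite uE; lra|by lra].
  by rewrite ler_wpM2l ?powR_ge0// powR_slice_le//; lra.
have H2 : (1 - r ^+ 2) `^ tau <= 2 `^ tau * e `^ tau.
  rewrite -powRM ?(ltW e0)//; apply: ge0_ler_powR; rewrite ?nnegrE ?mulr_ge0 ?(ltW e0) ?(ltW tau0)//.
  rewrite (_ : 1 - r ^+ 2 = (1 + r) * e); last by rewrite /e; ring.
  by rewrite ler_wpM2r ?(ltW e0)//; lra.
have eu : 0 < e + u by rewrite uE; lra.
have ey : 0 < e + `|y| by have := normr_ge0 y; lra.
have ew j : 0 < e + w j by have := w0 j; lra.
have H3 := powRN_le (ltW bc0) eu B1.
have H4 := powRN_le (ltW c0) ey B2.
have H5 : \prod_(j < m) D `^ (- c) <= 3 `^ (m%:R * c) * \prod_(j < m) (e + w j) `^ (- c).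
  have -> : 3 `^ (m%:R * c) = \prod_(j < m) 3 `^ c :> R.
    by rewrite prodr_const card_ord mulrC powRrM powR_mulrn ?powR_ge0.
  rewrite -big_split /=; apply: ler_prod => j _; rewrite powR_ge0 /=.
  exact: powRN_le (ltW c0) (ew j) (B3 j).
have T3 : 3 `^ (2 * tau) = 3 `^ (b + c) * 3 `^ c * 3 `^ (m%:R * c).
  by rewrite -!powRD ?pnatr_eq0 ?implybT// bc.
have P0 : 0 <= \prod_(j < m) (e + w j) `^ (- c).
  by apply: prodr_ge0 => j _; exact: powR_ge0.
rewrite DE T3.
apply: (@le_trans _ _ ((u `^ b * 2 `^ `|b|) * ((2 `^ tau * e `^ tau) *
  ((3 `^ (b + c) * (e + u) `^ (- (b + c))) * (3 `^ c * (e + `|y|) `^ (- c)) *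
   (3 `^ (m%:R * c) * \prod_(j < m) (e + w j) `^ (- c))))));
  last by rewrite le_eqVlt; apply/orP; left; apply/eqP; ring.
have Pc : 0 <= \prod_(j < m) D `^ (- c) by apply: prodr_ge0 => j _; exact: powR_ge0.
by do !apply: ler_pM; rewrite ?mulr_ge0 ?powR_ge0.
Qed.

End forelli_rudin.

Section invariant_integral.
Context {R : realType} {m : nat}.
Local Notation leb := (@lebesgue_measure R).
Local Notation T := (m.+1.-tuple (plane R)).

Definition mod2 k (z : k.-tuple (plane R)) (j : 'I_k) : R :=
  ((tnth z j).1 : R) ^+ 2 + ((tnth z j).2 : R) ^+ 2.

(** The supremum of the first real coordinate over the points of the ball whose
    other coordinates are prescribed. *)
Definition slice_radius (z : m.-tuple (plane R)) (y : R) : R :=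
  Num.sqrt (1 - (y ^+ 2 + \sum_(j < m) mod2 z j)).

(** The local part of the bound in [kernel_bound], as a function of a point. *)
Definition majorant (b c e : R) (t : T) : R :=
  let: (z, x, y) := tuncons t in
  let u := `|slice_radius z y - x| in
  u `^ b * (e + u) `^ (- (b + c)) * (e + `|y|) `^ (- c) * polyweight c e z.

Lemma majorant_ge0 b c e t : 0 <= majorant b c e t.
Proof.
rewrite /majorant; case: (tuncons t) => -[z x] y.
by rewrite !mulr_ge0 ?powR_ge0 ?polyweight_ge0.
Qed.

Lemma measurable_mod2 k (j : 'I_k) : measurable_fun setT (fun z => mod2 z j).
Proof.
have mt := @measurable_tnth _ (plane R) k j.
apply: measurable_funD; apply: measurable_funX.
  exact: (measurableT_comp measurable_fst mt).
exact: (measurableT_comp measurable_snd mt).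
Qed.

Lemma measurable_majorant b c e : measurable_fun setT (majorant b c e).
Proof.
pose P := (m.-tuple (plane R) * measurableTypeR R * measurableTypeR R)%type.
have mz : measurable_fun setT (fun p : P => p.1.1) by exact: measurableT_comp.
have mx : measurable_fun setT (fun p : P => p.1.2) by exact: measurableT_comp.
have my : measurable_fun setT (fun p : P => p.2) by exact: measurable_snd.
have ms : measurable_fun setT (fun p : P => slice_radius p.1.1 p.2).
  apply: (@measurableT_comp _ _ _ _ _ _ (@Num.sqrt R)).
    exact: continuous_measurable_fun (@sqrt_continuous R).
  apply: measurable_funB => //; apply: measurable_funD; first exact: measurable_funX.
  by apply: measurable_sum => j; exact: (measurableT_comp (measurable_mod2 j) mz).
have mu : measurable_fun setT (fun p : P => `|slice_radius p.1.1 p.2 - p.1.2|).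
  by apply: (measurableT_comp (@normr_measurable R setT)); exact: measurable_funB.
pose E3 (p : P) := let u := `|slice_radius p.1.1 p.2 - p.1.2| in
  u `^ b * (e + u) `^ (- (b + c)) * (e + `|p.2|) `^ (- c) * polyweight c e p.1.1.
have -> : majorant b c e = E3 \o (@tuncons R m).
  by apply/funext => t; rewrite /majorant /E3 /=.
apply: measurableT_comp; last exact: measurable_tuncons.
have mW := measurableT_comp (@measurable_polyweight R m c e) mz.
have mn : measurable_fun setT (fun p : P => `|p.2|).
  exact: (measurableT_comp (@normr_measurable R setT)).
apply: measurable_funM => //; apply: measurable_funM; first apply: measurable_funM.
- exact: (measurableT_comp (measurable_powR _)).
- by apply: (measurableT_comp (measurable_powR _)); exact: measurable_funD.
- by apply: (measurableT_comp (measurable_powR _)); exact: measurable_funD.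
Qed.

(** Integrating in the first real coordinate first makes the dependence of the
    slice radius on the other coordinates disappear, by translation; the
    integral then factors, and each of the [m + 2] factors contributes a power
    [e^(1-c)]. *)
Lemma integral_majorant_le (b c : R) : -1 < b -> 1 < c ->
  exists2 K : R, 0 <= K & forall e : R, 0 < e ->
  (\int[@lebesgue_cvec R m.+1]_t (majorant b c e t)%:E <=
   (K * (e `^ (1 - c)) ^+ m.+2)%:E)%E.
Proof.
move=> b1 c1.
have [K1 K10 HK1] := @line_integral_bound R b (b + c) b1 ltac:(lra).
have [K2 K20 HK2] := @line_integral_bound R 0 c ltac:(lra) ltac:(lra).
have [K3 K30 HK3] := integral_polyweight_le c1.
exists (K2 * K1 * K3 ^+ m) => [|e e0].
  by rewrite mulr_ge0 ?mulr_ge0 ?exprn_ge0.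
have mM : measurable_fun setT (fun t => (majorant b c e t)%:E).
  by apply/measurable_EFinP; exact: measurable_majorant.
rewrite integral_tcons_yzx//; last by move=> t; rewrite lee_fin majorant_ge0.
pose psi (x : R) := (`|x| `^ b * (e + `|x|) `^ (- (b + c)))%:E.
have psi0 x : (0 <= psi x)%E by rewrite lee_fin mulr_ge0 ?powR_ge0.
have mpsi : measurable_fun setT (psi : measurableTypeR R -> \bar R).
  have mn : measurable_fun setT (fun x : measurableTypeR R => `|x|).
    exact: (@normr_measurable R setT).
  apply/measurable_EFinP; apply: measurable_funM.
    exact: (measurableT_comp (measurable_powR _)).
  by apply: (measurableT_comp (measurable_powR _)); exact: measurable_funD.
have Lle : (\int[leb]_x psi x <= (K1 * e `^ (1 - c))%:E)%E.
  have := HK1 0 e e0; rewrite (_ : b + 1 - (b + c) = 1 - c); last by ring.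
  by under eq_integral do rewrite sub0r normrN.
have L0 : (0 <= \int[leb]_x psi x)%E by exact: integral_ge0.
have innerE z y : (\int[leb]_x (majorant b c e (tcons (z, x, y)))%:E =
    ((e + `|y|) `^ (- c) * polyweight c e z)%:E * \int[leb]_x psi x)%E.
  have N1 : (-1 : R) != 0 by rewrite oppr_eq0 oner_eq0.
  (* The reflection [x |-> slice_radius z y - x] removes the dependence on z and y. *)
  have [mr _ /(_ psi mpsi psi0)] := rescales_lebesgue (slice_radius z y) N1.
  rewrite normrN1 mul1e => <-.
  rewrite -ge0_integralZl_EFin//.
  - apply: eq_integral => x _; rewrite -EFinM; congr EFin.
    by rewrite /majorant tconsK mulN1r (addrC (- x)); ring.
  - exact: (measurableT_comp mpsi mr).
  - by rewrite mulr_ge0 ?powR_ge0 ?polyweight_ge0.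
have mW : measurable_fun setT (fun z : m.-tuple (plane R) => (polyweight c e z)%:E).
  by apply/measurable_EFinP; exact: measurable_polyweight.
have W0 : (0 <= \int[@lebesgue_cvec R m]_z (polyweight c e z)%:E)%E.
  by apply: integral_ge0 => z _; rewrite lee_fin polyweight_ge0.
have midE y : (\int[@lebesgue_cvec R m]_z \int[leb]_x (majorant b c e (tcons (z, x, y)))%:E =
  ((e + `|y|) `^ (- c))%:E * ((\int[@lebesgue_cvec R m]_z (polyweight c e z)%:E) *
    \int[leb]_x psi x))%E.
  under eq_integral => z _ do rewrite innerE EFinM -muleA.
  rewrite ge0_integralZl_EFin ?powR_ge0//.
  - rewrite ge0_integralZr//.
    by move=> z _; rewrite lee_fin polyweight_ge0.
  - by move=> z _; rewrite mule_ge0// lee_fin polyweight_ge0.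
  - exact: emeasurable_funM.
under eq_integral => y _ do rewrite midE.
have my : measurable_fun setT (fun y : measurableTypeR R => ((e + `|y|) `^ (- c))%:E).
  apply/measurable_EFinP/(measurableT_comp (measurable_powR _)).
  by apply: measurable_funD => //; exact: (@normr_measurable R setT).
rewrite ge0_integralZr//; last 2 first.
- by move=> y _; rewrite lee_fin powR_ge0.
- by rewrite mule_ge0.
have Yle : (\int[leb]_y ((e + `|y|) `^ (- c))%:E <= (K2 * e `^ (1 - c))%:E)%E.
  have := HK2 0 e e0; rewrite add0r.
  by under eq_integral do rewrite sub0r normrN powRr0 mul1r.
rewrite (_ : K2 * K1 * K3 ^+ m * _ =
  (K2 * e `^ (1 - c)) * ((K3 * e `^ (1 - c)) ^+ m * (K1 * e `^ (1 - c)))); last first.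
  by rewrite exprMn !exprS; ring.
rewrite EFinM [(_ ^+ m * _)%:E]EFinM.
apply: lee_pmul => //.
- by apply: integral_ge0 => y _; rewrite lee_fin powR_ge0.
- by rewrite mule_ge0.
- by apply: lee_pmul => //; exact: HK3.
Qed.

End invariant_integral.

Section phi_integral.
Context {R : realType} {m : nat}.
Local Notation leb := (@lebesgue_cvec R m.+1).
Local Notation T := (m.+1.-tuple (plane R)).
Local Notation ball := (cvec @^-1` uball : set T).
Local Notation "x %:C" := (real_complex _ x).

(** The integrand of [Phi_integral_bounded] for a point at distance [r] from 0
    on the first axis, rewritten by [one_sub_sqr_hnorm_Phi]. *)
Definition axis_kernel (tau r : R) (t : T) : R :=
  ((1 - r ^+ 2) * (1 - hnorm (cvec t) ^+ 2) /
   Normc.normc (1 - cvec t 0 0 * r%:C) ^+ 2) `^ tau / (1 - hnorm (cvec t) ^+ 2) ^+ m.+2.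

Lemma measurable_funV d (S : measurableType d) (f : S -> R) :
  measurable_fun setT f -> measurable_fun setT (fun x => (f x)^-1).
Proof.
move=> mf; rewrite (_ : (fun _ => _) = fun x => f x * (f x ^+ 2) `^ (-1)).
  apply: measurable_funM => //; apply: (measurableT_comp (measurable_powR _)).
  exact: measurable_funX.
apply/funext => x; rewrite powR_inv1 ?sqr_ge0//.
have [->|f0] := eqVneq (f x) 0; first by rewrite invr0 mul0r.
by field.
Qed.

Lemma measurable_sqr_hnorm n : measurable_fun setT (fun t : n.-tuple (plane R) => hnorm (cvec t) ^+ 2).
Proof. by apply: measurable_funX; exact: measurable_hnorm_cvec. Qed.

Lemma measurable_axis_kernel tau r : measurable_fun setT (axis_kernel tau r).
Proof.
have m1 : measurable_fun setT (fun t : T => 1 - hnorm (cvec t) ^+ 2).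
  by apply: measurable_funB => //; exact: measurable_sqr_hnorm.
apply: measurable_funM; last by apply: measurable_funV; exact: measurable_funX.
apply: (measurableT_comp (measurable_powR _)).
apply: measurable_funM; first exact: measurable_funM.
apply: measurable_funV; apply: measurable_funX; apply: measurable_normc.
under eq_fun do rewrite -mulrN.
apply: cmeasurableD; first exact: cmeasurable_cst.
by apply: cmeasurableM; [exact: cmeasurable_cvec|exact: cmeasurable_cst].
Qed.

Lemma axis_kernel_majorant (tau : R) : m.+1%:R < tau ->
  exists2 K : R, 0 <= K & forall (r : R) t, 0 <= r < 1 -> ball t ->
  axis_kernel tau r t <= 16 `^ tau * (1 - hnorm (cvec t) ^+ 2) `^ (tau - m.+2%:R) +
   K * ((1 - r) `^ tau *
     majorant (tau - m.+2%:R) (1 + tau / m.+2%:R) (1 - r) t).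
Proof.
move=> tau1.
exists (2 `^ tau * 2 `^ `|tau - m.+2%:R| * 3 `^ (2 * tau)).
  by rewrite !mulr_ge0 ?powR_ge0.
move=> r t r01 Bt.
have tE : hnorm (cvec t) ^+ 2 = \sum_(j < m.+1) mod2 t j.
  rewrite sqr_hnorm; apply: eq_bigr => j _; rewrite mxE /mod2 /= sqr_sqrtr//.
  by rewrite addr_ge0// sqr_ge0.
rewrite /majorant; case E : (tuncons t) => [[z x] y].
have Ex : (tnth t ord0).1 = x by case: E => _ <- _.
have Ey : (tnth t ord0).2 = y by case: E => _ _ <-.
have Ez j : tnth t (lift ord0 j) = tnth z j.
  case: E => <- _ _; rewrite tnth_behead; congr tnth; apply/val_inj.
  by rewrite /= inordK//= ltnS.
have N : hnorm (cvec t) ^+ 2 = x ^+ 2 + y ^+ 2 + \sum_(j < m) mod2 z j.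
  rewrite tE big_ord_recl /mod2 Ex Ey; congr (_ + _).
  by apply: eq_bigr => j _; rewrite Ez.
have N1 : x ^+ 2 + y ^+ 2 + \sum_(j < m) mod2 z j < 1.
  by rewrite -N exprn_ilt1 ?hnorm_ge0.
pose D := Normc.normc (1 - cvec t 0 0 * r%:C).
have D2 : D ^+ 2 = (1 - r * x) ^+ 2 + (r * y) ^+ 2.
  rewrite /D mxE -/(ord0 : 'I_m.+1) /= sqr_sqrtr ?addr_ge0 ?sqr_ge0//.
  by rewrite Ex Ey; ring.
have := @kernel_bound R m tau r x y D (mod2 z) tau1 r01
  (fun j => addr_ge0 (sqr_ge0 _) (sqr_ge0 _)) N1 (normc_ge0 _) D2.
by rewrite /axis_kernel N.
Qed.

(** The local part contributes [e^tau] times [(e^(1-c))^(m+2)], and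
    [tau = (m+2)(c-1)]: the powers of [e] cancel, so the bound does not depend
    on r. *)
Lemma axis_kernel_integral (tau : R) : m.+1%:R < tau ->
  exists K : R, forall r : R, 0 <= r < 1 ->
  (\int[@ball_volume R m.+1]_(t in ball) (axis_kernel tau r t)%:E <= K%:E)%E.
Proof.
move=> tau1.
have b1 : -1 < tau - m.+2%:R by rewrite -(natr1 m.+1); lra.
have tau0 : 0 < tau by apply: lt_trans tau1.
have m2 : (0 : R) < m.+2%:R by [].
set b := tau - m.+2%:R in b1.
have c1 : 1 < 1 + tau / m.+2%:R by rewrite ltrDl divr_gt0.
have [K1 K10 HK1] := axis_kernel_majorant tau1.
have [K2 K20 HK2] := @ball_weight R m.+1 b isT b1.
have [K3 K30 HK3] := @integral_majorant_le R m b _ b1 c1.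
set c := 1 + tau / m.+2%:R in c1 HK3 HK1.
exists (16 `^ tau * K2 + (vol_const (R := R) (n := m.+1)) * (K1 * K3)) => r r01.
have e0 : 0 < 1 - r by lra.
have mB := @measurable_uball R m.+1.
have [V [V0 V1 VE]] : exists V : R, [/\ 0 <= V, V <= 1 &
    (\int[@ball_volume R m.+1]_(t in ball) 1%:E = V%:E)%E].
  have fin : @ball_volume R m.+1 ball \is a fin_num.
    by rewrite ge0_fin_numE//; exact: (le_lt_trans (ball_volume_le1 mB) (ltry 1)).
  exists (fine (@ball_volume R m.+1 ball)); split; first exact: fine_ge0.
    by rewrite -lee_fin fineK//; exact: ball_volume_le1.
  by rewrite integral_cst// mul1e fineK.
have {HK2} := HK2 (fun=> 1) V (fun _ _ _ => erefl) (measurable_cst _) (fun _ => ler01) VE.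
under eq_integral do rewrite mul1r.
move=> HK2.
pose F1 (t : T) := 16 `^ tau * (1 - hnorm (cvec t) ^+ 2) `^ b.
pose F2 (t : T) := K1 * ((1 - r) `^ tau * majorant b c (1 - r) t).
have mF2 : measurable_fun setT F2.
  by apply: measurable_funM => //; apply: measurable_funM => //; exact: measurable_majorant.
have mw : measurable_fun ball (fun t : T => (1 - hnorm (cvec t) ^+ 2) `^ b).
  apply: measurable_funTS; apply: (measurableT_comp (measurable_powR _)).
  by apply: measurable_funB => //; exact: measurable_sqr_hnorm.
have mF1 : measurable_fun ball F1 by apply: measurable_funM.
have F10 t : 0 <= F1 t by rewrite /F1 mulr_ge0 ?powR_ge0.
have F20 t : 0 <= F2 t.
  by apply: mulr_ge0 => //; apply: mulr_ge0; [exact: powR_ge0|exact: majorant_ge0].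
apply: (@le_trans _ _ (\int[@ball_volume R m.+1]_(t in ball) (F1 t + F2 t)%:E)%E).
  apply: ge0_le_integral => //.
  - move=> t Bt; rewrite lee_fin divr_ge0 ?powR_ge0// exprn_ge0// subr_ge0.
    by rewrite exprn_ile1 ?hnorm_ge0// ltW.
  - by apply/measurable_EFinP; apply: measurable_funTS; exact: measurable_axis_kernel.
  - by apply/measurable_EFinP; apply: measurable_funD => //; exact: measurable_funTS.
  - by move=> t Bt; rewrite lee_fin; exact: HK1.
under eq_integral do rewrite EFinD.
rewrite ge0_integralD//; last 4 first.
- by move=> t _; rewrite lee_fin.
- exact/measurable_EFinP.
- by move=> t _; rewrite lee_fin.
- by apply/measurable_EFinP; exact: measurable_funTS.
rewrite EFinD; apply: leeD.
  under eq_integral do rewrite EFinM.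
  rewrite ge0_integralZl_EFin ?powR_ge0//; last 2 first.
  - by move=> t _; rewrite lee_fin powR_ge0.
  - exact/measurable_EFinP.
  rewrite EFinM; apply: lee_wpmul2l; first by rewrite lee_fin powR_ge0.
  by apply: (le_trans HK2); rewrite lee_fin ler_piMr.
rewrite integral_ball_volume//; last 2 first.
- by apply/measurable_EFinP; exact: measurable_funTS.
- by move=> t _; rewrite lee_fin.
rewrite EFinM; apply: lee_wpmul2l; first by rewrite lee_fin vol_const_ge0.
apply: (@le_trans _ _ (\int[leb]_t (F2 t)%:E)%E).
  apply: ge0_subset_integral => //.
  - exact: measurableI.
  - exact: (measurableT_comp (@EFin_measurable R setT) mF2).
  - by move=> t _; rewrite lee_fin.
have mM : measurable_fun setT (fun t : T => (majorant b c (1 - r) t)%:E : \bar R).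
  exact: (measurableT_comp (@EFin_measurable R setT) (measurable_majorant _ _ _)).
under eq_integral do rewrite /F2 mulrA EFinM.
rewrite ge0_integralZl_EFin ?mulr_ge0 ?powR_ge0//; last first.
  by move=> t _; rewrite lee_fin majorant_ge0.
apply: (@le_trans _ _ ((K1 * (1 - r) `^ tau)%:E * (K3 * ((1 - r) `^ (1 - c)) ^+ m.+2)%:E)%E).
  by apply: lee_wpmul2l; [rewrite lee_fin mulr_ge0 ?powR_ge0|exact: HK3].
rewrite -EFinM lee_fin [leLHS](_ : _ = K1 * K3 * ((1 - r) `^ tau * (1 - r) `^ (1 - c) ^+ m.+2)); last by ring.
rewrite -powR_mulrn ?powR_ge0// -powRrM -powRD; last first.
  by rewrite (lt0r_neq0 e0) implybT.
rewrite (_ : tau + _ = 0) ?powRr0 ?mulr1//.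
by rewrite /c; field; exact: lt0r_neq0.
Qed.

(** By [one_sub_sqr_hnorm_Phi] the integrand involves [a] only through [|a|] and
    [<z,a>], and the map of [unitary_to_axis] turns [<z,a>] into the product
    of [|a|] and the first coordinate. *)
Lemma Phi_integral_bounded (tau : R) : m.+1%:R < tau ->
  exists K : R, forall a, uball a ->
  (\int[@ball_volume R m.+1]_(t in ball)
    ((1 - hnorm (Phi a (cvec t)) ^+ 2) `^ tau / (1 - hnorm (cvec t) ^+ 2) ^+ m.+2)%:E <= K%:E)%E.
Proof.
move=> tau1; have [K HK] := axis_kernel_integral tau1.
exists K => a ua; apply: le_trans (HK (hnorm a) _); last by rewrite hnorm_ge0.
have mB := @measurable_uball R m.+1.
have [phi [mphi phiD phi_surj phi_norm phiE]] := unitary_to_axis a.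
have mk D : measurable_fun D (fun t => (axis_kernel tau (hnorm a) t)%:E).
  by apply: measurable_funTS; apply/measurable_EFinP; exact: measurable_axis_kernel.
have k0 t : ball t -> (0 <= (axis_kernel tau (hnorm a) t)%:E)%E.
  move=> Bt; rewrite lee_fin divr_ge0 ?powR_ge0// exprn_ge0// subr_ge0.
  by rewrite exprn_ile1 ?hnorm_ge0// ltW.
have HE t : ball t -> (1 - hnorm (Phi a (cvec t)) ^+ 2) `^ tau /
    (1 - hnorm (cvec t) ^+ 2) ^+ m.+2 = axis_kernel tau (hnorm a) (phi t).
  by move=> Bt; rewrite /axis_kernel one_sub_sqr_hnorm_Phi// phi_norm phiE.
under eq_integral => t /set_mem Bt do rewrite HE//.
(* The invariance holds for integrals over the whole space, so the integrand is
   extended by 0 outside the ball, which [phi] preserves. *)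
pose F := (fun t => (axis_kernel tau (hnorm a) t)%:E) \_ ball.
have mF : measurable_fun setT F by exact/(measurable_restrictT _ _).1.
have F0 t : (0 <= F t)%E by apply: erestrict_ge0.
have FE t : F (phi t) = ((fun t => (axis_kernel tau (hnorm a) (phi t))%:E) \_ ball) t.
  rewrite /F !patchE; congr (if _ then _ else _).
  by apply/idP/idP; rewrite !inE /= /uball /= phi_norm.
have H := integral_isometry mphi phiD phi_surj phi_norm mF F0.
have mk' : measurable_fun ball (fun t => (axis_kernel tau (hnorm a) (phi t))%:E).
  by apply: measurable_funTS; exact: (measurableT_comp (mk setT) mphi).
have k0' t : ball t -> (0 <= (axis_kernel tau (hnorm a) (phi t))%:E)%E.
  by move=> Bt; apply: k0; rewrite /= /uball /= phi_norm.
rewrite (integral_ball_volume mB mk' k0') (integral_ball_volume mB (mk ball) k0) !setIid.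
rewrite [in leRHS]integral_mkcond -/F -H le_eqVlt; apply/orP; left; apply/eqP.
by congr (_ * _)%E; rewrite integral_mkcond; apply: eq_integral => t _; rewrite FE.
Qed.

End phi_integral.

(** * Moments of monomials *)

Section monomial_moments.
Context {R : realType} {n : nat}.
Local Notation leb := (@lebesgue_cvec R n).
Local Notation T := (n.-tuple (plane R)).
Local Notation ball := (cvec @^-1` uball : set T).
Local Notation zero := ([tuple (0, 0) | j < n] : T).
Local Notation "x %:C" := (real_complex _ x).

Lemma cvec_radial (t : T) : cvec (radial t) = ((hnorm (cvec t))^-1)%:C *: cvec t.
Proof.
apply/rowP => j; rewrite !mxE tnth_map /=; apply/eqP.
by rewrite eq_complex /= !mul0r subr0 addr0 (mulrC _ _^-1) (mulrC _ _^-1) !eqxx.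
Qed.

Lemma hnorm_radial (t : T) : hnorm (cvec t) != 0 -> hnorm (cvec (radial t)) = 1.
Proof.
by move=> t0; rewrite cvec_radial hnormZR ger0_norm ?invr_ge0 ?hnorm_ge0// mulVf.
Qed.

Lemma radial_affine (c : R) (t : T) : 0 < c -> radial (affine c zero t) = radial t.
Proof.
move=> c0; apply: (can_inj (@cvecK R n)); rewrite !cvec_radial hnorm_affine.
rewrite cvec_affine (_ : cvec zero = 0); last first.
  by apply/rowP => j; rewrite !mxE tnth_mktuple.
rewrite addr0 gtr0_norm// scalerA -rmorphM invfM mulrAC mulVf ?mul1r//.
exact: lt0r_neq0.
Qed.

(** The ball of radius c has volume at most [c^(2n)]. *)
Lemma ball_volume_origin : (0 < n)%N ->
  @ball_volume R n [set t | hnorm (cvec t) = 0] = 0%E.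
Proof.
move=> n0.
have mB := @measurable_uball R n.
have mO : measurable [set t : T | hnorm (cvec t) = 0].
  rewrite (_ : [set t | _] = (fun t => hnorm (@cvec R n t)) @^-1` [set 0])//.
  by rewrite -[X in measurable X]setTI; exact: measurable_hnorm_cvec.
apply/eqP; rewrite eq_le measure_ge0 andbT; apply/lee_addgt0Pr => e e0; rewrite add0e.
pose c := Num.min (2^-1) e.
have c0 : 0 < c by rewrite lt_min e0 andbT invr_gt0.
have c1 : c <= 1 by rewrite ge_min (_ : 2^-1 <= 1)// invf_le1// ler1n.
have mS := @measurable_hnorm_lt R n c.
apply: (@le_trans _ _ (@ball_volume R n [set t | (hnorm (cvec t) < c)%R])).
  by apply: le_measure; rewrite ?inE// => t /= ->.
rewrite -[leLHS]mul1e -integral_cst// integral_ball_volume//.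
rewrite (setIidl (A := [set t | _])); last first.
  by move=> t /= tc; rewrite /uball /=; exact: lt_le_trans tc c1.
rewrite (integral_small_ball (h := fun=> 1))//.
rewrite muleCA.
have -> : ((@vol_const R n)%:E * \int[leb]_(t in ball) 1%:E = @ball_volume R n ball)%E.
  by rewrite -[RHS]mul1e -integral_cst// integral_ball_volume// setIid.
apply: (@le_trans _ _ ((c ^+ (2 * n))%:E * 1)%E).
  by apply: lee_wpmul2l; [rewrite lee_fin exprn_ge0// ltW|exact: ball_volume_le1].
rewrite mule1 lee_fin; apply: (@le_trans _ _ c); last by rewrite ge_min lexx orbT.
rewrite -[leRHS]expr1; apply: ler_wiXn2l => //; first exact: ltW.
by rewrite muln_gt0.
Qed.

Lemma cmeasurable_monomial (alpha : multiindex n) :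
  cmeasurable (fun t : T => monomial alpha (cvec t)).
Proof.
apply: cmeasurable_prod => j; apply: cmeasurableX; exact: cmeasurable_cvec.
Qed.

Lemma monomialZ (alpha : multiindex n) c (z : 'rV[R[i]]_n) :
  monomial alpha (c *: z) = c ^+ (\sum_j alpha j) * monomial alpha z.
Proof.
rewrite /monomial expr_sum -big_split /=; apply: eq_bigr => j _.
by rewrite mxE exprMn.
Qed.

Lemma normc_monomial_le1 (alpha : multiindex n) (z : 'rV[R[i]]_n) :
  hnorm z <= 1 -> Normc.normc (monomial alpha z) <= 1.
Proof.
move=> z1; rewrite /monomial normc_prod (@le_trans _ _ (\prod_(j < n) 1))//; last by rewrite big1.
apply: ler_prod => j _; rewrite normcX exprn_ge0 ?normc_ge0//= exprn_ile1 ?normc_ge0//.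
exact: le_trans (normc_le_hnorm _ _) z1.
Qed.

(** The function [|(z/|z|)^alpha|^k], set to 0 at the origin, where the direction is
    not defined. *)
Definition radial_weight (alpha : multiindex n) (k : R) (t : T) : R :=
  Normc.normc (monomial alpha (cvec (radial t))) `^ k * (hnorm (cvec t) != 0)%:R.

Lemma radial_weight_ge0 alpha k t : 0 <= radial_weight alpha k t.
Proof. by rewrite mulr_ge0 ?powR_ge0. Qed.

Lemma measurable_radial_weight alpha k : measurable_fun setT (radial_weight alpha k).
Proof.
apply: measurable_funM.
  apply: (measurableT_comp (measurable_powR _)).
  exact: (measurableT_comp (measurable_normc (cmeasurable_monomial alpha))
    (@measurable_radial R n)).
apply: (measurableT_comp (f := fun b : bool => b%:R : R)) => //.
under eq_fun do rewrite -[_ != _]/(~~ (_ == _)).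
apply: measurable_neg; apply: measurable_fun_eqr => //.
exact: measurable_hnorm_cvec.
Qed.

(** Surface measure is the image of volume under the radial projection; the
    integral is finite because monomials are bounded by 1 on the sphere. *)
Lemma sphere_momentE alpha k : 0 < k ->
  (\int[@ball_volume R n]_(t in ball) (radial_weight alpha k t)%:E =
   (sphere_moment alpha k `^ k)%:E)%E.
Proof.
move=> k0.
have mB := @measurable_uball R n.
have mh := measurable_radial_weight alpha k.
have mhE : measurable_fun setT (fun t => (radial_weight alpha k t)%:E).
  exact/measurable_EFinP.
have mSph : measurable (cvec @^-1` usphere : set T).
  rewrite (_ : _ @^-1` _ = (fun t => hnorm (@cvec R n t)) @^-1` [set 1])//.
  by rewrite -[X in measurable X]setTI; exact: measurable_hnorm_cvec.
have mg : measurable_fun setT (fun t : T => (Normc.normc (monomial alpha (cvec t)) `^ k)%:E).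
  apply/measurable_EFinP; apply: (measurableT_comp (measurable_powR _)).
  exact: measurable_normc (cmeasurable_monomial alpha).
have SE : (\int[@sphere_measure R n]_(t in cvec @^-1` usphere)
    (Normc.normc (monomial alpha (cvec t)) `^ k)%:E =
    \int[@ball_volume R n]_(t in ball) (radial_weight alpha k t)%:E)%E.
  rewrite /sphere_measure ge0_integral_pushforward//; last 3 first.
  - exact: measurable_radial.
  - exact: measurable_funTS.
  - by move=> t _; rewrite lee_fin powR_ge0.
  rewrite integral_mkcond.
  transitivity (\int[@ball_volume R n]_(t in setT) (radial_weight alpha k t)%:E)%E.
    apply: eq_integral => t _; rewrite patchE /radial_weight /=.
    have [t0|t0] := eqVneq (hnorm (cvec t)) 0.
      rewrite mulr0 ifF//; apply/negbTE; rewrite notin_setE /= /usphere /=.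
      rewrite cvec_radial hnormZR t0 mulr0 => /esym/eqP; rewrite oner_eq0//.
    rewrite mulr1 ifT// inE /= /usphere /=; exact: hnorm_radial.
  rewrite !integral_ball_volume//; try by move=> t _; rewrite lee_fin radial_weight_ge0.
  - by rewrite setTI setIid.
  - exact: measurable_funTS.
rewrite /sphere_moment SE.
set I := (\int[_]_(t in _) _)%E.
have I0 : (0 <= I)%E by apply: integral_ge0 => t _; rewrite lee_fin radial_weight_ge0.
have I1 : (I <= 1)%E.
  apply: (@le_trans _ _ (\int[@ball_volume R n]_(t in ball) 1%:E)%E).
    apply: ge0_le_integral => //.
    - by move=> t _; rewrite lee_fin radial_weight_ge0.
    - exact: measurable_funTS.
    move=> t _; rewrite lee_fin /radial_weight; case: eqP => [_|/eqP t0]; first by rewrite mulr0.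
    rewrite mulr1 -[leRHS](_ : 1 `^ k = 1); last by rewrite powR1.
    apply: ge0_ler_powR; rewrite ?nnegrE ?normc_ge0 ?(ltW k0)//.
    by rewrite normc_monomial_le1// hnorm_radial.
  by rewrite integral_cst// mul1e; exact: ball_volume_le1.
have fI : I \is a fin_num by rewrite ge0_fin_numE//; exact: le_lt_trans I1 (ltry 1).
rewrite -powRrM mulVf ?(lt0r_neq0 k0)// powRr1 ?fineK//.
by rewrite fine_ge0.
Qed.

(** On the ball [|z^alpha| <= |(z/|z|)^alpha|], and the right-hand side is
    homogeneous of degree 0, so [ball_weight] applies. *)
Lemma monomial_integral_le (k rho : R) : (0 < n)%N -> 0 < k -> 0 < rho ->
  exists2 K : R, 0 <= K & forall alpha : multiindex n,
  (\int[@ball_volume R n]_(t in ball)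
     (Normc.normc (monomial alpha (cvec t)) `^ k *
      (1 - hnorm (cvec t) ^+ 2) `^ (rho - 1))%:E <=
   (K * sphere_moment alpha k `^ k)%:E)%E.
Proof.
move=> n0 k0 rho0; have [K K0 HK] := @ball_weight R n (rho - 1) n0 ltac:(lra).
exists K => // alpha.
have mB := @measurable_uball R n.
have mh := measurable_radial_weight alpha k.
have hh : homogeneous0 (radial_weight alpha k).
  move=> c t c0; rewrite /radial_weight radial_affine// hnorm_affine.
  by rewrite mulf_eq0 normr_eq0 (gt_eqF c0).
apply: le_trans (HK _ _ hh mh (radial_weight_ge0 _ _) (sphere_momentE alpha k0)).
have mw : measurable_fun ball (fun t : T => (1 - hnorm (cvec t) ^+ 2) `^ (rho - 1)).
  apply: measurable_funTS; apply: (measurableT_comp (measurable_powR _)).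
  by apply: measurable_funB => //; exact: measurable_sqr_hnorm.
apply: ae_ge0_le_integral => //.
- by move=> t _; rewrite lee_fin mulr_ge0 ?powR_ge0.
- apply/measurable_EFinP; apply: measurable_funM => //; apply: measurable_funTS.
  apply: (measurableT_comp (measurable_powR _)).
  exact: measurable_normc (cmeasurable_monomial alpha).
- by move=> t _; rewrite lee_fin mulr_ge0 ?powR_ge0 ?radial_weight_ge0.
- apply/measurable_EFinP; apply: measurable_funM => //; exact: measurable_funTS.
exists [set t | hnorm (cvec t) = 0]; split.
- rewrite (_ : [set t | _] = (fun t => hnorm (@cvec R n t)) @^-1` [set 0])//.
  by rewrite -[X in measurable X]setTI; exact: measurable_hnorm_cvec.
- exact: ball_volume_origin.
move=> t /= H; apply: contrapT => /eqP t0; apply: H => Bt.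
rewrite lee_fin ler_wpM2r ?powR_ge0// /radial_weight t0 mulr1.
apply: ge0_ler_powR; rewrite ?nnegrE ?normc_ge0 ?(ltW k0)//.
rewrite cvec_radial monomialZ Normc.normcM normcX normcR ger0_norm ?invr_ge0 ?hnorm_ge0//.
rewrite ler_peMl ?normc_ge0// exprVn invf_ge1.
  by rewrite exprn_ile1 ?hnorm_ge0// ltW.
by rewrite exprn_gt0// lt_def t0 hnorm_ge0.
Qed.

End monomial_moments.

(** * Khinchine's inequality *)

Section khinchine.
Context {R : realType}.
Local Notation "x %:C" := (real_complex _ x).

Definition signed (b : bool) : R := if b then 1 else -1.

Lemma cosh_le (x : R) : `|x| <= 2^-1 -> (expR x + expR (- x)) / 2 <= expR (2 * x ^+ 2).
Proof.
have aux (y : R) : `|y| <= 2^-1 -> expR y <= 1 + y + 2 * y ^+ 2.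
  rewrite ler_norml => /andP[y1 y2].
  have h : 0 < 1 - y by lra.
  have := expR_ge1Dx (- y); rewrite expRN => h2.
  apply: (@le_trans _ _ (1 - y)^-1).
    by rewrite -[leLHS]invrK lef_pV2 ?posrE ?invr_gt0 ?expR_gt0.
  rewrite -[leLHS]mul1r ler_pdivrMr// -subr_ge0.
  rewrite (_ : _ - _ = y ^+ 2 * (1 - 2 * y)); last by ring.
  by rewrite mulr_ge0 ?sqr_ge0//; lra.
move=> hx; have h1 := aux _ hx; have := aux (- x); rewrite normrN => /(_ hx).
rewrite sqrrN => h2; have h3 := expR_ge1Dx (2 * x ^+ 2).
by rewrite ler_pdivrMr//; lra.
Qed.

Lemma powR_le_cosh (k : R) : 0 < k ->
  exists2 M : R, 0 <= M & forall t : R, `|t| `^ k <= M * (expR t + expR (- t)).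
Proof.
move=> k0; pose m := Num.bound k.
have mk : k <= m.+1%:R by rewrite -natr1 ler_wpDr// ltW// archi_boundP// ltW.
exists (m.+1)`!%:R => // t.
have e0 : expR `|t| <= expR t + expR (- t).
  by case: (ler0P t) => _; rewrite ?lerDr ?lerDl expR_ge0.
have f1 : (1 : R) <= (m.+1)`!%:R by rewrite ler1n fact_gt0.
apply: (@le_trans _ _ ((m.+1)`!%:R * expR `|t|)); last by rewrite ler_wpM2l.
have [t1|t1] := leP `|t| 1.
  apply: (@le_trans _ _ 1).
    rewrite -[leRHS](_ : 1 `^ k = 1); last by rewrite powR1.
    by apply: ge0_ler_powR; rewrite ?nnegrE ?(ltW k0).
  by rewrite mulr_ege1//; have := expR_ge1Dx `|t|; have := normr_ge0 t; lra.
apply: (@le_trans _ _ (`|t| ^+ m.+1)).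
  by rewrite -powR_mulrn// ler_powR// ltW.
have := expR_ge1Dxn m (normr_ge0 t).
rewrite -lerBrDl ler_pdivrMr ?ltr0n ?fact_gt0// mulrC => /le_trans; apply.
by rewrite ler_wpM2l// gerBl.
Qed.

Lemma sum_expR_signs (I : finType) (y : I -> R) :
  (2^-1) ^+ #|I| * \sum_(s : {ffun I -> bool}) expR (\sum_i signed (s i) * y i) =
  \prod_i ((expR (y i) + expR (- y i)) / 2).
Proof.
rewrite big_split /= prodr_const mulrC; congr (_ * _).
under [RHS]eq_bigr => i _.
  rewrite (_ : expR (y i) + expR (- y i) = \sum_(b : bool) expR (signed b * y i)); last first.
    by rewrite big_bool /= mul1r mulN1r.
  over.
rewrite bigA_distr_bigA /=; apply: eq_bigr => s _.
by rewrite expR_sum.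
Qed.

(** Normalize so that the squares sum to 1/4.  The power k is dominated by cosh,
    whose mean over the signs is the product of the [cosh (x i)], at most
    the product of the [expR (2 x i ^+ 2)], a constant. *)
Lemma khinchine_real (k : R) : 0 < k ->
  exists2 C : R, 0 <= C & forall (I : finType) (x : I -> R),
  (2^-1) ^+ #|I| * \sum_(s : {ffun I -> bool}) `|\sum_i signed (s i) * x i| `^ k <=
  C * (\sum_i x i ^+ 2) `^ (k / 2).
Proof.
move=> k0; have [M M0 HM] := powR_le_cosh k0.
exists (2 `^ k * (M * (2 * expR 2^-1))).
  by rewrite !mulr_ge0 ?powR_ge0 ?expR_ge0.
move=> I x; pose S2 := \sum_i x i ^+ 2.
have S20 : 0 <= S2 by apply: sumr_ge0 => i _; exact: sqr_ge0.
pose S := Num.sqrt S2.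
have S0 : 0 <= S by exact: sqrtr_ge0.
have SS : S ^+ 2 = S2 by rewrite sqr_sqrtr.
have SE : S2 `^ (k / 2) = S `^ k.
  by rewrite -SS -powR_mulrn// -powRrM; congr (_ `^ _); field.
rewrite -/S2 SE.
have xS i : `|x i| <= S.
  rewrite -(@ler_pXn2r _ 2) ?nnegrE// real_normK ?num_real// SS /S2 (bigD1 i)//=.
  by rewrite lerDl sumr_ge0// => j _; exact: sqr_ge0.
have h2 : (0 : R) <= 2^-1 by rewrite invr_ge0.
have [S00|Sn0] := eqVneq S 0.
  rewrite big1 ?mulr0 ?mulr_ge0 ?powR_ge0 ?expR_ge0// => s _.
  rewrite big1 => [|i _]; first by rewrite normr0 powR0// gt_eqF.
  by move: (xS i); rewrite S00 normr_le0 => /eqP ->; rewrite mulr0.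
have Sp : 0 < S by rewrite lt_def Sn0.
(* The factor 2 brings every term into the range of [cosh_le]. *)
pose y i := x i / (2 * S).
have yle i : `|y i| <= 2^-1.
  by rewrite /y normrM normfV (ger0_norm (x := 2 * S)) ?mulr_ge0// invfM mulrA
     ler_pdivrMr// mulrC ler_wpM2l.
have y2 : \sum_i y i ^+ 2 = 4^-1.
  under eq_bigr do rewrite /y exprMn; rewrite -mulr_suml -/S2 -SS; field.
  exact: Sn0.
have prodle : \prod_i ((expR (y i) + expR (- y i)) / 2) <= expR 2^-1.
  rewrite [in leRHS](_ : 2^-1 = \sum_i 2 * y i ^+ 2); last by rewrite -mulr_sumr y2; field.
  rewrite expR_sum; apply: ler_prod => i _.
  by rewrite cosh_le// andbT divr_ge0// addr_ge0 ?expR_ge0.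
apply: (@le_trans _ _ ((2^-1) ^+ #|I| * \sum_(s : {ffun I -> bool}) (2 `^ k * S `^ k *
    (M * (expR (\sum_i signed (s i) * y i) + expR (\sum_i signed (s i) * - y i)))))).
  apply: ler_wpM2l; first exact: exprn_ge0.
  apply: ler_sum => s _.
  have -> : \sum_i signed (s i) * x i = 2 * S * \sum_i signed (s i) * y i.
    rewrite mulr_sumr; apply: eq_bigr => i _; rewrite /y; field; exact: Sn0.
  have -> : \sum_i signed (s i) * - y i = - \sum_i signed (s i) * y i.
    by rewrite -sumrN; apply: eq_bigr => i _; rewrite mulrN.
  rewrite normrM (ger0_norm (x := 2 * S)) ?mulr_ge0// !powRM ?mulr_ge0//.
  by apply: ler_wpM2l; [rewrite mulr_ge0 ?powR_ge0|exact: HM].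
rewrite -!mulr_sumr big_split /=.
set E1 := \sum_s expR _; set E2 := \sum_s expR _.
have E1le : (2^-1) ^+ #|I| * E1 <= expR 2^-1 by rewrite sum_expR_signs.
have E2le : (2^-1) ^+ #|I| * E2 <= expR 2^-1.
  rewrite (sum_expR_signs (fun i => - y i)).
  by under eq_bigr do rewrite opprK addrC.
rewrite [leLHS](_ : _ = 2 `^ k * M * S `^ k * ((2^-1) ^+ #|I| * E1 + (2^-1) ^+ #|I| * E2)); last by ring.
rewrite [leRHS](_ : _ = 2 `^ k * M * S `^ k * (expR 2^-1 + expR 2^-1)); last by ring.
by rewrite ler_wpM2l ?mulr_ge0 ?powR_ge0// lerD.
Qed.

Lemma normc_powR_le (k : R) (z : R[i]) : 0 < k ->
  Normc.normc z `^ k <= 2 `^ k * (`|complex.Re z| `^ k + `|complex.Im z| `^ k).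
Proof.
move=> k0; case: z => u v /=.
have h (s t : R) : `|s| <= `|t| -> Num.sqrt (s ^+ 2 + t ^+ 2) <= 2 * `|t|.
  move=> st; rewrite -(@ler_pXn2r _ 2) ?nnegrE ?sqrtr_ge0 ?mulr_ge0//.
  rewrite sqr_sqrtr ?addr_ge0 ?sqr_ge0// exprMn real_normK ?num_real//.
  have : s ^+ 2 <= t ^+ 2.
    by rewrite -[s ^+ 2]real_normK ?num_real// -[t ^+ 2]real_normK ?num_real// ler_pXn2r ?nnegrE.
  by have := sqr_ge0 t; lra.
have key (s t : R) : `|s| <= `|t| ->
    Num.sqrt (s ^+ 2 + t ^+ 2) `^ k <= 2 `^ k * (`|s| `^ k + `|t| `^ k).
  move=> st; apply: (@le_trans _ _ ((2 * `|t|) `^ k)).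
    by apply: ge0_ler_powR; rewrite ?nnegrE ?sqrtr_ge0 ?mulr_ge0 ?(ltW k0)// h.
  by rewrite powRM// ler_wpM2l ?powR_ge0// lerDr powR_ge0.
have [uv|vu] := leP `|u| `|v|; first exact: key.
by rewrite addrC [X in _ * X]addrC key// ltW.
Qed.

(** The real inequality for the real and imaginary parts. *)
Lemma khinchine (k : R) : 0 < k ->
  exists2 C : R, 0 <= C & forall (I : finType) (a : I -> R[i]),
  (2^-1) ^+ #|I| * \sum_(s : {ffun I -> bool})
     Normc.normc (\sum_i (signed (s i))%:C * a i) `^ k <=
  C * (\sum_i Normc.normc (a i) ^+ 2) `^ (k / 2).
Proof.
move=> k0; have [C C0 HC] := khinchine_real k0.
exists (2 `^ k * (C + C)); first by rewrite mulr_ge0 ?powR_ge0 ?addr_ge0.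
move=> I a.
have ReE (s : {ffun I -> bool}) : complex.Re (\sum_i (signed (s i))%:C * a i) =
    \sum_i signed (s i) * complex.Re (a i).
  elim/big_rec2 : _ => // i x z _ <-.
  by case: (a i) z => u v [u' v'] /=; rewrite mul0r subr0.
have ImE (s : {ffun I -> bool}) : complex.Im (\sum_i (signed (s i))%:C * a i) =
    \sum_i signed (s i) * complex.Im (a i).
  elim/big_rec2 : _ => // i x z _ <-.
  by case: (a i) z => u v [u' v'] /=; rewrite mul0r addr0.
have sq z : Normc.normc z ^+ 2 = complex.Re z ^+ 2 + complex.Im z ^+ 2 :> R.
  by case: z => u v /=; rewrite sqr_sqrtr// addr_ge0 ?sqr_ge0.
have h2 : (0 : R) <= 2^-1 by rewrite invr_ge0.
have mono (x : I -> R) : (forall i, x i ^+ 2 <= Normc.normc (a i) ^+ 2) ->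
    C * (\sum_i x i ^+ 2) `^ (k / 2) <= C * (\sum_i Normc.normc (a i) ^+ 2) `^ (k / 2).
  move=> hx; apply: ler_wpM2l => //; apply: ge0_ler_powR.
  - by rewrite divr_ge0// ltW.
  - by rewrite nnegrE sumr_ge0// => i _; exact: sqr_ge0.
  - by rewrite nnegrE sumr_ge0// => i _; exact: sqr_ge0.
  - by apply: ler_sum => i _.
apply: (@le_trans _ _ ((2^-1) ^+ #|I| * \sum_(s : {ffun I -> bool}) (2 `^ k *
   (`|\sum_i signed (s i) * complex.Re (a i)| `^ k +
    `|\sum_i signed (s i) * complex.Im (a i)| `^ k)))).
  apply: ler_wpM2l; first exact: exprn_ge0.
  by apply: ler_sum => s _; apply: (le_trans (normc_powR_le _ k0)); rewrite ReE ImE.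
rewrite -mulr_sumr big_split /= mulrCA -mulrA ler_wpM2l ?powR_ge0//.
rewrite mulrDr mulrDl lerD//.
  by apply: (le_trans (HC _ _)); apply: mono => i; rewrite sq lerDl sqr_ge0.
by apply: (le_trans (HC _ _)); apply: mono => i; rewrite sq lerDr sqr_ge0.
Qed.

End khinchine.

(** * The square function of a family of monomials *)

Section square_function.
Context {R : realType}.

Lemma le_poweR (r : R) (x y : \bar R) : 0 <= r ->
  (0 <= x)%E -> (x <= y)%E -> (x `^ r <= y `^ r)%E.
Proof.
move=> r0 x0 xy; apply: gt0_ler_poweR => //.
  by rewrite in_itv /= leey andbT.
by rewrite in_itv /= leey andbT (le_trans x0).
Qed.

(** Minkowski's inequality in L^r, in the form of a bound on integrals of r-th
    powers. *)
Lemma integral_powR_sum_le d (T : measurableType d) (mu : {measure set T -> \bar R})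
    (I : Type) (s : seq I) (r : R) (f : I -> T -> R) (c : I -> R) : 1 <= r ->
  (forall i, measurable_fun setT (f i)) -> (forall i x, 0 <= f i x) ->
  (forall i, 0 <= c i) ->
  (forall i, (\int[mu]_x (f i x `^ r)%:E <= (c i `^ r)%:E)%E) ->
  (\int[mu]_x ((\sum_(i <- s) f i x) `^ r)%:E <= ((\sum_(i <- s) c i) `^ r)%:E)%E.
Proof.
move=> r1 mf f0 c0 H; have r0 : 0 < r by lra.
have NE g : (forall x, 0 <= g x) ->
    (\int[mu]_x (g x `^ r)%:E = (Lnorm mu r%:E (EFin \o g)) `^ r)%E.
  move=> g0; rewrite powR_Lnorm; last exact: lt0r_neq0.
  apply: eq_integral => x _.
  by rewrite /= ger0_norm.
have sum0 s' x : 0 <= \sum_(i <- s') f i x by apply: sumr_ge0.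
have csum0 s' : 0 <= \sum_(i <- s') c i by apply: sumr_ge0.
rewrite NE// -poweR_EFin.
apply: le_poweR; [exact: ltW|exact: Lnorm_ge0|].
have Ni i : (Lnorm mu r%:E (EFin \o f i) <= (c i)%:E)%E.
  have := H i; rewrite NE// -poweR_EFin => h.
  have rV0 : 0 <= r^-1 by rewrite invr_ge0 ltW.
  have := le_poweR rV0 (poweR_ge0 _ _) h.
  by rewrite -!poweRrM mulfV ?(lt0r_neq0 r0)// !poweRe1 ?Lnorm_ge0 ?lee_fin.
elim: s => [|i s IH].
  rewrite big_nil (@eq_Lnorm _ _ _ _ _ _ (cst 0%E)); last first.
    by move=> x; rewrite /= big_nil.
  by rewrite Lnorm0// eqe lt0r_neq0.
rewrite big_cons EFinD.
rewrite (@eq_Lnorm _ _ _ _ _ _ (EFin \o (f i \+ (fun x => \sum_(j <- s) f j x))%R)); last first.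
  by move=> x; rewrite /= big_cons.
apply: (@le_trans _ _ (Lnorm mu r%:E (EFin \o f i) +
    Lnorm mu r%:E (EFin \o (fun x => (\sum_(j <- s) f j x)%R)))%E); last exact: leeD.
by apply: minkowski_EFin => //; exact: measurable_sum.
Qed.

(** With S the sum and [y i <= S], [(y i / S)^th >= y i / S]; sum over i. *)
Lemma powR_sum_le (I : finType) (y : I -> R) (th : R) : 0 < th <= 1 ->
  (forall i, 0 <= y i) -> (\sum_i y i) `^ th <= \sum_i y i `^ th.
Proof.
move=> /andP[th0 th1] y0; set S := \sum_i y i.
have S0 : 0 <= S by apply: sumr_ge0.
have [->|Sn] := eqVneq S 0.
  by rewrite powR0 ?gt_eqF// sumr_ge0// => i _; exact: powR_ge0.
have Sp : 0 < S by rewrite lt_def Sn.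
have yS i : y i <= S by rewrite /S (bigD1 i)//= lerDl sumr_ge0.
have -> : S `^ th = \sum_i S `^ th * (y i / S).
  by rewrite -mulr_sumr -mulr_suml -/S mulfV// mulr1.
apply: ler_sum => i _.
rewrite -{2}(divfK Sn (y i)) powRM ?divr_ge0// mulrC ler_wpM2r ?powR_ge0//.
have [->|yn] := eqVneq (y i) 0; first by rewrite mul0r powR_ge0.
have yp : 0 < y i by rewrite lt_def yn y0.
by apply: ger1_powR => //; rewrite divr_gt0//= ler_pdivrMr// mul1r.
Qed.

Section monomial_sums.
Context {n : nat}.
Local Notation T := (n.-tuple (plane R)).
Local Notation ball := (cvec @^-1` uball : set T).

Lemma integral_ball_volumeT (F : T -> \bar R) : measurable_fun setT F ->
  (forall t, 0 <= F t)%E ->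
  (\int[@ball_volume R n]_t F t = \int[@ball_volume R n]_(t in ball) F t)%E.
Proof.
move=> mF F0; have mB := @measurable_uball R n.
rewrite !integral_ball_volume//; last exact: measurable_funTS.
by rewrite setTI setIid.
Qed.

(** For k <= 2 the power k/2 of the sum is at most the sum of the powers k of the
    moduli, which are integrated one by one.  For k >= 2, Minkowski's inequality
    in L^(k/2) bounds the integral by the power k/2 of the sum of the squares of
    the moments. *)
Lemma square_function_integral (k rho S : R) : (0 < n)%N -> 0 < k -> 0 < rho -> 0 <= S ->
  exists2 K : R, 0 <= K & forall (I : finType) (alpha : I -> multiindex n) (a : I -> R[i]),
  \sum_i (Normc.normc (a i) * sphere_moment (alpha i) k) `^ (Num.min 2 k) <= S ->
  (\int[@ball_volume R n]_(t in ball)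
     ((\sum_i Normc.normc (a i * monomial (alpha i) (cvec t)) ^+ 2) `^ (k / 2) *
      (1 - hnorm (cvec t) ^+ 2) `^ (rho - 1))%:E <= K%:E)%E.
Proof.
move=> n0 k0 rho0 S0; have [K K0 HK] := monomial_integral_le n0 k0 rho0.
have mB := @measurable_uball R n.
have mw : measurable_fun setT (fun t : T => (1 - hnorm (cvec t) ^+ 2) `^ (rho - 1)).
  apply: (measurableT_comp (measurable_powR _)).
  by apply: measurable_funB => //; exact: measurable_sqr_hnorm.
have mm alpha : measurable_fun setT (fun t : T => Normc.normc (monomial alpha (cvec t))).
  exact: measurable_normc (cmeasurable_monomial alpha).
have mom0 alpha : 0 <= @sphere_moment R n alpha k by exact: powR_ge0.
have k2 : k / 2 != 0 by rewrite mulf_neq0 ?gt_eqF// invr_gt0.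
exists (Num.max (K * S) (K * S `^ (k / 2))) => [|I alpha a HS].
  by rewrite le_max mulr_ge0.
have powE (u : R) : 0 <= u -> (u ^+ 2) `^ (k / 2) = u `^ k.
  by move=> u0; rewrite -powR_mulrn// -powRrM; congr (_ `^ _); field.
have HKi i : (\int[@ball_volume R n]_(t in ball)
    (Normc.normc (a i * monomial (alpha i) (cvec t)) `^ k *
      (1 - hnorm (cvec t) ^+ 2) `^ (rho - 1))%:E <=
    (K * (Normc.normc (a i) * sphere_moment (alpha i) k) `^ k)%:E)%E.
  under eq_integral do rewrite Normc.normcM powRM ?normc_ge0// -mulrA EFinM.
  rewrite ge0_integralZl_EFin ?powR_ge0//; last 2 first.
  - by move=> t _; rewrite lee_fin mulr_ge0 ?powR_ge0.
  - apply: measurable_funTS; apply/measurable_EFinP; apply: measurable_funM => //.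
    exact: (measurableT_comp (measurable_powR _)).
  rewrite powRM ?normc_ge0// mulrCA EFinM.
  by apply: lee_wpmul2l; [rewrite lee_fin powR_ge0|exact: HK].
pose w (t : T) := (1 - hnorm (cvec t) ^+ 2) `^ (rho - 1).
have w0 t : 0 <= w t by exact: powR_ge0.
pose x i (t : T) := Normc.normc (a i * monomial (alpha i) (cvec t)).
have x0 i t : 0 <= x i t by exact: normc_ge0.
have mx i : measurable_fun setT (x i).
  apply: measurable_normc; apply: cmeasurableM; first exact: cmeasurable_cst.
  exact: cmeasurable_monomial.
have mxk i : measurable_fun setT (fun t => (x i t `^ k * w t)%:E).
  apply/measurable_EFinP; apply: measurable_funM => //.
  exact: (measurableT_comp (measurable_powR _)).
have sq0 (t : T) : 0 <= \sum_i x i t ^+ 2 by apply: sumr_ge0 => i _; exact: sqr_ge0.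
have mS : measurable_fun setT (fun t => ((\sum_i x i t ^+ 2) `^ (k / 2) * w t)%:E).
  apply/measurable_EFinP; apply: measurable_funM => //.
  apply: (measurableT_comp (measurable_powR _)); apply: measurable_sum => i.
  exact: measurable_funX.
have [k2le|k2gt] := leP k 2.
  rewrite (min_idPr k2le) in HS.
  apply: (@le_trans _ _ (\int[@ball_volume R n]_(t in ball)
      \sum_(i <- index_enum I) (x i t `^ k * w t)%:E)%E).
    apply: ge0_le_integral => //.
    - by move=> t _; rewrite lee_fin mulr_ge0 ?powR_ge0.
    - exact: measurable_funTS.
    - by apply: emeasurable_sum => i; exact: measurable_funTS.
    - move=> t _; rewrite sumEFin lee_fin -[leRHS]mulr_suml.
      have h : (\sum_i x i t ^+ 2) `^ (k / 2) <= \sum_i x i t `^ k.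
        apply: (@le_trans _ _ (\sum_i (x i t ^+ 2) `^ (k / 2))).
          apply: powR_sum_le => [|i]; last exact: sqr_ge0.
          by rewrite divr_gt0//= ler_pdivrMr// mul1r.
        by apply: ler_sum => i _; rewrite powE.
      exact: (ler_wpM2r (w0 t) h).
  rewrite ge0_integral_sum//; last 2 first.
  - by move=> i; exact: measurable_funTS.
  - by move=> i t _; rewrite lee_fin mulr_ge0 ?powR_ge0.
  apply: (@le_trans _ _ (\sum_(i <- index_enum I)
      (K * (Normc.normc (a i) * sphere_moment (alpha i) k) `^ k)%:E)%E).
    by apply: lee_sum => i _; exact: HKi.
  rewrite sumEFin lee_fin -mulr_sumr le_max; apply/orP; left.
  by rewrite ler_wpM2l.
rewrite (min_idPl (ltW k2gt)) in HS.
pose r := k / 2.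
have r1 : 1 <= r by rewrite ler_pdivlMr// mul1r ltW.
have r0 : 0 < r by lra.
have rV : r^-1 * r = 1 by rewrite mulVf// gt_eqF.
(* The weight is moved inside the r-th power. *)
pose f i (t : T) := x i t ^+ 2 * w t `^ r^-1.
have f0 i t : 0 <= f i t by rewrite mulr_ge0 ?sqr_ge0 ?powR_ge0.
have mf i : measurable_fun setT (f i).
  apply: measurable_funM; first exact: measurable_funX.
  exact: (measurableT_comp (measurable_powR _)).
pose c i := K `^ r^-1 * (Normc.normc (a i) * sphere_moment (alpha i) k) ^+ 2.
have c0 i : 0 <= c i by rewrite mulr_ge0 ?sqr_ge0 ?powR_ge0.
have wr t : (w t `^ r^-1) `^ r = w t by rewrite -powRrM rV powRr1.
have Hf i : (\int[@ball_volume R n]_t (f i t `^ r)%:E <= (c i `^ r)%:E)%E.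
  rewrite integral_ball_volumeT; last 2 first.
  - by apply/measurable_EFinP; exact: (measurableT_comp (measurable_powR _)).
  - by move=> t; rewrite lee_fin powR_ge0.
  rewrite /c powRM ?sqr_ge0 ?powR_ge0// -powRrM rV powRr1// powE ?mulr_ge0 ?normc_ge0//.
  apply: le_trans (HKi i); rewrite le_eqVlt; apply/orP; left; apply/eqP.
  apply: eq_integral => t _; rewrite /f powRM ?sqr_ge0 ?powR_ge0// wr powE//.
have := integral_powR_sum_le (index_enum I) r1 mf f0 c0 Hf.
rewrite integral_ball_volumeT; last 2 first.
- apply/measurable_EFinP; apply: (measurableT_comp (measurable_powR _)).
  exact: measurable_sum.
- by move=> t; rewrite lee_fin powR_ge0.
move=> H; apply: (@le_trans _ _ ((\sum_i c i) `^ r)%:E).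
  apply: le_trans H; rewrite le_eqVlt; apply/orP; left; apply/eqP.
  apply: eq_integral => t _; rewrite /f -mulr_suml.
  by rewrite powRM ?powR_ge0// wr.
rewrite lee_fin le_max; apply/orP; right.
rewrite /c -mulr_sumr powRM ?powR_ge0//; last by apply: sumr_ge0 => i _; exact: sqr_ge0.
rewrite -powRrM rV powRr1// ler_wpM2l// -/r.
apply: ge0_ler_powR; rewrite ?nnegrE ?(ltW r0)//.
  by apply: sumr_ge0 => i _; exact: sqr_ge0.
by apply: le_trans HS; apply: ler_sum => i _; rewrite powR_mulrn// mulr_ge0// normc_ge0.
Qed.

End monomial_sums.

End square_function.

(** * Means over Bernoulli signs *)

Section bernoulli_expectation.
Context {d : measure_display} {Omega : measurableType d} {R : realType}.
Context {I : choiceType}.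
Variables (P : probability Omega R) (eps : I -> {RV P >-> R}).
Hypothesis Beps : bernoulli_sequence eps.

(** Recording whether the variable is 1 makes every outcome a pattern, including
    those of the negligible set where a variable is neither 1 nor -1. *)
Definition sign_pattern (J : finType) (alpha : J -> I) (w : Omega) : {ffun J -> bool} :=
  [ffun j => eps (alpha j) w == 1].

Lemma prob_neq1 i : P (eps i @^-1` [set x | (x == 1) = false]) = (2^-1)%:E.
Proof.
have [_ /(_ i)[H _]] := Beps.
rewrite (_ : _ @^-1` _ = ~` (eps i @^-1` [set 1])); last first.
  apply/seteqP; split => w /=; first by move=> /eqP.
  by move=> /eqP/negbTE.
rewrite probability_setC; last by rewrite -[X in measurable X]setTI; exact: measurable_funP.
by rewrite H -EFinB; congr EFin; field.
Qed.

Lemma prob_sign i b : P (eps i @^-1` [set x | (x == 1) = b]) = (2^-1)%:E.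
Proof.
case: b; last exact: prob_neq1.
have [_ /(_ i)[<- _]] := Beps; congr (P _).
by apply/seteqP; split => w /= /eqP.
Qed.

Lemma prob_sign_pattern (J : finType) (alpha : J -> I) (s : {ffun J -> bool}) :
  injective alpha ->
  measurable [set w | sign_pattern alpha w = s] /\
  P [set w | sign_pattern alpha w = s] = (2^-1 ^+ #|J|)%:E.
Proof.
move=> inj_alpha.
pose A i := [set x : R | forall j, alpha j = i -> (x == 1) = s j].
have AE j : A (alpha j) = [set x | (x == 1) = s j].
  by apply/seteqP; split => x /= => [/(_ j erefl)//|h j' /inj_alpha ->].
have m1 b : measurable [set x : measurableTypeR R | (x == 1) = b].
  case: b.
    rewrite (_ : [set _ | _] = [set 1]); first exact: measurable_set1.
    by apply/seteqP; split => x /= /eqP.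
  rewrite (_ : [set _ | _] = ~` [set 1]); first by apply: measurableC; exact: measurable_set1.
  by apply/seteqP; split => x /=; [move=> /eqP|move=> /eqP/negbTE].
have mA i : measurable (A i : set (measurableTypeR R)).
  have [[j <-]|nj] := pselect (exists j, alpha j = i); first by rewrite AE.
  rewrite (_ : A i = setT); first exact: measurableT.
  by apply/seteqP; split => // x _ j ji; exfalso; apply: nj; exists j.
pose F := [fset alpha j | j in J]%fset.
have SE : [set w | sign_pattern alpha w = s] = \bigcap_(i in [set` F]) (eps i @^-1` A i).
  apply/seteqP; split => [w /= ws i /imfsetP[j /= _ ->]|w /= H].
    by rewrite AE /= -ws ffunE.
  apply/ffunP => j; rewrite ffunE.
  have := H (alpha j); rewrite AE /=; apply.
  by apply/imfsetP; exists j.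
split.
  rewrite SE; apply: fin_bigcap_measurable; first exact: finite_fset.
  move=> i _; rewrite -[X in measurable X]setTI; apply: measurable_funP => //.
  exact: mA.
have [indep _] := Beps.
rewrite SE (indep F A mA).
rewrite /F (perm_big _ (enum_imfset _ (fun x y _ _ => @inj_alpha x y))) /= big_map.
under eq_bigr do rewrite AE prob_sign.
by rewrite prodEFin big_enum /= prodr_const.
Qed.

(** By independence every pattern has the same probability, so an expectation is
    an average over all patterns. *)
Lemma expectation_sign_pattern (J : finType) (alpha : J -> I)
    (G : {ffun J -> bool} -> \bar R) : injective alpha -> (forall s, 0 <= G s)%E ->
  measurable_fun setT (fun w => G (sign_pattern alpha w)) /\
  (\int[P]_w G (sign_pattern alpha w) =
   (2^-1 ^+ #|J|)%:E * \sum_(s : {ffun J -> bool}) G s)%E.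
Proof.
move=> inj_alpha G0.
pose A s := [set w | sign_pattern alpha w = s].
have mA s : measurable (A s) by have [] := prob_sign_pattern s inj_alpha.
have PA s : P (A s) = (2^-1 ^+ #|J|)%:E by have [] := prob_sign_pattern s inj_alpha.
have GE w : G (sign_pattern alpha w) = (\sum_s G s * (\1_(A s) w)%:E)%E.
  rewrite (bigD1 (sign_pattern alpha w))//= big1 ?adde0.
    by rewrite indicE mem_set ?mule1.
  move=> s sn; rewrite indicE memNset ?mule0// => /= h.
  by rewrite h eqxx in sn.
have mI s : measurable_fun setT (fun w => (G s * (\1_(A s) w)%:E)%E).
  by apply: emeasurable_funM => //; apply/measurable_EFinP; exact: measurable_indic.
have -> : (fun w => G (sign_pattern alpha w)) = (fun w => \sum_s G s * (\1_(A s) w)%:E)%E.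
  by apply/funext => w; rewrite GE.
split; first exact: emeasurable_sum.
rewrite ge0_integral_sum//; last by move=> s w _; rewrite mule_ge0// lee_fin.
rewrite ge0_sume_distrr//; apply: eq_bigr => s _.
rewrite ge0_integralZl//; last by apply/measurable_EFinP; exact: measurable_indic.
by rewrite integral_indic// setIT muleC; congr (_ * _)%E; exact: PA.
Qed.

Lemma ae_signed (a0 : I) : {ae P, forall w, eps a0 w = signed (eps a0 w == 1)}.
Proof.
have [_ /(_ a0)[H1 H2]] := Beps.
have m1 x : measurable (eps a0 @^-1` [set x]).
  by rewrite -[X in measurable X]setTI; apply: measurable_funP => //; exact: measurable_set1.
exists (~` (eps a0 @^-1` [set 1] `|` eps a0 @^-1` [set -1])); split.
- by apply: measurableC; exact: measurableU.
- rewrite probability_setC; last exact: measurableU.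
  rewrite measureU//; last first.
    apply/seteqP; split => // w [/= -> /eqP].
    by rewrite -subr_eq0 opprK -(natrD _ 1 1) pnatr_eq0.
  transitivity (1 - ((2^-1 : R)%:E + (2^-1 : R)%:E))%E.
    by congr (_ - (_ + _))%E; [exact: H1|exact: H2].
  have -> : ((2^-1 : R)%:E + (2^-1 : R)%:E = 1)%E by rewrite -EFinD; congr EFin; field.
  by rewrite subee.
move=> w /= h [hw|hw]; apply: h; rewrite /signed; rewrite hw.
  by rewrite eqxx.
by case: eqP => // e; rewrite -e in hw; move/eqP: e; rewrite -subr_eq0 -opprD oppr_eq0 -(natrD _ 1 1) pnatr_eq0.
Qed.

End bernoulli_expectation.

(** By Fatou's lemma the limit inferior is integrable. *)
Lemma ae_limn_einf_lty d (Omega : measurableType d) (R : realType)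
    (P : probability Omega R) (G : nat -> Omega -> \bar R) (C : R) :
  (forall N, measurable_fun setT (G N)) -> (forall N w, (0 <= G N w)%E) ->
  (forall N, (\int[P]_w G N w <= C%:E)%E) ->
  {ae P, forall w, (limn_einf (fun N => G N w) < +oo)%E}.
Proof.
move=> mG G0 GC.
have L0 w : (0 <= limn_einf (fun N => G N w))%E.
  rewrite limn_einf_lim; apply: lime_ge; first exact: is_cvg_einfs.
  by apply: nearW => N; apply: le_ereal_inf_tmp => _ [m _ <-].
have mL : measurable_fun setT (fun w => limn_einf (fun N => G N w)).
  rewrite (_ : (fun _ => _) = (fun w => - limn_esup (fun N => - G N w)))%E.
    apply: measurableT_comp => //; apply: measurable_fun_limn_esup => N.
    exact: measurableT_comp.
  apply/funext => w; rewrite -limn_einfN; congr limn_einf.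
  by apply/funext => N /=; rewrite oppeK.
have LC : (\int[P]_w limn_einf (fun N => G N w) <= C%:E)%E.
  apply: (le_trans (fatou P measurableT mG (fun N w _ => G0 N w))).
  rewrite limn_einf_lim; apply: lime_le; first exact: is_cvg_einfs.
  apply: nearW => N; apply: le_trans (GC N).
  by apply: ereal_inf_lbound; exists N => //=.
have : P.-integrable setT (fun w => limn_einf (fun N => G N w)).
  apply/integrableP; split => //.
  under eq_integral do rewrite gee0_abs//.
  exact: le_lt_trans LC (ltry _).
move=> /(integrable_ae measurableT); apply: filterS => w /(_ Logic.I).
by rewrite ge0_fin_numE.
Qed.

(** * Unconditional sums of complex families *)

#[local] Existing Instance summability.totally_filter.

Section unconditional_sums.
Context {R : realType} {I : choiceType}.
Local Notation "x %:C" := (real_complex _ x).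
Implicit Types (x y : I -> R[i]) (l m c : R[i]) (J : {fset I}).

(** Convergence along the filter of finite sets, with the norm taken in the reals;
    [has_sumP] gives the link with the topology. *)
Definition has_sum x l := forall e : R, 0 < e -> exists J0, forall J,
  (J0 `<=` J)%fset -> Normc.normc (l - \sum_(i <- J) x i) < e.

Definition abs_bounded x (M : R) := forall J, \sum_(i <- J) Normc.normc (x i) <= M.

Lemma ler_normcD (u v : R[i]) :
  Normc.normc (u + v) <= Normc.normc u + Normc.normc v.
Proof. exact: (@le_normcD R u v). Qed.

Lemma ler_normc_sum (J : Type) (s : seq J) (u : J -> R[i]) :
  Normc.normc (\sum_(j <- s) u j) <= \sum_(j <- s) Normc.normc (u j).
Proof.
elim/big_ind2: _ => [|x1 x2 y1 y2 h1 h2|//]; first by rewrite Normc.normc0.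
exact: le_trans (ler_normcD _ _) (lerD h1 h2).
Qed.

Lemma has_sumP x l : has_sum x l <->
  (summability.partial_sum (x : I -> R[i]^o) @ summability.totally --> (l : R[i]^o)).
Proof.
have sumE J : summability.partial_sum (x : I -> R[i]^o) J = \sum_(i <- J) x i.
  by rewrite big_seq_fsetE.
have nE (u : R[i]^o) : `|u| = (Normc.normc u)%:C by [].
split => [H|/cvgrPdist_lt H e e0].
  apply/cvgrPdist_lt => e; rewrite ltcE => /andP[/eqP /= ei er].
  have [J0 HJ] := H _ er; exists J0 => // J /= J0J.
  by rewrite sumE nE ltcE /= ei eqxx /= HJ.
have e0' : (0 : R[i]) < e%:C by rewrite ltcR.
have [J0 _ HJ] := H _ e0'; exists J0 => J J0J.
by have := HJ J J0J; rewrite sumE nE ltcR.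
Qed.

Lemma sum_has_sum x l : has_sum x l -> summability.sum (x : I -> R[i]^o) = l.
Proof. by move=> /has_sumP H; apply: cvg_lim H; exact: norm_hausdorff. Qed.

Lemma has_sumD x y l m : has_sum x l -> has_sum y m ->
  has_sum (fun i => x i + y i) (l + m).
Proof.
move=> Hx Hy e e0; have e2 : 0 < e / 2 by rewrite divr_gt0.
have [J1 H1] := Hx _ e2; have [J2 H2] := Hy _ e2.
exists (J1 `|` J2)%fset => J; rewrite fsubUset => /andP[J1J J2J].
rewrite big_split /= opprD addrACA (splitr e).
apply: le_lt_trans (ltrD (H1 J J1J) (H2 J J2J)).
exact: ler_normcD.
Qed.

Lemma has_sumZ x l c : has_sum x l -> has_sum (fun i => c * x i) (c * l).
Proof.
move=> Hx e e0; have c1 : 0 < Normc.normc c + 1 by rewrite ltr_wpDl// normc_ge0.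
have [J1 H1] := Hx _ (divr_gt0 e0 c1).
exists J1 => J J1J; rewrite -mulr_sumr -mulrBr Normc.normcM.
apply: (@le_lt_trans _ _ ((Normc.normc c + 1) * Normc.normc (l - \sum_(i <- J) x i))).
  by rewrite ler_wpM2r ?normc_ge0// lerDl.
by rewrite mulrC -ltr_pdivlMr// H1.
Qed.

Lemma ler_sum_fsubset (J K : {fset I}) (F : I -> R) :
  (forall i, 0 <= F i) -> (J `<=` K)%fset ->
  \sum_(i <- J) F i <= \sum_(i <- K) F i.
Proof.
move=> F0 JK; rewrite [leRHS](big_fsetID _ (mem J)) /=.
rewrite (_ : [fset i | i in K & i \in J]%fset = J); last first.
  apply/fsetP => i; rewrite !inE /= andbC; case: (boolP (i \in J)) => //=.
  exact: (fsubsetP JK).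
by rewrite lerDl; apply: sumr_ge0.
Qed.

Lemma abs_bounded_has_sum_ge0 (x : I -> R) M : (forall i, 0 <= x i) ->
  (forall J, \sum_(i <- J) x i <= M) -> exists l, has_sum (fun i => (x i)%:C) l.
Proof.
move=> x0 xM; pose A := [set \sum_(i <- J) x i | J in [set: {fset I}]].
have A0 : A !=set0 by exists (\sum_(i <- fset0) x i); exists fset0.
have supA : has_sup A by split => //; exists M => _ [J _ <-].
exists (sup A)%:C => e e0.
have [_ [J0 _ <-] HJ0] := sup_adherent e0 supA.
exists J0 => J J0J; rewrite -(rmorph_sum (real_complex R)) -rmorphB normcR /=.
have h1 : \sum_(i <- J) x i <= sup A by apply: sup_upper_bound => //; exists J.
have h2 : \sum_(i <- J0) x i <= \sum_(i <- J) x i.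
  exact: ler_sum_fsubset.
by rewrite ger0_norm ?subr_ge0//; lra.
Qed.

(** A bounded nonnegative family has its supremum as sum; a real family is the
    difference of [|x| + x] and [|x|]; a complex one is treated by real and
    imaginary parts. *)
Lemma abs_bounded_has_sum x M : abs_bounded x M -> exists l, has_sum x l.
Proof.
move=> xM.
have normr_le (u v : R) : `|u| <= Normc.normc (u +i* v)%C.
  rewrite /= -(sqrtr_sqr u) ler_wsqrtr// lerDl; exact: sqr_ge0.
have normi_le (u v : R) : `|v| <= Normc.normc (u +i* v)%C.
  rewrite /= -(sqrtr_sqr v) ler_wsqrtr// lerDr; exact: sqr_ge0.
have real_case (y : I -> R) : (forall i, `|y i| <= Normc.normc (x i)) ->
    exists l, has_sum (fun i => (y i)%:C) l.
  move=> yx.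
  have [l1 H1] : exists l, has_sum (fun i => (`|y i|)%:C) l.
    apply: (@abs_bounded_has_sum_ge0 _ M) => // J.
    by apply: le_trans (xM J); apply: ler_sum.
  have [l2 H2] : exists l, has_sum (fun i => (`|y i| + y i)%:C) l.
    apply: (@abs_bounded_has_sum_ge0 _ (M + M)) => [i|J].
      by rewrite -(subrr `|y i|) lerD2l lerNl; have := ler_norm (- y i); rewrite normrN.
    rewrite big_split /=; apply: lerD; apply: le_trans (xM J); apply: ler_sum => i _//.
    exact: le_trans (ler_norm _) (yx i).
  exists (l2 + (-1) * l1).
  rewrite (_ : (fun i => _) = fun i => (`|y i| + y i)%:C + (-1) * (`|y i|)%:C).
    by apply: has_sumD => //; exact: has_sumZ.
  by apply/funext => i; rewrite rmorphD /= mulN1r addrAC subrr add0r.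
have [l1 H1] : exists l, has_sum (fun i => (complex.Re (x i))%:C) l.
  by apply: real_case => i; case: (x i) => u v; exact: normr_le.
have [l2 H2] : exists l, has_sum (fun i => (complex.Im (x i))%:C) l.
  by apply: real_case => i; case: (x i) => u v; exact: normi_le.
exists (l1 + 'i%C * l2).
rewrite (_ : x = fun i => (complex.Re (x i))%:C + 'i%C * (complex.Im (x i))%:C).
  by apply: has_sumD => //; exact: has_sumZ.
by apply/funext => i; case: (x i) => u v; simpc.
Qed.

Lemma has_sum_le x l M : has_sum x l -> abs_bounded x M -> Normc.normc l <= M.
Proof.
move=> Hl xM; apply/ler_addgt0Pr => e e0; have [J HJ] := Hl _ e0.
have {}HJ := HJ _ (fsubset_refl J).
rewrite -(subrK (\sum_(i <- J) x i) l).
apply: (@le_trans _ _ (Normc.normc (l - \sum_(i <- J) x i) + Normc.normc (\sum_(i <- J) x i))).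
  exact: ler_normcD.
rewrite addrC lerD ?(ltW HJ)//.
exact: le_trans (ler_normc_sum _ _) (xM J).
Qed.

Lemma abs_bounded_le x y M : (forall i, Normc.normc (x i) <= Normc.normc (y i)) ->
  abs_bounded y M -> abs_bounded x M.
Proof. by move=> xy yM J; apply: le_trans (yM J); apply: ler_sum. Qed.

End unconditional_sums.

Section boxes.
Context {R : realType} {n : nat}.
Local Notation "x %:C" := (real_complex _ x).

Definition box_index (N : nat) (b : {ffun 'I_n -> 'I_N}) : multiindex n :=
  [ffun j => val (b j)].

Lemma box_index_inj N : injective (@box_index N).
Proof. by move=> b c /ffunP H; apply/ffunP => j; have := H j; rewrite !ffunE => /val_inj. Qed.

Definition box N : {fset multiindex n} :=
  [fset box_index b | b in {ffun 'I_n -> 'I_N}]%fset.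

Lemma in_box N (alpha : multiindex n) :
  (forall j, (alpha j < N)%N) -> alpha \in box N.
Proof.
move=> H; apply/imfsetP; exists [ffun j => Ordinal (H j)] => //.
by apply/ffunP => j; rewrite !ffunE.
Qed.

Lemma sum_box (V : nmodType) N (F : multiindex n -> V) :
  \sum_(alpha <- box N) F alpha = \sum_(b : {ffun 'I_n -> 'I_N}) F (box_index b).
Proof.
rewrite /box (perm_big _ (enum_imfset _ (fun x y _ _ => @box_index_inj N x y))) /=.
by rewrite big_map big_enum.
Qed.

Lemma fset_sub_box (J : {fset multiindex n}) : exists N, forall M, (N <= M)%N ->
  (J `<=` box M)%fset.
Proof.
exists (\max_(alpha <- J) \max_(j < n) alpha j).+1 => M NM.
apply/fsubsetP => alpha aJ; apply: in_box => j; apply: leq_trans NM; rewrite ltnS.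
apply: leq_trans (leq_bigmax_seq _ aJ _) => //.
exact: (leq_bigmax_cond (F := fun j => alpha j)).
Qed.

Lemma has_sum_box (x : multiindex n -> R[i]) l : has_sum x l ->
  forall e, 0 < e -> exists N0, forall N, (N0 <= N)%N ->
    Normc.normc (l - \sum_(b : {ffun 'I_n -> 'I_N}) x (box_index b)) < e.
Proof.
move=> H e /H[J HJ]; have [N0 HN] := fset_sub_box J.
by exists N0 => N NN; rewrite -sum_box; apply: HJ; exact: HN.
Qed.

(** A sum over a box is a product of n geometric sums. *)
Lemma geometric_multi_sum_le (q : R) (J : {fset multiindex n}) : 0 <= q < 1 ->
  \sum_(alpha <- J) \prod_(j < n) q ^+ alpha j <= (1 - q)^-1 ^+ n.
Proof.
move=> q01; have [N /(_ N (leqnn N)) JN] := fset_sub_box J.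
have q0 : 0 <= q by case/andP: q01.
apply: le_trans (ler_sum_fsubset _ JN) _ => [alpha|].
  by apply: prodr_ge0 => j _; exact: exprn_ge0.
rewrite sum_box.
under eq_bigr do under eq_bigr do rewrite ffunE.
rewrite -(bigA_distr_bigA (fun (j : 'I_n) (k : 'I_N) => q ^+ k)) /=.
rewrite prodr_const card_ord.
apply: lerXn2r; rewrite ?nnegrE.
- by apply: sumr_ge0 => k _; exact: exprn_ge0.
- by rewrite invr_ge0 subr_ge0; case/andP: q01 => _ /ltW.
rewrite -(big_mkord xpredT (fun k => q ^+ k)); exact: geometric_sum_le.
Qed.

(** Outside a finite set of indices a term is the difference of two partial sums
    at distance less than 1 from the limit. *)
Lemma has_sum_term_bound (x : multiindex n -> R[i]) l : has_sum x l ->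
  exists M, forall alpha, Normc.normc (x alpha) <= M.
Proof.
move=> H; have [J HJ] := H _ (@ltr01 R).
exists (\sum_(i <- J) Normc.normc (x i) + 2) => alpha.
have [aJ|aJ] := boolP (alpha \in J).
  rewrite (big_fsetD1 alpha)//= -addrA lerDl addr_ge0// sumr_ge0// => i _.
  exact: normc_ge0.
have h1 := HJ _ (fsubset_refl J).
have h2 := HJ _ (fsubsetU1 alpha J).
rewrite big_fsetU1//= in h2.
have -> : x alpha = (l - \sum_(i <- J) x i) + - (l - (x alpha + \sum_(i <- J) x i)).
  by ring.
apply: le_trans (ler_normcD _ _) _; rewrite (@normcN R).
have h3 : 0 <= \sum_(i <- J) Normc.normc (x i).
  by apply: sumr_ge0 => i _; exact: normc_ge0.
apply: le_trans (lerD (ltW h1) (ltW h2)) _; lra.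
Qed.

(** The point of coordinates [r j / th] still lies in the ball for some th < 1, and
    the terms of the series are bounded there; at [r] they are smaller by the
    factor [th^|alpha|], which is summable. *)
Lemma power_series_abs_bounded (a : multiindex n -> R[i]) (f : 'rV[R[i]]_n -> R[i])
    (r : 'I_n -> R) : power_series_on_ball a f -> (forall j, 0 <= r j) ->
  \sum_j r j ^+ 2 < 1 ->
  exists M, forall J : {fset multiindex n},
    \sum_(alpha <- J) Normc.normc (a alpha) * \prod_j r j ^+ alpha j <= M.
Proof.
move=> af r0 rlt1; set s := \sum_j r j ^+ 2 in rlt1.
have s0 : 0 <= s by apply: sumr_ge0 => j _; exact: sqr_ge0.
(* Any square of th between s and 1 would do. *)
pose th := Num.sqrt ((1 + s) / 2).
have th2 : th ^+ 2 = (1 + s) / 2 by rewrite sqr_sqrtr//; lra.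
have th0 : 0 < th by rewrite sqrtr_gt0; lra.
have th1 : th < 1 by rewrite -(@ltr_pXn2r _ 2) ?nnegrE ?(ltW th0)// th2 expr1n; lra.
pose z : 'rV[R[i]]_n := \row_j (r j / th)%:C.
have zball : uball z.
  rewrite /uball /= -(@ltr_pXn2r _ 2) ?nnegrE ?hnorm_ge0// expr1n sqr_hnorm.
  under eq_bigr do rewrite mxE normcR real_normK ?num_real// expr_div_n.
  rewrite -mulr_suml ltr_pdivrMr ?exprn_gt0// mul1r th2 -/s; lra.
have [M HM] := has_sum_term_bound ((has_sumP _ _).2 (af z zball)).
exists (M * (1 - th)^-1 ^+ n) => J.
have M0 : 0 <= M by apply: le_trans (HM [ffun=> 0%N]); exact: normc_ge0.
apply: le_trans (_ : \sum_(alpha <- J) M * \prod_j th ^+ alpha j <= _); last first.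
  rewrite -mulr_sumr ler_wpM2l// geometric_multi_sum_le// th1 ltW//.
apply: ler_sum => alpha _.
have -> : \prod_j r j ^+ alpha j = Normc.normc (monomial alpha z) * \prod_j th ^+ alpha j.
  rewrite /monomial normc_prod -big_split /=; apply: eq_bigr => j _.
  rewrite normcX mxE normcR ger0_norm ?divr_ge0 ?(ltW th0)//.
  by rewrite -exprMn divfK// gt_eqF.
rewrite mulrA -Normc.normcM ler_wpM2r// prodr_ge0// => j _.
by rewrite exprn_ge0// ltW.
Qed.
End boxes.

(** * Second-order expansions of monomials *)

Lemma quadratic_remainder_differentiable (K : numFieldType)
    (V W : normedModType K) (g : V -> W) (z : V) (dg : {linear V -> W}) (de M : K) :
  continuous dg -> 0 < de -> 0 <= M ->
  (forall h, `|h| <= de -> `|g (z + h) - g z - dg h| <= `|h| ^+ 2 * M) ->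
  differentiable g z.
Proof.
move=> Hc de0 M0 H.
have E : g \o shift z = cst (g z) + dg +o_ 0 id.
  apply/eqaddoP => e e0.
  have M1 : 0 < M + 1 by rewrite ltr_wpDl.
  have eM : 0 < e / (M + 1) by rewrite divr_gt0.
  near=> h.
  have h1 : `|h| <= de by near: h; exact: nbhs0_le.
  have h2 : `|h| <= e / (M + 1) by near: h; exact: nbhs0_le.
  rewrite -![(_ + _ : _ -> _) _]/(_ + _) -![(- _ : _ -> _) _]/(- _).
  rewrite /= opprD addrA [h + z]addrC; apply: le_trans (H h h1) _.
  rewrite expr2 -mulrA [leRHS]mulrC ler_wpM2l//.
  apply: le_trans (_ : `|h| * (M + 1) <= _); first by rewrite ler_wpM2l// lerDl.
  by rewrite -ler_pdivlMr.
apply/diff_locallyP.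
by rewrite (diff_unique Hc E).
Unshelve. all: by end_near. Qed.

Section differentiability.
Context {K : numFieldType} {n : nat}.

Definition gradient_form (c : 'I_n -> K) (h : 'rV[K]_n) : K^o :=
  \sum_j c j * h 0 j.

Lemma gradient_form_is_linear c : linear (gradient_form c).
Proof.
move=> k u v; rewrite /gradient_form scaler_sumr -big_split /=.
by apply: eq_bigr => j _; rewrite !mxE mulrDr [k *: _]mulrCA.
Qed.
HB.instance Definition _ c :=
  GRing.isLinear.Build _ _ _ _ (gradient_form c) (gradient_form_is_linear c).

Lemma continuous_gradient_form c : continuous (gradient_form c).
Proof.
apply: (@continuous_big K^o _ _ _ _ _ _ _ (fun j (h : 'rV[K]_n) => c j * h 0 j)) => [|j _ h].
  exact: add_continuous.
exact: (cvgM (cvg_cst _) (@coord_continuous _ _ _ 0 j h)).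
Qed.

Lemma normr_coord_le (h : 'rV[K]_n) j : `|h 0 j| <= `|h|.
Proof.
rewrite [leRHS](mx_normE h) -[leLHS]nngE num_le.
exact: (le_bigmax _ (fun i : 'I_1 * 'I_n => `|h i.1 i.2|%:nng) (0, j)).
Qed.

End differentiability.

Section monomial_expansion.
Context {R : realType} {n : nat}.
Implicit Types (phi : 'rV[R[i]]_n -> R[i]) (z h : 'rV[R[i]]_n) (c : 'I_n -> R[i]).

(** An expansion of order 1 of [phi] at [z] on the polydisc of radius [de], with a
    single constant M for the value, the linear part and the remainder.  The
    parameter [t] records that the linear part and the remainder are of
    orders 1 and 2 in the size of [h]. *)
Definition expansion phi z c (de M : R) := Normc.normc (phi z) <= M /\
  forall (t : R) h, 0 <= t <= 1 -> (forall j, Normc.normc (h 0 j) <= t * de) ->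
    Normc.normc (gradient_form c h) <= t * M /\
    Normc.normc (phi (z + h) - phi z - gradient_form c h) <= t ^+ 2 * M.

Lemma gradient_form_coord (j0 : 'I_n) (x : R[i]) h :
  gradient_form (fun j => if j == j0 then x else 0) h = x * h 0 j0.
Proof.
rewrite /gradient_form (bigD1 j0)//= eqxx big1 ?addr0// => j /negPf ->.
by rewrite mul0r.
Qed.

(** The product rule; [2 de] absorbs both the increment of the coordinate in the
    remainder of [phi] and the product of the two linear parts. *)
Lemma expansion_mul_coord phi z c de M (j0 : 'I_n) : 0 <= de ->
  expansion phi z c de M ->
  expansion (fun w => phi w * w 0 j0) z
    (fun j => z 0 j0 * c j + (if j == j0 then phi z else 0)) de
    (M * (Normc.normc (z 0 j0) + 2 * de)).
Proof.
move=> de0 [phiM H].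
have M0 : 0 <= M := le_trans (normc_ge0 _) phiM.
have zj0 := normc_ge0 (z 0 j0).
split; first by rewrite Normc.normcM ler_pM ?normc_ge0// lerDl mulr_ge0.
move=> t h /[dup] t01 /andP[t0 t1] ht; have [HL HR] := H t h t01 ht.
have gE : gradient_form (fun j => z 0 j0 * c j + (if j == j0 then phi z else 0)) h =
    z 0 j0 * gradient_form c h + phi z * h 0 j0.
  rewrite -gradient_form_coord /gradient_form mulr_sumr -big_split /=.
  by apply: eq_bigr => j _; rewrite mulrDl mulrA.
rewrite gE; split.
  apply: le_trans (ler_normcD _ _) _; rewrite !Normc.normcM.
  apply: le_trans (_ : Normc.normc (z 0 j0) * (t * M) + M * (t * de) <= _).
    by apply: lerD; [exact: ler_wpM2l|apply: ler_pM; rewrite ?normc_ge0].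
  have : 0 <= t * M * de by rewrite !mulr_ge0.
  by move: (Normc.normc (z 0 j0)) => x; lra.
have -> : phi (z + h) * (z + h) 0 j0 - phi z * z 0 j0 -
    (z 0 j0 * gradient_form c h + phi z * h 0 j0) =
    (phi (z + h) - phi z - gradient_form c h) * (z 0 j0 + h 0 j0) +
    gradient_form c h * h 0 j0 by rewrite mxE; ring.
apply: le_trans (ler_normcD _ _) _; rewrite !Normc.normcM.
apply: le_trans (_ : t ^+ 2 * M * (Normc.normc (z 0 j0) + de) + t * M * (t * de) <= _).
  apply: lerD; apply: ler_pM; rewrite ?normc_ge0//.
  apply: le_trans (ler_normcD _ _) _; rewrite lerD2l.
  by apply: le_trans (ht j0) _; rewrite ler_piMl.
by rewrite le_eqVlt; apply/orP; left; apply/eqP; ring.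
Qed.

(** The constant is the value of the monomial at a point whose coordinates exceed
    those of z by [2 de]; this is what makes the expansions of all
    monomials summable. *)
Lemma expansion_monomial z de (alpha : multiindex n) : 0 <= de ->
  exists c, expansion (monomial alpha) z c de
    (\prod_j (Normc.normc (z 0 j) + 2 * de) ^+ alpha j).
Proof.
move=> de0; rewrite /monomial.
elim: (index_enum 'I_n) => [|j0 s [c Hc]].
  exists (fun=> 0); split; first by rewrite !big_nil Normc.normc1.
  move=> t h /andP[t0 t1] _.
  have -> : gradient_form (fun=> 0) h = 0 by rewrite /gradient_form big1// => j _; rewrite mul0r.
  by rewrite !big_nil subrr subr0 Normc.normc0 !mulr1 sqr_ge0.
rewrite big_cons.
suff [c' Hc'] : exists c, expansion (fun w => w 0 j0 ^+ alpha j0 * \prod_(i <- s) w 0 i ^+ alpha i)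
    z c de ((Normc.normc (z 0 j0) + 2 * de) ^+ alpha j0 *
            \prod_(j <- s) (Normc.normc (z 0 j) + 2 * de) ^+ alpha j).
  exists c'; congr (expansion _ _ _ _ _): Hc'.
  by apply/funext => w; rewrite big_cons.
elim: (alpha j0) => [|k [c' Hc']].
  exists c; rewrite mul1r; congr (expansion _ _ _ _ _): Hc.
  by apply/funext => w; rewrite mul1r.
exists (fun j => z 0 j0 * c' j +
  (if j == j0 then z 0 j0 ^+ k * \prod_(i <- s) z 0 i ^+ alpha i else 0)).
move: (expansion_mul_coord j0 de0 Hc'); congr (expansion _ _ _ _ _).
  by apply/funext => w; rewrite exprS mulrC mulrA.
by rewrite exprS mulrC mulrA.
Qed.

End monomial_expansion.

(** * Holomorphy of power series with dominated coefficients *)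

Section dominated_series.
Context {R : realType} {n : nat}.
Local Notation "x %:C" := (real_complex _ x).
Variables (a : multiindex n -> R[i]) (f : 'rV[R[i]]_n -> R[i]).
Hypothesis af : power_series_on_ball a f.
Variable b : multiindex n -> R[i].
Hypothesis ba : forall alpha, Normc.normc (b alpha) <= Normc.normc (a alpha).

Definition series_value (w : 'rV[R[i]]_n) : R[i] :=
  summability.sum (fun alpha => b alpha * monomial alpha w : R[i]^o).

Lemma dominated_abs_bounded (r : 'I_n -> R) : (forall j, 0 <= r j) ->
  \sum_j r j ^+ 2 < 1 -> exists M, 0 <= M /\
  forall (x : multiindex n -> R[i]) (k : R), 0 <= k ->
  (forall alpha, Normc.normc (x alpha) <= k * \prod_j r j ^+ alpha j) ->
  abs_bounded (fun alpha => b alpha * x alpha) (k * M).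
Proof.
move=> r0 rlt1; have [M HM] := power_series_abs_bounded af r0 rlt1.
exists M; split; first by have := HM fset0; rewrite big_seq_fset0.
move=> x k k0 xr J; apply: le_trans (ler_wpM2l k0 (HM J)).
rewrite mulr_sumr; apply: ler_sum => alpha _.
by rewrite Normc.normcM mulrCA ler_pM ?normc_ge0.
Qed.

Lemma normc_monomial_le (r : 'I_n -> R) alpha (w : 'rV[R[i]]_n) :
  (forall j, Normc.normc (w 0 j) <= r j) ->
  Normc.normc (monomial alpha w) <= \prod_j r j ^+ alpha j.
Proof.
move=> wr; rewrite /monomial normc_prod; apply: ler_prod => j _.
rewrite normcX exprn_ge0 ?normc_ge0//=; apply: lerXn2r; rewrite ?nnegrE ?normc_ge0//.
exact: le_trans (normc_ge0 _) (wr j).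
Qed.

Lemma has_sum_series_value (w : 'rV[R[i]]_n) (r : 'I_n -> R) :
  (forall j, Normc.normc (w 0 j) <= r j) -> \sum_j r j ^+ 2 < 1 ->
  has_sum (fun alpha => b alpha * monomial alpha w) (series_value w).
Proof.
move=> wr rlt1; have r0 j : 0 <= r j := le_trans (normc_ge0 _) (wr j).
have [M [_ HM]] := dominated_abs_bounded r0 rlt1.
have [|l Hl] := abs_bounded_has_sum (HM (monomial^~ w) 1 ler01 _).
  by move=> alpha; rewrite mul1r; exact: normc_monomial_le.
by rewrite /series_value (sum_has_sum Hl).
Qed.

(** With s the square norm of z, the sum is at most [s + 8 n de]. *)
Lemma uball_radius (z : 'rV[R[i]]_n) : uball z ->
  exists2 de : R, 0 < de & \sum_j (Normc.normc (z 0 j) + 2 * de) ^+ 2 < 1.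
Proof.
move=> zB; have z1 : hnorm z ^+ 2 < 1 by rewrite expr_lt1 ?hnorm_ge0.
have s0 := sqr_ge0 (hnorm z); set s := hnorm z ^+ 2 in z1 s0.
have n0 : (0 : R) <= n%:R by [].
have n8 : (0 : R) < 8 * n%:R + 8 by lra.
exists ((1 - s) / (8 * n%:R + 8)); first by rewrite divr_gt0// subr_gt0.
set de := _ / _.
have de0 : 0 < de by rewrite divr_gt0// subr_gt0.
have deE : de * (8 * n%:R + 8) = 1 - s by rewrite divfK// gt_eqF.
have de1 : de <= 1 by nra.
apply: (@le_lt_trans _ _ (s + 8 * de * n%:R)); last by lra.
have -> : n%:R = \sum_(j < n) 1 :> R by rewrite sumr_const card_ord.
rewrite /s sqr_hnorm mulr_sumr -big_split /=.
rewrite ler_sum// => j _; rewrite mulr1.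
have := ltW (le_lt_trans (normc_le_hnorm z j) zB).
by have := normc_ge0 (z 0 j); move: (Normc.normc _) => x; nra.
Qed.

Lemma has_sum_gradient (c : multiindex n -> 'I_n -> R[i]) (C : 'I_n -> R[i]) h :
  (forall j, has_sum (fun alpha => b alpha * c alpha j) (C j)) ->
  has_sum (fun alpha => b alpha * gradient_form (c alpha) h) (gradient_form C h).
Proof.
move=> H; rewrite /gradient_form.
rewrite (_ : (fun _ => _) = fun alpha => \sum_j h 0 j * (b alpha * c alpha j)); last first.
  apply/funext => alpha; rewrite mulr_sumr; apply: eq_bigr => j _.
  by rewrite mulrA mulrC.
have -> : \sum_j C j * h 0 j = \sum_j h 0 j * C j :> R[i].
  by apply: eq_bigr => j _; rewrite mulrC.
elim: (index_enum 'I_n) => [|j s IH].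
  move=> e e0; exists fset0 => J _; rewrite big_nil big1 => [|i _]; last by rewrite big_nil.
  by rewrite subrr Normc.normc0.
rewrite big_cons; under eq_fun do rewrite big_cons.
by apply: has_sumD => //; exact: has_sumZ.
Qed.

(** The expansions of the monomials at z are summed term by term; the gradient
    and the remainder inherit the bounds of the terms. *)
Lemma holomorphic_series_value : holomorphic_ball series_value.
Proof.
move=> z /uball_radius[de de0 rlt1].
set r := fun j => Normc.normc ((z : 'rV[R[i]]_n) 0 j) + 2 * de.
have de2 : 0 <= 2 * de by rewrite mulr_ge0// ltW.
have r0 j : 0 <= r j by rewrite addr_ge0 ?normc_ge0.
have [M [M0 HM]] := dominated_abs_bounded r0 rlt1.
have [c Hc] := choice (fun alpha => expansion_monomial z alpha (ltW de0)).
have Hz : has_sum (fun alpha => b alpha * monomial alpha z) (series_value z).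
  by apply: (has_sum_series_value _ rlt1) => j; rewrite lerDl.
have HC j : exists l, has_sum (fun alpha => b alpha * c alpha j) l.
  apply: (@abs_bounded_has_sum _ _ _ (de^-1 * (1 * M))) => J.
  have Hj : abs_bounded (fun alpha => b alpha * (de%:C * c alpha j)) (1 * M).
    apply: HM => // alpha; rewrite mul1r; have [_ H] := Hc alpha.
    have [|i|+ _] := H 1 (\row_i (if i == j then de%:C else 0)).
    - by rewrite ler01 lexx.
    - rewrite mxE mul1r; case: ifP => _; last by rewrite Normc.normc0 ltW.
      by rewrite normcR gtr0_norm.
    rewrite mul1r; congr (Normc.normc _ <= _).
    rewrite /gradient_form (bigD1 j)//= big1 => [|i /negPf ij]; last by rewrite mxE ij mulr0.
    by rewrite mxE eqxx addr0 mulrC.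
  rewrite ler_pdivlMl// -[leLHS]/(de * _) mulr_sumr; apply: le_trans (Hj J).
  apply: ler_sum => alpha _.
  by rewrite -{1}(gtr0_norm de0) -normcR -Normc.normcM mulrCA.
have [C {}HC] := choice HC.
apply: (@quadratic_remainder_differentiable _ _ _ _ _ (gradient_form C) de%:C (M / de ^+ 2)%:C).
- exact: continuous_gradient_form.
- by rewrite ltcR.
- by rewrite lecR divr_ge0// sqr_ge0.
move=> h; set x := complex.Re `|h|.
have hx : `|h| = x%:C by rewrite /x RRe_real ?normr_real.
rewrite hx => hde.
have xde : x <= de by rewrite -lecR.
have x0 : 0 <= x by rewrite -lecR -hx; exact: normr_ge0.
have hj j : Normc.normc (h 0 j) <= x.
  by rewrite -lecR -hx; exact: (normr_coord_le h j).
pose t := x / de.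
have t01 : 0 <= t <= 1 by rewrite divr_ge0 ?(ltW de0)//= ler_pdivrMr// mul1r.
have ht j : Normc.normc (h 0 j) <= t * de by rewrite divfK ?gt_eqF.
have Hw : has_sum (fun alpha => b alpha * monomial alpha (z + h)) (series_value (z + h)).
  apply: (has_sum_series_value _ rlt1) => j; rewrite mxE.
  apply: le_trans (ler_normcD _ _) _; rewrite lerD2l.
  by apply: le_trans (hj j) _; apply: le_trans xde _; rewrite ler_peMl ?(ltW de0)// ler1n.
have HR := has_sumD (has_sumD Hw (has_sumZ (-1) Hz)) (has_sumZ (-1) (has_sum_gradient h HC)).
have : Normc.normc (series_value (z + h) + -1 * series_value z + -1 * gradient_form C h)
    <= t ^+ 2 * M.
  apply: (has_sum_le HR).
  suff H : abs_bounded (fun alpha => b alpha * (monomial alpha (z + h) - monomial alpha z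
      - gradient_form (c alpha) h)) (t ^+ 2 * M).
    by apply: abs_bounded_le H => alpha; rewrite !mulN1r -!mulrBr.
  apply: HM => [|alpha]; first exact: sqr_ge0.
  by have [_ H] := Hc alpha; have [_] := H t h t01 ht.
have -> : x%:C ^+ 2 * (M / de ^+ 2)%:C = (t ^+ 2 * M)%:C.
  by rewrite -rmorphXn -rmorphM /t; congr (_%:C); field; rewrite gt_eqF.
by rewrite !mulN1r -lecR.
Qed.

End dominated_series.

(** * Convergence and exponents *)

Lemma cvg_powR (R : realType) (u : nat -> R) (l k : R) : 0 < k ->
  (forall N, 0 <= u N) -> u @ \oo --> l -> (fun N => u N `^ k) @ \oo --> l `^ k.
Proof.
move=> k0 u0 ul.
have l0 : 0 <= l.
  have <- : lim (u @ \oo) = l by exact: cvg_lim.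
  by apply: limr_ge; [apply/cvg_ex; exists l|exact: nearW].
have kV (x : R) : 0 <= x -> (x `^ k^-1) `^ k = x.
  by move=> x0; rewrite -powRrM mulVf ?gt_eqF// powRr1.
have lE : l = (l `^ k) `^ k^-1 by rewrite -powRrM mulfV ?gt_eqF// powRr1.
apply/cvgrPdist_le => e e0.
have up0 : 0 <= l `^ k + e by rewrite addr_ge0 ?powR_ge0// ltW.
have low : \forall N \near \oo, l `^ k - e <= u N `^ k.
  have [le0|le0] := leP (l `^ k - e) 0.
    by apply: nearW => N; exact: le_trans le0 (powR_ge0 _ _).
  near=> N; rewrite -[leLHS]kV ?(ltW le0)//.
  apply: ge0_ler_powR; rewrite ?nnegrE ?powR_ge0 ?(ltW k0)//.
  apply: ltW; near: N; apply: (cvgr_gt l ul).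
  rewrite [ltRHS]lE; apply: gt0_ltr_powR.
  - by rewrite invr_gt0.
  - by rewrite nnegrE ltW.
  - by rewrite nnegrE powR_ge0.
  - by rewrite gtrBl.
near=> N; rewrite ler_distlC; apply/andP; split; first by near: N.
rewrite -[leRHS]kV//; apply: ge0_ler_powR; rewrite ?nnegrE ?powR_ge0 ?(ltW k0)//.
apply: ltW; near: N; apply: (cvgr_lt l ul).
rewrite [ltLHS]lE; apply: gt0_ltr_powR.
- by rewrite invr_gt0.
- by rewrite nnegrE powR_ge0.
- by rewrite nnegrE.
- by rewrite ltrDl.
Unshelve. all: by end_near. Qed.

(** Young's inequality for [A^p X^q] and [Y^(n s)] with the exponents
    [t = (n + rho) / q] and [t' = (n + rho) / (n + rho - q)], the power n + 1 of X
    being divided out. *)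
Lemma young_weight (R : realType) (n : nat) (p q s rho A X Y : R) :
  0 < q -> q < n%:R + rho -> 0 <= A -> 0 < X -> 0 <= Y ->
  A `^ p * X `^ q * Y `^ (n%:R * s) / X ^+ n.+1 <=
  A `^ (p * (n%:R + rho) / q) * X `^ (rho - 1) +
  Y `^ (n%:R * s * ((n%:R + rho) / (n%:R + rho - q))) / X ^+ n.+1.
Proof.
move=> q0 qnr A0 X0 Y0; set nr := n%:R + rho in qnr *.
have nr0 : 0 < nr by exact: lt_trans qnr.
have d0 : 0 < nr - q by rewrite subr_gt0.
have t1 : 1 <= nr / q by rewrite ler_pdivlMr// mul1r ltW.
have t1' : 1 <= nr / (nr - q) by rewrite ler_pdivlMr// mul1r gerBl ltW.
have tt' : (nr / q)^-1 + (nr / (nr - q))^-1 = 1.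
  by rewrite !invf_div -mulrDl addrCA subrr addr0 divff// gt_eqF.
have XE : X `^ nr / X ^+ n.+1 = X `^ (rho - 1).
  rewrite -powR_mulrn ?(ltW X0)// -powRN -powRD ?(gt_eqF X0) ?implybT//.
  by congr (_ `^ _); rewrite /nr -natr1; ring.
have h := conjugate_powR (mulr_ge0 (powR_ge0 A p) (powR_ge0 X q)) (powR_ge0 Y (n%:R * s))
  (lt_le_trans ltr01 t1) (lt_le_trans ltr01 t1') tt'.
rewrite powRM ?powR_ge0// -!powRrM in h.
rewrite (_ : q * (nr / q) = nr) in h; last by field; rewrite gt_eqF.
rewrite -XE [A `^ _ * (_ / _)]mulrA -mulrDl -(mulrA p nr) ler_wpM2r//.
  by rewrite invr_ge0 exprn_ge0// ltW.
apply: le_trans h _; apply: lerD.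
  by rewrite ler_piMr ?mulr_ge0 ?powR_ge0// invf_le1// (lt_le_trans ltr01).
by rewrite ler_piMr ?powR_ge0// invf_le1// (lt_le_trans ltr01).
Qed.

(** The second conclusion amounts to [rho (1 - s) < q + n s - n]: this is the upper
    bound on rho if s < 1, and holds for every positive rho if s >= 1. *)
Lemma exponent_conditions (R : realType) (n : nat) (q s rho : R) :
  (0 < n)%N -> 0 < q -> Num.max 0 (1 - q / n%:R) < s -> 0 < rho ->
  (0 < s < 1 ->
    Num.max 0 (q - n%:R) < rho < (q + n%:R * s - n%:R) / (1 - s)) ->
  (1 <= s -> Num.max 0 (q - n%:R) < rho) ->
  q < n%:R + rho /\ n%:R < n%:R * s * ((n%:R + rho) / (n%:R + rho - q)).
Proof.
move=> n0 q0; rewrite gt_max => /andP[s0 _] rho0 H1 H2.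
have n0' : (0 : R) < n%:R by rewrite ltr0n.
have : q - n%:R < rho /\ rho * (1 - s) < q + n%:R * s - n%:R.
  have [s1|s1] := ltP s 1.
    have := H1; rewrite s0 s1 => /(_ isT)/andP[]; rewrite gt_max => /andP[_ ->].
    by rewrite ltr_pdivlMr// subr_gt0.
  by have := H2 s1; rewrite gt_max => /andP[_ ->]; split => //; nra.
move=> [h1 h2]; split; first by lra.
have d0 : 0 < n%:R + rho - q by lra.
rewrite mulrA ltr_pdivlMr// -mulrA ltr_pM2l//; lra.
Qed.

(** * Partial sums over boxes *)

Section box_sums.
Context {R : realType} {n : nat}.
Local Notation "x %:C" := (real_complex _ x).
Local Notation T := (n.-tuple (plane R)).
Local Notation ball := (cvec @^-1` uball : set T).

Definition box_sum (b : multiindex n -> R[i]) N (z : 'rV[R[i]]_n) : R[i] :=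
  \sum_(i : {ffun 'I_n -> 'I_N}) b (box_index i) * monomial (box_index i) z.

Lemma cmeasurable_box_sum b N : cmeasurable (fun t : T => box_sum b N (cvec t)).
Proof.
apply: cmeasurable_sum => i; apply: cmeasurableM; first exact: cmeasurable_cst.
exact: cmeasurable_monomial.
Qed.

Lemma in_ell_box_le (r : R) (x : multiindex n -> R) : (forall i, 0 <= x i) ->
  in_ell r x -> exists2 S, 0 <= S &
  forall N, \sum_(i : {ffun 'I_n -> 'I_N}) x (box_index i) `^ r <= S.
Proof.
move=> x0; rewrite /in_ell => H.
have h0 : (0 <= \esum_(i in [set: multiindex n]) (`|x i| `^ r)%:E)%E.
  by apply: esum_ge0 => i _; rewrite lee_fin powR_ge0.
exists (fine (\esum_(i in [set: multiindex n]) (`|x i| `^ r)%:E)); first exact: fine_ge0.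
move=> N; rewrite -lee_fin fineK ?ge0_fin_numE//.
apply: esum_ge; exists [set` box N]; first by split => //; exact: finite_fset.
rewrite -fsbig_seq ?fset_uniq// sumEFin -(sum_box N (fun al => x al `^ r)) lee_fin.
by apply: ler_sum => i _; rewrite ger0_norm.
Qed.

Section dominated.
Variables (a : multiindex n -> R[i]) (f : 'rV[R[i]]_n -> R[i]).
Hypothesis af : power_series_on_ball a f.
Variable b : multiindex n -> R[i].
Hypothesis ba : forall alpha, Normc.normc (b alpha) <= Normc.normc (a alpha).

Lemma cvg_normc_box_sum z : uball z ->
  (fun N => Normc.normc (box_sum b N z)) @ \oo --> Normc.normc (series_value b z).
Proof.
move=> zB; have [de de0 rlt1] := uball_radius zB.
have H : has_sum (fun alpha => b alpha * monomial alpha z) (series_value b z).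
  by apply: (has_sum_series_value af ba _ rlt1) => j; rewrite lerDl mulr_ge0// ltW.
apply/cvgrPdist_lt => e /(has_sum_box H)[N0 HN0]; exists N0 => // N /= NN.
apply: le_lt_trans (HN0 N NN).
have tri (u v : R[i]) : Normc.normc u <= Normc.normc v + Normc.normc (u - v).
  by rewrite -[X in Normc.normc X <= _](subrKC v); exact: ler_normcD.
rewrite ler_norml lerNl opprB !lerBlDl tri andbT.
by rewrite -(@normcN R (series_value b z - _)) opprB; exact: tri.
Qed.

Lemma measurable_normc_series_value :
  measurable_fun ball (fun t : T => Normc.normc (series_value b (cvec t))).
Proof.
apply: (measurable_fun_cvg (h := fun N t => Normc.normc (box_sum b N (cvec t)))).
  by move=> N; apply: measurable_funTS; apply: measurable_normc; exact: cmeasurable_box_sum.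
by move=> t /= tB; exact: cvg_normc_box_sum.
Qed.

End dominated.

Lemma measurable_weight (r : R) :
  measurable_fun setT (fun t : T => (1 - hnorm (cvec t) ^+ 2) `^ r).
Proof.
apply: (measurableT_comp (measurable_powR _)).
by apply: measurable_funB => //; exact: measurable_sqr_hnorm.
Qed.

(** The average over the signs is taken inside the integral, where Khinchine's
    inequality produces the square function. *)
Lemma signed_average_integral_le (a : multiindex n -> R[i]) (k rho : R) :
  (0 < n)%N -> 0 < k -> 0 < rho ->
  in_ell (Num.min 2 k) (fun alpha => Normc.normc (a alpha) * sphere_moment alpha k) ->
  exists K : R, forall N,
  ((2^-1 ^+ #|{ffun 'I_n -> 'I_N}|)%:E *
   \sum_(s : {ffun {ffun 'I_n -> 'I_N} -> bool})
     \int[@ball_volume R n]_(t in ball)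
       (Normc.normc (\sum_i (signed (s i))%:C *
          (a (box_index i) * monomial (box_index i) (cvec t))) `^ k *
        (1 - hnorm (cvec t) ^+ 2) `^ (rho - 1))%:E <= K%:E)%E.
Proof.
move=> n0 k0 rho0 /in_ell_box_le[alpha|S S0 HS].
  by rewrite mulr_ge0 ?normc_ge0 ?powR_ge0.
have [C C0 HC] := khinchine k0.
have [K K0 HK] := square_function_integral n0 k0 rho0 S0.
exists (C * K) => N.
have mB := @measurable_uball R n.
have mI (s : {ffun {ffun 'I_n -> 'I_N} -> bool}) : measurable_fun ball (fun t : T =>
    (Normc.normc (\sum_i (signed (s i))%:C *
          (a (box_index i) * monomial (box_index i) (cvec t))) `^ k *
        (1 - hnorm (cvec t) ^+ 2) `^ (rho - 1))%:E).
  apply: measurable_funTS; apply/measurable_EFinP; apply: measurable_funM.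
    apply: (measurableT_comp (measurable_powR _)); apply: measurable_normc.
    apply: cmeasurable_sum => i; apply: cmeasurableM; first exact: cmeasurable_cst.
    by apply: cmeasurableM; [exact: cmeasurable_cst|exact: cmeasurable_monomial].
  exact: measurable_weight.
have I0 (s : {ffun {ffun 'I_n -> 'I_N} -> bool}) (t : T) : (0 <=
    (Normc.normc (\sum_i (signed (s i))%:C *
          (a (box_index i) * monomial (box_index i) (cvec t))) `^ k *
        (1 - hnorm (cvec t) ^+ 2) `^ (rho - 1))%:E)%E.
  by rewrite lee_fin mulr_ge0 ?powR_ge0.
rewrite -ge0_integral_sum//.
rewrite -ge0_integralZl//; last 2 first.
- exact: emeasurable_sum.
- by move=> t _; apply: sume_ge0 => s _; exact: I0.
have HKN := HK _ (@box_index n N) (fun i => a (box_index i)) (HS N).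
have mQ : measurable_fun ball (fun t : T => ((\sum_i
    Normc.normc (a (@box_index n N i) * monomial (box_index i) (cvec t)) ^+ 2) `^ (k / 2) *
    (1 - hnorm (cvec t) ^+ 2) `^ (rho - 1))%:E).
  apply: measurable_funTS; apply/measurable_EFinP; apply: measurable_funM.
    apply: (measurableT_comp (measurable_powR _)); apply: measurable_sum => i.
    apply: measurable_funX; apply: measurable_normc.
    by apply: cmeasurableM; [exact: cmeasurable_cst|exact: cmeasurable_monomial].
  exact: measurable_weight.
rewrite EFinM; apply: le_trans (lee_wpmul2l _ HKN); last by rewrite lee_fin.
rewrite -ge0_integralZl//; last first.
  by move=> t _; rewrite lee_fin mulr_ge0 ?powR_ge0.
apply: ge0_le_integral => //.
- move=> t _; apply: mule_ge0; first by rewrite lee_fin exprn_ge0// invr_ge0.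
  by apply: sume_ge0 => s _; exact: I0.
- apply: emeasurable_funM => //; exact: emeasurable_sum.
- exact: emeasurable_funM.
move=> t _; rewrite sumEFin -EFinM -EFinM lee_fin -mulr_suml mulrA mulrA.
by rewrite ler_wpM2r ?powR_ge0.
Qed.

End box_sums.

(** * Random power series *)

Section random_series.
Context {d : measure_display} {Omega : measurableType d} {R : realType} {n : nat}.
Variables (P : probability Omega R) (eps : multiindex n -> {RV P >-> R}).
Hypothesis Beps : bernoulli_sequence eps.
Variables (a : multiindex n -> R[i]) (f : 'rV[R[i]]_n -> R[i]).
Hypothesis af : power_series_on_ball a f.
Local Notation "x %:C" := (real_complex _ x).
Local Notation T := (n.-tuple (plane R)).
Local Notation ball := (cvec @^-1` uball : set T).

Definition signs_at (w : Omega) := forall alpha, eps alpha w = signed (eps alpha w == 1).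

(** A countable intersection of almost sure events, along an enumeration of the
    multi-indices. *)
Lemma ae_signs_at : {ae P, forall w, signs_at w}.
Proof.
have H m : {ae P, forall w, if @choice.unpickle (multiindex n) m is Some alpha
    then eps alpha w = signed (eps alpha w == 1) else True}.
  case: (choice.unpickle m) => [alpha|]; first exact: ae_signed.
  exact: aeW.
move: (ae_foralln H); apply: filterS => w Hw alpha.
by have := Hw (choice.pickle alpha); rewrite choice.pickleK.
Qed.

Definition random_coef (w : Omega) (alpha : multiindex n) : R[i] :=
  (eps alpha w)%:C * a alpha.

Lemma normc_random_coef w alpha : signs_at w ->
  Normc.normc (random_coef w alpha) <= Normc.normc (a alpha).
Proof.
move=> /(_ alpha) e; rewrite /random_coef {}e Normc.normcM normcR /signed.
by case: ifP => _; rewrite ?normrN normr1 mul1r.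
Qed.

(** The integrals of the partial sums have bounded mean, so their limit inferior is
    almost surely finite; by Fatou's lemma in z it dominates the integral of
    the sum. *)
Lemma ae_randomization_integral_lty (k rho : R) : (0 < n)%N -> 0 < k -> 0 < rho ->
  in_ell (Num.min 2 k) (fun alpha => Normc.normc (a alpha) * sphere_moment alpha k) ->
  {ae P, forall w, (\int[@ball_volume R n]_(t in ball)
    (Normc.normc (randomization eps a w (cvec t)) `^ k *
     (1 - hnorm (cvec t) ^+ 2) `^ (rho - 1))%:E < +oo)%E}.
Proof.
move=> n0 k0 rho0 aell.
have [K HK] := signed_average_integral_le n0 k0 rho0 aell.
have mB := @measurable_uball R n.
pose X (t : T) := (1 - hnorm (cvec t) ^+ 2) `^ (rho - 1).
pose G N (s : {ffun {ffun 'I_n -> 'I_N} -> bool}) : \bar R :=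
  (\int[@ball_volume R n]_(t in ball)
       (Normc.normc (\sum_i (signed (s i))%:C *
          (a (box_index i) * monomial (box_index i) (cvec t))) `^ k * X t)%:E)%E.
have G0 N s : (0 <= G N s)%E.
  by apply: integral_ge0 => t _; rewrite lee_fin mulr_ge0 ?powR_ge0.
have EG N := expectation_sign_pattern Beps (@box_index_inj n N) (G0 N).
have H : {ae P, forall w,
    (limn_einf (fun N => G N (sign_pattern eps (@box_index n N) w)) < +oo)%E}.
  apply: (@ae_limn_einf_lty _ _ _ _ _ K) => [N|N w|N]; first exact: (EG N).1.
    exact: G0.
  by rewrite (EG N).2; exact: HK.
move: H; apply: filter_app.
move: ae_signs_at; apply: filterS => w sw; apply: le_lt_trans.
have wa alpha := normc_random_coef alpha sw.
(* Off the negligible set the sign pattern gives back the variables. *)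
have GE N : G N (sign_pattern eps (@box_index n N) w) =
    (\int[@ball_volume R n]_(t in ball)
       (Normc.normc (box_sum (random_coef w) N (cvec t)) `^ k * X t)%:E)%E.
  apply: eq_integral => t _; congr ((Normc.normc _ `^ k * _)%:E).
  by apply: eq_bigr => i _; rewrite ffunE -sw mulrA.
under [in leRHS]eq_fun do rewrite GE.
apply: le_trans (fatou _ _ _ _) => //.
- rewrite le_eqVlt; apply/orP; left; apply/eqP.
  apply: eq_integral => t; rewrite inE => tB; apply/esym.
  apply: (cvg_limn_einf_sup _).1; apply: cvg_EFin; first exact: nearW.
  apply: cvgMl; apply: cvg_powR => //; first by move=> N; exact: normc_ge0.
  exact: (cvg_normc_box_sum af wa tB).
- move=> N; apply: measurable_funTS; apply/measurable_EFinP; apply: measurable_funM.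
    apply: (measurableT_comp (measurable_powR _)); apply: measurable_normc.
    exact: cmeasurable_box_sum.
  exact: measurable_weight.
- by move=> N t _; rewrite lee_fin mulr_ge0 ?powR_ge0.
Qed.

End random_series.

(** * Membership in N(p,q,s) *)

(** The integral of [young_weight] over the ball: of the two terms on the right only
    the second involves [a]. *)
Lemma Npqs_integral_bounded (R : realType) (m : nat) (p q s rho : R)
    (g : 'rV[R[i]]_m.+1 -> R[i]) :
  let n := m.+1%:R in
  0 < q -> q < n + rho -> n < n * s * ((n + rho) / (n + rho - q)) ->
  measurable_fun (cvec @^-1` uball : set (m.+1.-tuple (plane R)))
    (fun t => Normc.normc (g (cvec t))) ->
  (\int[@ball_volume R m.+1]_(t in cvec @^-1` uball)
    (Normc.normc (g (cvec t)) `^ (p * (n + rho) / q) *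
     (1 - hnorm (cvec t) ^+ 2) `^ (rho - 1))%:E < +oo)%E ->
  (ereal_sup [set Npqs_integral p q s g a | a in uball] < +oo)%E.
Proof.
move=> n q0 qn taun mg gI.
have mB := @measurable_uball R m.+1.
have [K HK] := Phi_integral_bounded taun.
set I := (\int[_]_(t in _) _)%E in gI.
apply: (@le_lt_trans _ _ (I + K%:E)%E); last by rewrite lte_add_pinfty// ltry.
apply: ge_ereal_sup => _ [a ua <-].
apply: le_trans (leeD (le_refl I) (HK a ua)).
have mPhi (r : R) : measurable_fun (cvec @^-1` uball : set (m.+1.-tuple (plane R)))
    (fun t => (1 - hnorm (Phi a (cvec t)) ^+ 2) `^ r).
  apply: (measurableT_comp (measurable_powR _)).
  apply: (@eq_measurable_fun _ _ _ _ _ (fun t => (1 - hnorm a ^+ 2) *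
      (1 - hnorm (cvec t) ^+ 2) / Normc.normc (1 - hdot (cvec t) a) ^+ 2)).
    by move=> t; rewrite inE => tB; rewrite one_sub_sqr_hnorm_Phi.
  apply: measurable_funTS; apply: measurable_funM.
    apply: measurable_funM => //; apply: measurable_funB => //.
    exact: measurable_sqr_hnorm.
  apply: measurable_funV; apply: measurable_funX; apply: measurable_normc.
  apply: cmeasurableD; first exact: cmeasurable_cst.
  rewrite (_ : (fun _ => _) = fun t => -1 * hdot (cvec t) a); last first.
    by apply/funext => t; rewrite mulN1r.
  by apply: cmeasurableM; [exact: cmeasurable_cst|exact: cmeasurable_hdot].
have X0 (t : m.+1.-tuple (plane R)) : (cvec @^-1` uball) t -> 0 < 1 - hnorm (cvec t) ^+ 2.
  by move=> tB; rewrite subr_gt0 expr_lt1 ?hnorm_ge0.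
have Y0 (t : m.+1.-tuple (plane R)) : (cvec @^-1` uball) t ->
    0 <= 1 - hnorm (Phi a (cvec t)) ^+ 2.
  move=> tB; rewrite one_sub_sqr_hnorm_Phi// divr_ge0 ?sqr_ge0//.
  by rewrite mulr_ge0 ?(ltW (X0 t tB))// subr_ge0 exprn_ile1 ?hnorm_ge0// ltW.
have mX : measurable_fun (cvec @^-1` uball : set (m.+1.-tuple (plane R)))
    (fun t => ((1 - hnorm (cvec t) ^+ 2) ^+ m.+2)^-1).
  apply: measurable_funTS; apply: measurable_funV; apply: measurable_funX.
  by apply: measurable_funB => //; exact: measurable_sqr_hnorm.
have mgr (r : R) : measurable_fun (cvec @^-1` uball : set (m.+1.-tuple (plane R)))
    (fun t => Normc.normc (g (cvec t)) `^ r).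
  exact: (measurableT_comp (measurable_powR _)).
have mw (r : R) : measurable_fun (cvec @^-1` uball : set (m.+1.-tuple (plane R)))
    (fun t => (1 - hnorm (cvec t) ^+ 2) `^ r).
  by apply: measurable_funTS; exact: measurable_weight.
have XV0 (t : m.+1.-tuple (plane R)) : (cvec @^-1` uball) t ->
    0 <= ((1 - hnorm (cvec t) ^+ 2) ^+ m.+2)^-1.
  by move=> tB; rewrite invr_ge0 exprn_ge0// ltW// X0.
rewrite -ge0_integralD//; last 4 first.
- by move=> t _; rewrite lee_fin mulr_ge0 ?powR_ge0.
- by apply/measurable_EFinP; apply: measurable_funM.
- by move=> t tB; rewrite lee_fin mulr_ge0 ?powR_ge0// XV0.
- by apply/measurable_EFinP; apply: measurable_funM.
apply: ge0_le_integral => //.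
- by move=> t tB; rewrite lee_fin mulr_ge0 ?mulr_ge0 ?powR_ge0// XV0.
- apply/measurable_EFinP; apply: measurable_funM => //; apply: measurable_funM => //.
  exact: measurable_funM.
- apply/measurable_EFinP; apply: measurable_funD; exact: measurable_funM.
move=> t tB; rewrite -EFinD lee_fin.
by apply: young_weight; rewrite ?normc_ge0 ?X0 ?Y0.
Qed.

Theorem proposition4p14 (R : realType) (n : nat) (p q s rho : R)
    (d : measure_display) (Omega : measurableType d) (P : probability Omega R)
    (eps : multiindex n -> {RV P >-> R})
    (a : multiindex n -> R[i]) (f : 'rV[R[i]]_n -> R[i]) :
  (0 < n)%N ->
  1 <= p ->
  0 < q ->
  Num.max 0 (1 - q / n%:R) < s ->
  0 < rho ->
  (0 < s < 1 ->
    Num.max 0 (q - n%:R) < rho < (q + n%:R * s - n%:R) / (1 - s)) ->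
  (1 <= s -> Num.max 0 (q - n%:R) < rho) ->
  bernoulli_sequence eps ->
  holomorphic_ball f ->
  power_series_on_ball a f ->
  let k := p * (n%:R + rho) / q in
  in_ell (Num.min 2 k)
    (fun alpha => Normc.normc (a alpha) * sphere_moment alpha k) ->
  {ae P, forall w, Npqs p q s (randomization eps a w)}.
Proof.
move=> n0 p1 q0 smax rho0 H1 H2 Beps _ af k aell.
have [qn taun] := exponent_conditions n0 q0 smax rho0 H1 H2.
have k0 : 0 < k.
  by rewrite /k divr_gt0// mulr_gt0// ?(lt_le_trans ltr01 p1)// (lt_trans q0).
have := ae_randomization_integral_lty Beps af n0 k0 rho0 aell.
apply: filter_app; have := ae_signs_at Beps; apply: filterS => w sw gI.
have wa alpha := normc_random_coef a alpha sw.
split; first exact: (holomorphic_series_value af wa).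
case: n => [//|m] in P eps a f n0 smax H1 H2 Beps af k aell qn taun k0 w sw gI wa *.
apply: (Npqs_integral_bounded q0 qn taun) gI.
exact: (measurable_normc_series_value af wa).
Qed.
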